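(* Let $\underline{\mathcal{E}}=(\mathcal{E}_n)_{n\in\mathbb{Z}}$ be a two-periodic elliptic helix over $X$ with $d:=\dim_k\operatorname{Hom}(\mathcal{E}_{-1},\mathcal{E}_0)>2$, and let $\mu_n$ denote the slope of $\mathcal{E}_n$. Then $\lim_{n\to-\infty}\mu_n$ exists and is irrational.
   Context: $k$ is an algebraically closed field of characteristic zero and $X$ a smooth elliptic curve over $k$. The slope of a vector bundle is its degree divided by its rank. An object $\mathcal{E}$ of $\mathsf{Coh}\,X$ is elliptically exceptional if $\operatorname{Ext}^j(\mathcal{E},\mathcal{E})\cong k$ for $j=0,1$ and is zero otherwise, and for every $\mathcal{F}\in\mathsf{Coh}\,X$ the natural pairing $\operatorname{Hom}(\mathcal{E},\mathcal{F})\otimes\operatorname{Ext}^1(\mathcal{F},\mathcal{E})\to\operatorname{Ext}^1(\mathcal{E},\mathcal{E})=k$ is non-degenerate. $\mathcal{F}$ left mutates through $\mathcal{E}$ if $\operatorname{Ext}^j(\mathcal{E},\mathcal{F})=0$ for $j\neq0$ and the evaluation map $\operatorname{Hom}(\mathcal{E},\mathcal{F})\otimes_k\mathcal{E}\to\mathcal{F}$ is surjective; its kernel is called the left mutation. A two-periodic elliptic helix is a sequence $(\mathcal{E}_i)_{i\in\mathbb{Z}}$ of elliptically exceptional objects of $\mathsf{Coh}\,X$ such that (1) $\operatorname{Ext}^1(\mathcal{E}_i,\mathcal{E}_j)=0$ for all $i<j$, and (2) for all $i$, $\mathcal{E}_i$ left mutates through $\mathcal{E}_{i-1}$ and the left mutation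 is isomorphic to $\mathcal{E}_{i-2}$. It is known that every term of a two-periodic elliptic helix is a simple vector bundle (so slopes are finite) and that $\dim\operatorname{Hom}(\mathcal{E}_i,\mathcal{E}_{i+1})$ is independent of $i$. *)

(* Defs.v *)
From HB Require Import structures.
From mathcomp Require Import all_boot all_order all_algebra.
From mathcomp Require Import all_classical all_reals all_analysis.
From mathcomp Require Import qpoly.
From Stdlib Require Relation_Operators.

Set Implicit Arguments.
Unset Strict Implicit.
Unset Printing Implicit Defensive.

Import Order.TTheory GRing.Theory Num.Theory.
Import numFieldNormedType.Exports.

Local Open Scope classical_set_scope.
Local Open Scope ring_scope.

(******************************************************************************)
(* An elliptic curve X is a smooth Weierstrass cubic in P^2,                  *)
(*   y^2 z + a1 x y z + a3 y z^2 = x^3 + a2 x^2 z + a4 x z^2 + a6 z^3.        *)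
(* Its only point at infinity is [0 : 1 : 0], so X is covered by the affine   *)
(* opens U = {z != 0}, with coordinates x/z, y/z (written x, y), and          *)
(* V = {y != 0}, with coordinates t = x/y, s = z/y. On U, the open U \cap V   *)
(* is the locus y != 0, and on V it is the locus s != 0; there s = 1/y and    *)
(* t = x/y.                                                                   *)
(******************************************************************************)

Record elliptic_curve (k : closedFieldType) := EllipticCurve {
  a1 : k; a2 : k; a3 : k; a4 : k; a6 : k;
  (* Jacobian criterion on U; [0 : 1 : 0] is a smooth point of every
     Weierstrass cubic. *)
  smooth_affine : forall x y : k,
    y ^+ 2 + a1 * x * y + a3 * y = x ^+ 3 + a2 * x ^+ 2 + a4 * x + a6 ->
    ~ (a1 * y - (3%:R * x ^+ 2 + 2%:R * a2 * x + a4) = 0 /\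
       2%:R * y + a1 * x + a3 = 0)
}.

Section Charts.
Variables (k : closedFieldType) (X : elliptic_curve k).

(* The inner variable of {poly {poly k}} is x, the outer one is y. *)
Definition eqnU : {poly {poly k}} :=
  'X^2 + (a1 X *: 'X + (a3 X)%:P)%:P * 'X
  - ('X^3 + a2 X *: 'X^2 + a4 X *: 'X + (a6 X)%:P)%:P.

(* The inner variable is s, the outer one is t: the equation is monic in t. *)
Definition eqnV : {poly {poly k}} :=
  'X^3 + (a2 X *: 'X)%:P * 'X^2 + (a4 X *: 'X^2 - a1 X *: 'X)%:P * 'X
  + (a6 X *: 'X^3 - a3 X *: 'X^2 - 'X)%:P.

Lemma eqnU_size_lead : size eqnU = 3%N /\ lead_coef eqnU = 1.
Proof.
rewrite /eqnU; move: (a1 X *: 'X + _) ('X^3 + _ + _ + _) => b c.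
rewrite -addrA.
have sz : (size ((b%:P * 'X - c%:P)%R) < size ('X^2 : {poly {poly k}})%R)%N.
  rewrite size_polyXn -polyCN -cons_poly_def size_cons_poly.
  by case: ifP => // _; rewrite ltnS (leq_ltn_trans (size_polyC_leq1 _)).
by rewrite size_polyDl // size_polyXn lead_coefDl // lead_coefXn.
Qed.

Lemma eqnV_size_lead : size eqnV = 4%N /\ lead_coef eqnV = 1.
Proof.
rewrite /eqnV; move: (a2 X *: 'X) (a4 X *: _ - _) (a6 X *: _ - _ - _) => b c e.
have -> : 'X^3 + b%:P * 'X^2 + c%:P * 'X + e%:P
  = 'X^3 + ((b%:P * 'X + c%:P) * 'X + e%:P) :> {poly {poly k}}.
  by rewrite mulrDl -mulrA -expr2 !addrA.
have sz : (size (((b%:P * 'X + c%:P) * 'X + e%:P)%R)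
           < size ('X^3 : {poly {poly k}})%R)%N.
  rewrite size_polyXn -!cons_poly_def !size_cons_poly.
  case: ifP => // _; rewrite ltnS; case: ifP => // _.
  by rewrite ltnS (leq_ltn_trans (size_polyC_leq1 _)).
by rewrite size_polyDl // size_polyXn lead_coefDl // lead_coefXn.
Qed.

(* {poly %/ p} is the quotient by p only if p is monic of positive degree. *)
Lemma mk_monic_eqnU : mk_monic eqnU = eqnU.
Proof.
by case: eqnU_size_lead => s l; rewrite /mk_monic s /= monicE l eqxx.
Qed.

Lemma mk_monic_eqnV : mk_monic eqnV = eqnV.
Proof.
by case: eqnV_size_lead => s l; rewrite /mk_monic s /= monicE l eqxx.
Qed.

Definition ringU := {poly %/ eqnU}.
Definition ringV := {poly %/ eqnV}.
HB.instance Definition _ := GRing.ComNzRing.on ringU.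
HB.instance Definition _ := GRing.ComNzRing.on ringV.

Definition constU (c : k) : ringU := in_qpoly eqnU c%:P%:P.
Definition xU : ringU := in_qpoly eqnU 'X%:P.
Definition yU : ringU := in_qpoly eqnU 'X.

Definition constV (c : k) : ringV := in_qpoly eqnV c%:P%:P.
Definition sV : ringV := in_qpoly eqnV 'X%:P.
Definition tV : ringV := in_qpoly eqnV 'X.

End Charts.

Arguments xU {k X}. Arguments yU {k X}. Arguments constU {k X}.
Arguments sV {k X}. Arguments tV {k X}. Arguments constV {k X}.

Definition finitely_generated (A : comNzRingType) (M : lmodType A) :=
  exists (n : nat) (g : 'I_n -> M),
    forall m : M, exists a : 'I_n -> A, m = \sum_i a i *: g i.

(******************************************************************************)
(* Coherent sheaves, by descent along the affine cover X = U \cup V: finitely *)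
(* generated modules over O(U) and O(V) (both rings are noetherian) with a    *)
(* common localization over O(U \cap V) = O(U)[1/y] = O(V)[1/s]. A module     *)
(* over O(U)[1/y] is an O(U)-module on which y acts bijectively, and then s   *)
(* acts as 1/y and t as x/y.                                                  *)
(******************************************************************************)

Record coh (k : closedFieldType) (X : elliptic_curve k) := Coh {
  secU : lmodType (ringU X);
  secV : lmodType (ringV X);
  secUV : lmodType (ringU X);
  resU : {linear secU -> secUV};
  resV : {additive secV -> secUV};
  secU_fg : finitely_generated secU;
  secV_fg : finitely_generated secV;
  secUV_y : bijective (fun w : secUV => yU *: w);
  (* [resV] is linear over O(V) -> O(U \cap V) *)
  resV_const : forall (c : k) v, resV (constV c *: v) = constU c *: resV v;
  resV_s : forall v, yU *: resV (sV *: v) = resV v;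
  resV_t : forall v, yU *: resV (tV *: v) = xU *: resV v;
  (* [resU] is the localization at y *)
  resU_surj : forall w, exists n m, yU ^+ n *: w = resU m;
  resU_ker : forall m, resU m = 0 -> exists n, yU ^+ n *: m = 0;
  (* [resV] is the localization at s *)
  resV_surj : forall w, exists n v, w = yU ^+ n *: resV v;
  resV_ker : forall v, resV v = 0 -> exists n, sV ^+ n *: v = 0
}.

Section CoherentSheaves.
Variables (k : closedFieldType) (X : elliptic_curve k).
Implicit Types A B C E F G K : coh X.

Record hom F G := Hom {
  homU : {linear secU F -> secU G};
  homV : {linear secV F -> secV G};
  homUV : {linear secUV F -> secUV G};
  hom_resU : forall m, homUV (resU F m) = resU G (homU m);
  hom_resV : forall v, homUV (resV F v) = resV G (homV v)
}.

Definition hom_zero F G (f : hom F G) :=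
  (forall m, homU f m = 0) /\ (forall v, homV f v = 0).

Definition hom_id F : hom F F :=
  @Hom F F idfun idfun idfun (fun=> erefl) (fun=> erefl).

Fact scalar_resU F (c : k) m : constU c *: resU F m = resU F (constU c *: m).
Proof. by rewrite linearZ. Qed.

Fact scalar_resV F (c : k) v : constU c *: resV F v = resV F (constV c *: v).
Proof. by rewrite resV_const. Qed.

Definition hom_scalar F (c : k) : hom F F :=
  @Hom F F (constU c \*: idfun) (constV c \*: idfun) (constU c \*: idfun)
    (scalar_resU c) (scalar_resV c).

(* The component over U \cap V is determined by those over U and V. *)
Definition is_hom_basis F G (n : nat) (b : 'I_n -> hom F G) :=
  forall f : hom F G, exists! c : 'rV[k]_n,
    (forall m, homU f m = \sum_i constU (c 0 i) *: homU (b i) m) /\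
    (forall v, homV f v = \sum_i constV (c 0 i) *: homV (b i) v).

Definition hom_dim F G (n : nat) :=
  exists b : 'I_n -> hom F G, is_hom_basis b.

Definition epi F G (p : hom F G) :=
  (forall m, exists m', homU p m' = m) /\ (forall v, exists v', homV p v' = v).

Definition short_exact F G K (i : hom F G) (p : hom G K) :=
  [/\ injective (homU i) /\ injective (homV i),
      epi p,
      forall m, homU p m = 0 <-> exists m', homU i m' = m &
      forall v, homV p v = 0 <-> exists v', homV i v' = v].

(* Extensions 0 -> B -> mid -> A -> 0 *)
Record ext1 A B := Ext1 {
  mid : coh X;
  inj : hom B mid;
  prj : hom mid A;
  ext1_exact : short_exact inj prj
}.

(* xi -> xi' is a morphism of extensions which is a on A and b on B; that is,
   the pushout of xi along b is equivalent to the pullback of xi' along a. *)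
Definition ext1_mor A B A' B' (a : hom A A') (b : hom B B')
    (xi : ext1 A B) (xi' : ext1 A' B') :=
  exists f : hom (mid xi) (mid xi'),
    [/\ forall m, homU f (homU (inj xi) m) = homU (inj xi') (homU b m),
        forall v, homV f (homV (inj xi) v) = homV (inj xi') (homV b v),
        forall m, homU a (homU (prj xi) m) = homU (prj xi') (homU f m) &
        forall v, homV a (homV (prj xi) v) = homV (prj xi') (homV f v)].

(* Yoneda n-extensions 0 -> B -> X_n -> ... -> X_1 -> A -> 0, n >= 1, cut into
   short exact sequences. *)
Inductive yext : nat -> coh X -> coh X -> Type :=
| YOne A B : ext1 A B -> yext 1 A B
| YSplice n A C B : ext1 A C -> yext n C B -> yext n.+1 A B.

Inductive yext_mor : forall n A B A' B',
  hom A A' -> hom B B' -> yext n A B -> yext n A' B' -> Prop :=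
| YOne_mor A B A' B' (a : hom A A') (b : hom B B') xi xi' :
    ext1_mor a b xi xi' -> yext_mor a b (YOne xi) (YOne xi')
| YSplice_mor n A C B A' C' B'
    (a : hom A A') (c : hom C C') (b : hom B B')
    (xi : ext1 A C) (xi' : ext1 A' C') (eta : yext n C B) (eta' : yext n C' B') :
    ext1_mor a c xi xi' -> yext_mor c b eta eta' ->
    yext_mor a b (YSplice xi eta) (YSplice xi' eta').

Definition yext_equiv n A B : yext n A B -> yext n A B -> Prop :=
  Relation_Operators.clos_refl_sym_trans _
    (fun xi xi' => yext_mor (hom_id A) (hom_id B) xi xi').

(* Ext^n(A, B) = 0, for n >= 1: all n-extensions have the same class. *)
Definition ext_vanishes (n : nat) A B :=
  forall xi xi' : yext n A B, yext_equiv xi xi'.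

(* Multiplication by c on Ext^1(A, B) is the pushout along c on B; so
   Ext^1(A, B) is isomorphic to k iff, for some class xi0, the map sending c to
   c xi0 is a bijection from k to Ext^1(A, B). *)
Definition ext1_line A B :=
  exists xi0 : ext1 A B, forall xi : ext1 A B,
    exists! c : k, ext1_mor (hom_id A) (hom_scalar B c) xi0 xi.

(* xi is the zero class *)
Definition ext1_split A B (xi : ext1 A B) :=
  exists r : hom A (mid xi),
    (forall m, homU (prj xi) (homU r m) = m) /\
    (forall v, homV (prj xi) (homV r v) = v).

(* The pairing Hom(E, F) x Ext^1(F, E) -> Ext^1(E, E) is the pullback of
   extensions along morphisms. *)
Definition pairing_zero E F (f : hom E F) (xi : ext1 F E) :=
  exists eta : ext1 E E, ext1_mor f (hom_id E) eta xi /\ ext1_split eta.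

Definition pairing_nondegenerate E F :=
  (forall f : hom E F, (forall xi, pairing_zero f xi) -> hom_zero f) /\
  (forall xi : ext1 F E, (forall f, pairing_zero f xi) -> ext1_split xi).

Definition elliptically_exceptional E :=
  [/\ hom_dim E E 1,
      ext1_line E E,
      forall j, (1 < j)%N -> ext_vanishes j E E &
      forall F, pairing_nondegenerate E F].

(* The sheaf E^n; for a basis b of Hom(E, F) with n elements it is
   Hom(E, F) \otimes_k E. *)
Section Power.
Variables (E : coh X) (n : nat).
Local Notation PU := {ffun 'I_n -> secU E}.
Local Notation PV := {ffun 'I_n -> secV E}.
Local Notation PUV := {ffun 'I_n -> secUV E}.

Definition power_resU (m : PU) : PUV := [ffun i => resU E (m i)].
Definition power_resV (v : PV) : PUV := [ffun i => resV E (v i)].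

Fact power_resU_linear : linear power_resU.
Proof. by move=> a u v; apply/ffunP=> i; rewrite !ffunE linearP. Qed.
HB.instance Definition _ :=
  GRing.isLinear.Build (ringU X) PU PUV _ power_resU power_resU_linear.

Fact power_resV_additive : zmod_morphism power_resV.
Proof. by move=> u v; apply/ffunP=> i; rewrite !ffunE raddfB. Qed.
HB.instance Definition _ :=
  GRing.isZmodMorphism.Build PV PUV power_resV power_resV_additive.

Fact power_fg (A : comNzRingType) (M : lmodType A) :
  finitely_generated M -> finitely_generated {ffun 'I_n -> M}.
Proof.
case=> d [g gP].
exists #|{: 'I_n * 'I_d}|.
exists (fun j => [ffun i => (i == (enum_val j).1)%:R *: g (enum_val j).2]) => m.
have /choice[a aP] : forall i, exists a : 'I_d -> A, m i = \sum_j a j *: g j.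
  by move=> i; apply: gP.
exists (fun j => a (enum_val j).1 (enum_val j).2).
apply/ffunP => i; rewrite sum_ffunE aP.
pose G (p : 'I_n * 'I_d) := a p.1 p.2 *: ((i == p.1)%:R *: g p.2).
transitivity (\sum_p G p); last first.
  rewrite (reindex (@enum_val _ {: 'I_n * 'I_d})) /=; last first.
    by exists enum_rank => p _; rewrite ?enum_valK ?enum_rankK.
  by apply: eq_bigr => j _; rewrite !ffunE.
rewrite -(pair_bigA _ (fun i' j => G (i', j))) /= (bigD1 i) //=.
rewrite [X in _ + X]big1 ?addr0.
  by apply: eq_bigr => j _; rewrite /G eqxx scale1r.
move=> i' /negPf ne; apply: big1 => j _.
by rewrite /G eq_sym ne scale0r scaler0.
Qed.

(* Uniform bound for finitely many exponents. *)
Let bound (P : 'I_n -> nat -> Prop) :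
  (forall i e e', (e <= e')%N -> P i e -> P i e') ->
  (forall i, exists e, P i e) -> exists e, forall i, P i e.
Proof.
move=> mono /choice[e eP]; exists (\max_i e i) => i.
by apply: mono (eP i); apply: leq_bigmax.
Qed.

Fact power_y : bijective (fun w : PUV => yU *: w).
Proof.
have [g gK Kg] := secUV_y E.
by exists (fun w : PUV => [ffun i => g (w i)]) => w; apply/ffunP=> i;
  rewrite !ffunE ?gK ?Kg.
Qed.

Fact power_resV_const (c : k) v :
  power_resV (constV c *: v) = constU c *: power_resV v.
Proof. by apply/ffunP=> i; rewrite !ffunE resV_const. Qed.

Fact power_resV_s v : yU *: power_resV (sV *: v) = power_resV v.
Proof. by apply/ffunP=> i; rewrite !ffunE resV_s. Qed.

Fact power_resV_t v : yU *: power_resV (tV *: v) = xU *: power_resV v.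
Proof. by apply/ffunP=> i; rewrite !ffunE resV_t. Qed.

Fact power_resU_surj (w : PUV) : exists e m, yU ^+ e *: w = power_resU m.
Proof.
have [|i|e eP] := @bound (fun i e => exists m, yU ^+ e *: w i = resU E m).
- move=> i e e' le [m mE]; exists (yU ^+ (e' - e) *: m).
  by rewrite linearZ /= -mE scalerA -exprD subnK.
- exact: resU_surj.
- have [m mE] := choice eP; exists e, (finfun m).
  by apply/ffunP=> i; rewrite !ffunE mE.
Qed.

Fact power_resU_ker m : power_resU m = 0 -> exists e, yU ^+ e *: m = 0.
Proof.
move=> m0; have [|i|e eP] := @bound (fun i e => yU ^+ e *: m i = 0).
- by move=> i e e' le m0'; rewrite -(subnK le) exprD -scalerA m0' scaler0.
- by apply: resU_ker; move/ffunP: m0 => /(_ i); rewrite !ffunE.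
- by exists e; apply/ffunP=> i; rewrite !ffunE.
Qed.

Fact power_resV_surj (w : PUV) : exists e v, w = yU ^+ e *: power_resV v.
Proof.
have [|i|e eP] := @bound (fun i e => exists v, w i = yU ^+ e *: resV E v).
- move=> i e e' le [v ->]; exists (sV ^+ (e' - e) *: v).
  rewrite -(subnKC le) exprD -scalerA addKn; congr (_ *: _).
  elim: (e' - e)%N => [|j IH]; first by rewrite !expr0 !scale1r.
  by rewrite IH exprSr -scalerA exprS -scalerA resV_s.
- exact: resV_surj.
- have [v vE] := choice eP; exists e, (finfun v).
  by apply/ffunP=> i; rewrite !ffunE vE.
Qed.

Fact power_resV_ker v : power_resV v = 0 -> exists e, sV ^+ e *: v = 0.
Proof.
move=> v0; have [|i|e eP] := @bound (fun i e => sV ^+ e *: v i = 0).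
- by move=> i e e' le v0'; rewrite -(subnK le) exprD -scalerA v0' scaler0.
- by apply: resV_ker; move/ffunP: v0 => /(_ i); rewrite !ffunE.
- by exists e; apply/ffunP=> i; rewrite !ffunE.
Qed.

Definition power : coh X :=
  @Coh k X PU PV PUV power_resU power_resV
    (power_fg (@secU_fg _ _ E)) (power_fg (@secV_fg _ _ E)) power_y
    power_resV_const power_resV_s power_resV_t
    power_resU_surj power_resU_ker power_resV_surj power_resV_ker.

End Power.

Section Evaluation.
Variables (E F : coh X) (n : nat) (b : 'I_n -> hom E F).

Definition evalU (e : secU (power E n)) : secU F := \sum_i homU (b i) (e i).
Definition evalV (e : secV (power E n)) : secV F := \sum_i homV (b i) (e i).
Definition evalUV (e : secUV (power E n)) : secUV F := \sum_i homUV (b i) (e i).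

Fact evalU_linear : linear evalU.
Proof.
move=> a u v; rewrite /evalU scaler_sumr -big_split; apply: eq_bigr => i _ /=.
by rewrite !ffunE linearP.
Qed.
HB.instance Definition _ := GRing.isLinear.Build _ _ _ _ evalU evalU_linear.

Fact evalV_linear : linear evalV.
Proof.
move=> a u v; rewrite /evalV scaler_sumr -big_split; apply: eq_bigr => i _ /=.
by rewrite !ffunE linearP.
Qed.
HB.instance Definition _ := GRing.isLinear.Build _ _ _ _ evalV evalV_linear.

Fact evalUV_linear : linear evalUV.
Proof.
move=> a u v; rewrite /evalUV scaler_sumr -big_split; apply: eq_bigr => i _ /=.
by rewrite !ffunE linearP.
Qed.
HB.instance Definition _ := GRing.isLinear.Build _ _ _ _ evalUV evalUV_linear.

Fact eval_resU e : evalUV (resU (power E n) e) = resU F (evalU e).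
Proof.
rewrite /evalUV /evalU linear_sum; apply: eq_bigr => i _ /=.
by rewrite ffunE hom_resU.
Qed.

Fact eval_resV e : evalUV (resV (power E n) e) = resV F (evalV e).
Proof.
rewrite /evalUV /evalV raddf_sum; apply: eq_bigr => i _ /=.
by rewrite ffunE hom_resV.
Qed.

Definition evaluation : hom (power E n) F :=
  @Hom (power E n) F evalU evalV evalUV eval_resU eval_resV.

End Evaluation.

Definition left_mutates E F :=
  (forall j, (0 < j)%N -> ext_vanishes j E F) /\
  exists (n : nat) (b : 'I_n -> hom E F),
    is_hom_basis b /\ epi (evaluation b).

(* K is isomorphic to the kernel of Hom(E, F) \otimes_k E -> F. *)
Definition is_left_mutation K E F :=
  exists (n : nat) (b : 'I_n -> hom E F) (i : hom K (power E n)),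
    is_hom_basis b /\ short_exact i (evaluation b).

Definition two_periodic_elliptic_helix (E : int -> coh X) :=
  [/\ forall i, elliptically_exceptional (E i),
      forall i j, i < j -> ext_vanishes 1 (E i) (E j),
      forall i, left_mutates (E (i - 1)) (E i) &
      forall i, is_left_mutation (E (i - 2)) (E (i - 1)) (E i)].

(* Rank at the generic point: the maximal number of O(U)-linearly independent
   sections over U. Here and below [xget] picks the unique number with the
   given property; it exists for every coherent sheaf. *)
Definition independent E (r : nat) (m : 'I_r -> secU E) :=
  forall a : 'I_r -> ringU X, \sum_i a i *: m i = 0 -> forall i, a i = 0.

Definition rank E : nat :=
  xget 0%N [set r | (exists m : 'I_r -> secU E, independent m) /\
               (forall m : 'I_r.+1 -> secU E, ~ independent m)].

(* Cech cohomology of the cover {U, V}: the kernel and the cokernel of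
   F(U) (+) F(V) -> F(U \cap V). *)
Definition h0 E : nat :=
  xget 0%N [set n | exists (m : 'I_n -> secU E) (v : 'I_n -> secV E),
    (forall i, resU E (m i) = resV E (v i)) /\
    forall m' v', resU E m' = resV E v' -> exists! c : 'rV[k]_n,
      m' = \sum_i constU (c 0 i) *: m i /\ v' = \sum_i constV (c 0 i) *: v i].

Definition h1 E : nat :=
  xget 0%N [set n | exists w : 'I_n -> secUV E,
    forall w', exists! c : 'rV[k]_n, exists m v,
      w' = \sum_i constU (c 0 i) *: w i + (resU E m - resV E v)].

Definition euler_char E : int := (h0 E)%:Z - (h1 E)%:Z.

(* E is O_X: there is a section over X that generates E freely. *)
Definition is_structure_sheaf E :=
  exists (m : secU E) (v : secV E),
    [/\ resU E m = resV E v,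
        forall m', exists! a : ringU X, m' = a *: m &
        forall v', exists! a : ringV X, v' = a *: v].

Definition euler_char_structure_sheaf : int :=
  xget 0 [set c | exists E, is_structure_sheaf E /\ c = euler_char E].

(* deg E = chi(E) - rank(E) chi(O_X) *)
Definition degree E : int :=
  euler_char E - (rank E)%:Z * euler_char_structure_sheaf.

Definition slope E : rat := (degree E)%:~R / (rank E)%:R.

End CoherentSheaves.

(* Main.v *)
From HB Require Import structures.
From mathcomp Require Import all_boot all_order all_algebra.
From mathcomp Require Import all_classical all_reals all_analysis.
From mathcomp Require Import qpoly ring lra zify.
Require Import Defs.

(** Why the limit exists and is irrational.

    Write [r i] for the rank and [chi i] for the Euler characteristic of [E i]; the slope is
    [chi i / r i] up to the constant [chi(O)]. If [n] is the dimension of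
    [Hom(E (i - 1), E i)], the mutation sequence [0 -> E (i - 2) -> E (i - 1) ^ n -> E i -> 0]
    gives [r (i - 2) = n r (i - 1) - r i], and the same for [chi]. Riemann-Roch identifies [n]
    with the determinant [r (i - 1) chi i - r i chi (i - 1)], and the recurrences show that this
    determinant does not depend on [i]; so [n] is [d] throughout ([helix_numbers]). Both
    sequences thus satisfy [z (i - 2) = d z (i - 1) - z i]. With [be < 1] the smaller root of
    [z ^ 2 - d z + 1], a suitable combination of them decays geometrically as [i] decreases, so
    [chi / r]
    converges to a quotient of two linear forms in [be] with integer coefficients and determinant
    [+- d]. As [d > 2], [be] is irrational, and so is the limit ([recurrence_limit]).

    The geometric part takes place on the two charts. Three points carry it.

    Riemann-Roch. [H^0] and [H^1] of [F] are the kernel and the cokernel of the Cech complex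
    [F(U) x F(V) -> F(U cap V)], and [Hom(E, F)], [Ext^1(E, F)] those of a similar complex of
    homomorphisms ([cech_index], [hom_index]). If [F' -> F] is injective with cokernels of finite
    length, both indices change by lengths, and, since a torsion-free [E] has a basis of [r]
    elements near every point, the maps from [E] to a module of length [l] form a space of
    dimension [r l] ([dim_hom_to]). Two torsion-free sheaves of equal rank contain a common twist,
    so the index of [Hom(E, -)] and [r] times the Euler characteristic have the same difference
    on them ([index_same_rank]). Applied to [F ^ (rank G)] and [G ^ (rank F)] this yields
    [riemann_roch], once the index of [Hom(F, F)] is zero.

    The index of [Hom(E, E)]. Cocycles in the second complex define extensions
    ([cocycle_split]), so the cokernel vanishes when all extensions split, and it has dimension at
    most one when the extension classes form a line. It is not zero for [Hom(E, E)]: otherwise,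
    for a non-split self-extension [M], the index of [Hom(E, M)] would be two, and a second
    morphism from [E] to [M] would split it ([self_index]).

    Torsion. An elliptically exceptional sheaf may be a skyscraper. A simple sheaf with torsion
    maps onto the residue field of a point which it also contains, and the composition is a
    scalar only for a skyscraper ([simple_torsion_free]). Through the mutation sequences one
    skyscraper in the helix makes all terms skyscrapers, between which there are too few morphisms
    for [d > 2] ([helix_torsion_free]). For a simple torsion-free sheaf, sections of a
    very negative twist give endomorphisms, which bounds [H^0] ([negative_twist]); [H^1] is
    bounded by explicit generators ([cech_coker_finite]). *)

Set Implicit Arguments.
Unset Strict Implicit.
Unset Printing Implicit Defensive.

Import Order.TTheory GRing.Theory Num.Theory.
Import numFieldNormedType.Exports.

Local Open Scope classical_set_scope.
Local Open Scope ring_scope.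

(** * Identities in abelian groups *)

Inductive zexpr := ZVar of nat | ZZero | ZAdd of zexpr & zexpr | ZOpp of zexpr.

Section ZModReflection.
Variable M : zmodType.

Fixpoint zeval (env : seq M) (e : zexpr) : M :=
  match e with
  | ZVar n => nth 0 env n
  | ZZero => 0
  | ZAdd a b => zeval env a + zeval env b
  | ZOpp a => - zeval env a
  end.

Fixpoint zcoef (e : zexpr) (i : nat) : int :=
  match e with
  | ZVar n => (n == i)%:Z
  | ZZero => 0
  | ZAdd a b => zcoef a i + zcoef b i
  | ZOpp a => - zcoef a i
  end.

Lemma zevalE env e : zeval env e = \sum_(i < size env) nth 0 env i *~ zcoef e i.
Proof.
elim: e => [n||a IHa b IHb|a IHa] /=.
- have [lt|le] := ltnP n (size env); last first.
    rewrite nth_default // big1 // => i _.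
    by rewrite gtn_eqF ?mulr0z // (leq_trans (ltn_ord i)).
  rewrite (bigD1 (Ordinal lt)) //= eqxx mulr1z big1 ?addr0 // => i.
  rewrite -val_eqE /= eq_sym => /negPf ->; exact: mulr0z.
- by rewrite big1 // => i _; rewrite mulr0z.
- by rewrite IHa IHb -big_split; apply: eq_bigr => i _; rewrite mulrzDr.
- by rewrite IHa -sumrN; apply: eq_bigr => i _; rewrite mulrNz.
Qed.

Lemma zeval_eq env e e' :
  all (fun i => zcoef e i == zcoef e' i) (iota 0 (size env)) -> zeval env e = zeval env e'.
Proof.
move=> /allP h; rewrite !zevalE; apply: eq_bigr => i _.
by rewrite (eqP (h i _)) // mem_iota ltn_ord.
Qed.

End ZModReflection.

Ltac zmod_index x env :=
  match env with
  | ?y :: _ => let _ := match goal with _ => unify x y end in constr:(0%N)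
  | _ :: ?t => let n := zmod_index x t in constr:(n.+1)
  end.
Ltac zmod_mem x env :=
  match env with
  | ?y :: _ => let _ := match goal with _ => unify x y end in constr:(true)
  | _ :: ?t => zmod_mem x t
  | _ => constr:(false)
  end.
Ltac zmod_atoms e env :=
  lazymatch e with
  | (?a + ?b)%R => let env := zmod_atoms a env in zmod_atoms b env
  | (- ?a)%R => zmod_atoms a env
  | 0%R => env
  | _ => let b := zmod_mem e env in
         lazymatch b with true => env | _ => constr:(e :: env) end
  end.
Ltac zmod_reify e env :=
  lazymatch e with
  | (?a + ?b)%R => let a := zmod_reify a env in let b := zmod_reify b env in constr:(ZAdd a b)
  | (- ?a)%R => let a := zmod_reify a env in constr:(ZOpp a)
  | 0%R => constr:(ZZero)
  | _ => let n := zmod_index e env in constr:(ZVar n)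
  end.
(** Decides equations that hold in every abelian group. *)
Ltac zmod :=
  lazymatch goal with
  | |- @eq ?T ?l ?r =>
    let env := zmod_atoms l (@nil T) in let env := zmod_atoms r env in
    let l' := zmod_reify l env in let r' := zmod_reify r env in
    exact (@zeval_eq _ env l' r' isT)
  end.

(** * Independence and relative dimension *)

Section Submodules.
Variables (A : pzRingType) (M : lmodType A).
Implicit Types (P Q : M -> Prop).

(** Subspaces are predicates in [Prop]: they live in spaces of functions and of sections,
    which are infinite-dimensional and have no decidable membership. *)
Definition submodule P := P 0 /\ forall (a : A) u v, P u -> P v -> P (a *: u + v).

Definition indep_mod Q n (v : 'I_n -> M) :=
  forall a : 'I_n -> A, Q (\sum_i a i *: v i) -> forall i, a i = 0.

Definition span_of n (v : 'I_n -> M) : M -> Prop :=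
  fun m => exists a : 'I_n -> A, m = \sum_i a i *: v i.

Lemma submod0 P : submodule P -> P 0. Proof. by case. Qed.

Lemma submodD P u v : submodule P -> P u -> P v -> P (u + v).
Proof. by case=> _ h Pu Pv; rewrite -[u]scale1r; apply: h. Qed.

Lemma submodZ P a u : submodule P -> P u -> P (a *: u).
Proof. by case=> P0 h Pu; rewrite -[_ *: _]addr0; apply: h. Qed.

Lemma submodN P u : submodule P -> P u -> P (- u).
Proof. by move=> sP Pu; rewrite -scaleN1r; apply: submodZ. Qed.

Lemma submodB P u v : submodule P -> P u -> P v -> P (u - v).
Proof. by move=> sP Pu Pv; apply: submodD => //; apply: submodN. Qed.

Lemma submod_sum P (I : Type) (r : seq I) (p : pred I) (F : I -> M) :
  submodule P -> (forall i, p i -> P (F i)) -> P (\sum_(i <- r | p i) F i).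
Proof.
move=> sP h; elim/big_ind: _ => //; first exact: submod0.
by move=> u v; apply: submodD.
Qed.

Lemma submod_lc P n (a : 'I_n -> A) (v : 'I_n -> M) :
  submodule P -> (forall i, P (v i)) -> P (\sum_i a i *: v i).
Proof. by move=> sP h; apply: submod_sum => // i _; apply: submodZ. Qed.

Lemma submodDr P u v : submodule P -> P v -> P (u + v) <-> P u.
Proof.
by move=> sP Pv; split=> h; [rewrite -[u](addrK v); apply: submodB | apply: submodD].
Qed.

Lemma submod_eq P u v : submodule P -> P (u - v) -> P v -> P u.
Proof. by move=> sP Puv Pv; rewrite -[u](subrK v); apply: submodD. Qed.

Lemma submodBC P u v : submodule P -> P (u - v) -> P (v - u).
Proof. by move=> sP h; rewrite -opprB; apply: submodN. Qed.

Lemma submod_span n (v : 'I_n -> M) : submodule (span_of v).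
Proof.
split; first by exists (fun=> 0); rewrite big1 // => i _; rewrite scale0r.
move=> c _ _ [a ->] [b ->]; exists (fun i => c * a i + b i).
by rewrite scaler_sumr -big_split; apply: eq_bigr => i _; rewrite scalerDl scalerA.
Qed.

Lemma span_gen n (v : 'I_n -> M) i : span_of v (v i).
Proof.
exists (fun j => (j == i)%:R); rewrite (bigD1 i) //= eqxx scale1r big1 ?addr0 //.
by move=> j /negPf ->; rewrite scale0r.
Qed.

Lemma submod_zero : submodule (fun m : M => m = 0).
Proof. by split=> // a u v -> ->; rewrite scaler0 addr0. Qed.

Lemma submod_top : submodule (fun m : M => True).
Proof. by []. Qed.

Lemma submodI P Q : submodule P -> submodule Q -> submodule (fun m => P m /\ Q m).
Proof.
move=> sP sQ; split; first by split; exact: submod0.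
by move=> a u v [? ?] [? ?]; split; apply: submodD => //; apply: submodZ.
Qed.

Lemma indep_pair Q n (v : 'I_n -> M) i j a b : indep_mod Q v -> i != j ->
  Q (a *: v i + b *: v j) -> a = 0 /\ b = 0.
Proof.
move=> ind ij Qab; pose c l : A := if l == i then a else if l == j then b else 0.
have ci : c i = a by rewrite /c eqxx.
have cj : c j = b by rewrite /c eq_sym (negPf ij) eqxx.
have c0 : forall l, c l = 0.
  apply: ind; rewrite (bigD1 i) //= (bigD1 j) 1?eq_sym //= big1 ?addr0 ?ci ?cj // => l.
  by move=> /andP[/negPf li /negPf lj]; rewrite /c li lj scale0r.
by rewrite -ci -cj !c0.
Qed.

End Submodules.

Lemma submod_preim (A : pzRingType) (M N : lmodType A) (f : {linear M -> N})
    (P : N -> Prop) : submodule P -> submodule (fun m => P (f m)).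
Proof.
move=> sP; split; first by rewrite linear0; exact: submod0.
by move=> a u v Pu Pv; rewrite linearP; apply: submodD => //; apply: submodZ.
Qed.

Lemma submod_im (A : pzRingType) (M N : lmodType A) (f : {linear M -> N})
    (P : M -> Prop) : submodule P -> submodule (fun n => exists2 m, P m & n = f m).
Proof.
move=> sP; split; first by exists 0; [exact: submod0 | rewrite linear0].
move=> a _ _ [u Pu ->] [v Pv ->]; exists (a *: u + v); last by rewrite linearP.
by apply: submodD => //; apply: submodZ.
Qed.

Lemma submod_add (A : pzRingType) (M : lmodType A) (P Q : M -> Prop) :
  submodule P -> submodule Q ->
  submodule (fun m => exists p q, [/\ P p, Q q & m = p + q]).
Proof.
move=> sP sQ; split; first by exists 0, 0; split; rewrite ?addr0 //; exact: submod0.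
move=> a _ _ [p [q [Pp Qq ->]]] [p' [q' [Pp' Qq' ->]]].
exists (a *: p + p'), (a *: q + q'); split.
- by apply: submodD => //; apply: submodZ.
- by apply: submodD => //; apply: submodZ.
- by rewrite scalerDr addrACA.
Qed.

(** Coordinates with respect to a family that is a basis up to the factor [h]. *)
Lemma coordinates (A : comNzRingType) (M : lmodType A) r (m : 'I_r -> M) (h : A) :
  indep_mod (fun x => x = 0) m -> (forall x, span_of m (h *: x)) ->
  exists co : M -> 'I_r -> A, [/\ forall x, h *: x = \sum_i co x i *: m i,
    forall a u v i, co (a *: u + v) i = a * co u i + co v i &
    forall i j, co (m j) i = h * (i == j)%:R].
Proof.
move=> ind sp; have [co coP] := choice sp.
have coU x a : h *: x = \sum_i a i *: m i -> forall i, co x i = a i.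
  move=> hx i; apply/eqP; rewrite -subr_eq0; apply/eqP.
  apply: (ind (fun i => co x i - a i)).
  under eq_bigr do rewrite scalerBl.
  by rewrite sumrB -coP -hx subrr.
exists co; split=> // [a u v|i j].
  apply: (coU _ (fun i => a * co u i + co v i)).
  rewrite scalerDr scalerA mulrC -scalerA !coP scaler_sumr -big_split /=.
  by apply: eq_bigr => j _; rewrite scalerDl scalerA.
apply: (coU _ (fun i => h * (i == j)%:R)).
rewrite (bigD1 j) //= eqxx mulr1 big1 ?addr0 // => l /negPf ->.
by rewrite mulr0 scale0r.
Qed.

Lemma two_scalars_dependent (k : fieldType) (c d : k) :
  ~ (forall a b, a * c + b * d = 0 -> a = 0 /\ b = 0).
Proof.
move=> h; have [d0 _] : d = 0 /\ - c = 0 by apply: h; rewrite mulNr mulrC subrr.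
have [|_ /eqP] := h 0 1; last by rewrite oner_eq0.
by rewrite d0 mul0r mulr0 addr0.
Qed.

Definition is_domain (A : comNzRingType) := forall a b : A, a * b = 0 -> a = 0 \/ b = 0.

Lemma field_is_domain (k : fieldType) : is_domain k.
Proof. by move=> a b /eqP; rewrite mulf_eq0 => /orP[/eqP|/eqP]; auto. Qed.

(** Fraction-free elimination: pivot on a nonzero entry of the last column. *)
Lemma dependent_rows (A : comNzRingType) : is_domain A ->
  forall n m (B : 'I_m -> 'I_n -> A), (n < m)%N ->
  exists2 c : 'I_m -> A, exists i, c i <> 0 & forall j, \sum_i c i * B i j = 0.
Proof.
move=> dom; elim=> [|n IHn] m B.
  case: m B => // m B _; exists (fun=> 1); last by case.
  by exists ord0 => /eqP; rewrite oner_eq0.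
move=> lt; have [[i0 piv]|nopiv] := pselect (exists i, B i ord_max <> 0).
  case: m B i0 piv lt => [|m] B i0 piv lt; first by case: i0 {piv}.
  set p := B i0 ord_max in piv.
  pose B' i (j : 'I_n) := p * B (lift i0 i) (lift ord_max j)
                          - B (lift i0 i) ord_max * B i0 (lift ord_max j).
  have [|c [i ci] cB] := IHn m B'; first by rewrite -ltnS.
  pose s := - \sum_i c i * B (lift i0 i) ord_max.
  exists (fun l => if unlift i0 l is Some i' then p * c i' else s).
    by exists (lift i0 i); rewrite liftK => /dom[].
  move=> j; rewrite (bigD1_ord i0) //= unlift_none.
  under eq_bigr do rewrite liftK.
  have [j'|] := unliftP ord_max j; last first.
    move=> ->; rewrite mulNr mulrC mulr_sumr; apply/eqP; rewrite addrC subr_eq0.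
    by apply/eqP; apply: eq_bigr => l _; rewrite -/p mulrA.
  move=> ->; rewrite -[RHS](cB j') /B' mulNr mulr_suml addrC -sumrB.
  apply: eq_bigr => l _; ring.
pose B' i (j : 'I_n) := B i (lift ord_max j).
have [|c nz cB] := IHn m B'; first by rewrite ltnW.
exists c => // j; have [j' ->|->] := unliftP ord_max j; first exact: cB.
rewrite big1 // => i _; suff -> : B i ord_max = 0 by rewrite mulr0.
by apply: contra_notP nopiv => h; exists i.
Qed.

Section IndepBound.
Variables (A : comNzRingType) (M : lmodType A) (dom : is_domain A).
Implicit Types (P Q : M -> Prop).

(** Coordinates up to a common nonzero factor are enough, since linear dependence over a
    domain is insensitive to such factors. *)
Lemma indep_bound Q n (w : 'I_n -> M) m (v : 'I_m -> M) h : submodule Q ->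
  h <> 0 -> (forall i, exists a : 'I_n -> A, Q (h *: v i - \sum_j a j *: w j)) ->
  indep_mod Q v -> (m <= n)%N.
Proof.
move=> sQ h0 sp ind; rewrite leqNgt; apply/negP => lt.
have [B BP] := choice sp.
have [c [i ci] cB] := dependent_rows dom B lt.
have /ind/(_ i)/dom[//|//] : Q (\sum_i (h * c i) *: v i).
have -> : \sum_i (h * c i) *: v i
          = \sum_i c i *: (h *: v i - \sum_j B i j *: w j).
  rewrite [RHS](eq_bigr (fun i => (h * c i) *: v i
            - \sum_j (c i * B i j) *: w j)); last first.
    move=> l _; rewrite scalerBr scalerA mulrC scaler_sumr; congr (_ - _).
    by apply: eq_bigr => j _; rewrite scalerA.
  rewrite sumrB exchange_big /= [X in _ - X]big1 ?subr0 // => j _.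
  by rewrite -scaler_suml cB scale0r.
by apply: submod_lc.
Qed.

End IndepBound.

Section Dimension.
Variables (k : fieldType).

(** [dim_quo P Q n]: the vectors of [P] taken modulo [Q] form a space of
    dimension [n]; [P] and [Q] are subspaces of a common, possibly
    infinite-dimensional, space. *)
Definition dim_quo (V : lmodType k) (P Q : V -> Prop) (n : nat) :=
  exists v : 'I_n -> V, [/\ forall i, P (v i), indep_mod Q v &
    forall p, P p -> exists a : 'I_n -> k, Q (p - \sum_i a i *: v i)].

Section OneSpace.
Variable V : lmodType k.
Implicit Types P Q : V -> Prop.

Lemma dim_bound P Q n m (v : 'I_m -> V) : submodule Q -> dim_quo P Q n ->
  (forall i, P (v i)) -> indep_mod Q v -> (m <= n)%N.
Proof.
move=> sQ [w [_ _ sp]] Pv; apply: (indep_bound (@field_is_domain k) sQ (h := 1)).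
  by apply/eqP; exact: oner_neq0.
by move=> i; rewrite scale1r; apply: sp.
Qed.

Lemma dim_uniq P Q n m : submodule Q -> dim_quo P Q n -> dim_quo P Q m -> n = m.
Proof.
move=> sQ dn dm; apply/eqP; rewrite eqn_leq; apply/andP; split.
  by case: dn => v [Pv ind _]; apply: dim_bound dm Pv ind.
by case: dm => v [Pv ind _]; apply: dim_bound dn Pv ind.
Qed.

(** A maximal independent family is a basis. *)
Lemma dim_exists P Q n : submodule P -> submodule Q ->
  (forall m (v : 'I_m -> V), (forall i, P (v i)) -> indep_mod Q v -> (m <= n)%N) ->
  exists2 d, dim_quo P Q d & (d <= n)%N.
Proof.
move=> sP sQ bd.
pose good m := `[< exists v : 'I_m -> V, (forall i, P (v i)) /\ indep_mod Q v >].
have ex0 : exists m, good m.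
  by exists 0%N; apply/asboolP; exists (fun _ => 0); split; [by case | by move=> ? ? []].
have ub m : good m -> (m <= n)%N by move=> /asboolP[v [Pv ind]]; apply: bd Pv ind.
case: (ex_maxnP ex0 ub) => d /asboolP[v [Pv ind]] dmax.
exists d; last by apply: bd Pv ind.
exists v; split=> // p Pp.
have : ~ good d.+1 by move=> /dmax; rewrite ltnn.
move=> ng; pose w (i : 'I_d.+1) := if unlift ord_max i is Some j then v j else p.
have : ~ indep_mod Q w.
  move=> iw; apply: ng; apply/asboolP; exists w; split=> // i.
  by rewrite /w; case: unliftP => *.
move=> /existsNP[a /not_implyP[Qa /existsNP[i ai]]].
have sumE : \sum_i a i *: w i = a ord_max *: p + \sum_j a (lift ord_max j) *: v j.
  rewrite (bigD1_ord ord_max) //= /w unlift_none; congr (_ + _).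
  by apply: eq_bigr => j _; rewrite liftK.
have an0 : a ord_max != 0.
  apply/eqP => a0; move: Qa; rewrite sumE a0 scale0r add0r => /ind z.
  by apply: ai; have [j ->|->] := unliftP ord_max i.
exists (fun j => - (a ord_max)^-1 * a (lift ord_max j)).
have -> : p - \sum_i (- (a ord_max)^-1 * a (lift ord_max i)) *: v i
        = (a ord_max)^-1 *: \sum_i a i *: w i.
  rewrite sumE scalerDr scalerA mulVf // scale1r scaler_sumr -sumrN.
  by congr (_ + _); apply: eq_bigr => j _; rewrite -scaleNr mulNr opprK scalerA.
exact: submodZ.
Qed.

(** An independent family is never longer than a spanning one. *)
Lemma dim_of_span P Q n (w : 'I_n -> V) : submodule P -> submodule Q ->
  (forall p, P p -> exists a : 'I_n -> k, Q (p - \sum_i a i *: w i)) ->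
  exists2 d, dim_quo P Q d & (d <= n)%N.
Proof.
move=> sP sQ sp; apply: dim_exists => // m v Pv.
apply: (indep_bound (@field_is_domain k) sQ (h := 1)).
  by apply/eqP; exact: oner_neq0.
by move=> i; rewrite scale1r; apply: sp.
Qed.

Lemma dim_refl P : submodule P -> dim_quo P P 0.
Proof.
move=> sP; exists (fun=> 0); split; first by case.
  by move=> ? ? [].
by move=> p Pp; exists (fun=> 0); rewrite big_ord0 subr0.
Qed.

Lemma dim0_sub P Q p : dim_quo P Q 0 -> P p -> Q p.
Proof. by case=> v [_ _ sp] /sp[a]; rewrite big_ord0 subr0. Qed.

Lemma dim_trans P Q R a b : submodule Q -> submodule R ->
  (forall x, Q x -> P x) -> (forall x, R x -> Q x) ->
  dim_quo P Q a -> dim_quo Q R b -> dim_quo P R (a + b).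
Proof.
move=> sQ sR QP RQ [v [Pv iv sv]] [w [Qw iw sw]].
pose u (i : 'I_(a + b)) := match fintype.split i with inl j => v j | inr j => w j end.
have uE (c : 'I_(a + b) -> k) : \sum_i c i *: u i
    = \sum_j c (lshift b j) *: v j + \sum_j c (rshift a j) *: w j.
  rewrite big_split_ord /=; congr (_ + _); apply: eq_bigr => j _; rewrite /u.
    by rewrite -/(fintype.unsplit (inl j)) fintype.unsplitK.
  by rewrite -/(fintype.unsplit (inr j)) fintype.unsplitK.
exists u; split.
- by move=> i; rewrite /u; case: (fintype.split i) => j //; apply: QP.
- move=> c; rewrite uE => Rc.
  have cl j : c (lshift b j) = 0.
    apply: (iv (fun j => c (lshift b j))).
    by apply/(submodDr _ sQ (submod_lc (fun j => c (rshift a j)) sQ Qw)); apply: RQ.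
  have cr j : c (rshift a j) = 0.
    apply: (iw (fun j => c (rshift a j))); move: Rc; rewrite big1 ?add0r // => i _.
    by rewrite cl scale0r.
  by move=> i; rewrite -(fintype.splitK i); case: (fintype.split i) => j /=; [exact: cl | exact: cr].
- move=> p /sv[c Qc]; have [d Rd] := sw _ Qc.
  exists (fun i => match fintype.split i with inl j => c j | inr j => d j end).
  rewrite uE opprD addrA.
  under eq_bigr do rewrite -/(fintype.unsplit (inl _)) fintype.unsplitK.
  by under [X in _ - X]eq_bigr do rewrite -/(fintype.unsplit (inr _)) fintype.unsplitK.
Qed.

Lemma dim_mid P Q R n : submodule P -> submodule Q -> submodule R ->
  (forall x, Q x -> P x) -> (forall x, R x -> Q x) -> dim_quo P R n ->
  exists a b, [/\ dim_quo P Q a, dim_quo Q R b & n = (a + b)%N].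
Proof.
move=> sP sQ sR QP RQ dn.
have [|a da _] := @dim_exists P Q n sP sQ.
  move=> m v Pv iv; apply: dim_bound dn Pv _ => // c /RQ; exact: iv.
have [|b db _] := @dim_exists Q R n sQ sR.
  by move=> m v Qv iv; apply: dim_bound dn _ iv => // i; apply: QP.
exists a, b; split=> //; apply: dim_uniq dn _ => //; exact: dim_trans da db.
Qed.

Lemma dim_ext P Q P' Q' n : (forall x, P x <-> P' x) -> (forall x, Q x <-> Q' x) ->
  dim_quo P Q n -> dim_quo P' Q' n.
Proof.
move=> eP eQ [v [Pv iv sv]]; exists v; split.
- by move=> i; apply/eP.
- by move=> c /eQ; apply: iv.
- by move=> p /eP/sv[a /eQ]; exists a.
Qed.

End OneSpace.

Section TwoSpaces.
Variables V W : lmodType k.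
Implicit Types (f : {linear V -> W}).

(** [f] induces an isomorphism of [P / Q] onto [P' / Q']. *)
Definition quo_iso f (P Q : V -> Prop) (P' Q' : W -> Prop) :=
  [/\ forall p, P p -> P' (f p), forall p, P p -> Q' (f p) <-> Q p &
      forall p', P' p' -> exists2 p, P p & Q' (p' - f p)].

Lemma lc_linear f n (a : 'I_n -> k) (v : 'I_n -> V) :
  f (\sum_i a i *: v i) = \sum_i a i *: f (v i).
Proof. by rewrite linear_sum; apply: eq_bigr => i _; rewrite linearZ. Qed.

Lemma dim_iso f P Q P' Q' n : submodule P -> submodule Q' ->
  quo_iso f P Q P' Q' -> dim_quo P Q n <-> dim_quo P' Q' n.
Proof.
move=> sP sQ' [fP fQ fs]; split=> [[v [Pv iv sv]]|[w [Pw iw sw]]].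
  exists (f \o v); split.
  - by move=> i; apply: fP.
  - by move=> a; rewrite -lc_linear => /fQ - /(_ (submod_lc _ sP Pv)) /iv.
  - move=> p' /fs[p Pp Q'p]; have [a Qa] := sv _ Pp; exists a.
    apply: submod_eq sQ' _ Q'p; rewrite opprB addrC addrA subrK -lc_linear -linearB.
    by apply/fQ => //; apply: submodB => //; apply: submod_lc.
have /choice[v vP] : forall i, exists v, P v /\ Q' (w i - f v).
  by move=> i; have [v] := fs _ (Pw i); exists v.
have Pv i : P (v i) by case: (vP i).
have Q'v (a : 'I_n -> k) : Q' (\sum_i a i *: w i - f (\sum_i a i *: v i)).
  rewrite lc_linear -sumrB; apply: submod_sum => // i _; rewrite -scalerBr.
  by apply: submodZ => //; case: (vP i).
exists v; split=> //.
  move=> a /(fQ _ (submod_lc _ sP Pv)) h; apply: iw.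
  exact: submod_eq sQ' (Q'v a) h.
move=> p Pp; have [a Q'a] := sw _ (fP _ Pp); exists a.
apply/fQ; first by apply: submodB => //; apply: submod_lc.
rewrite linearB -[f p](subrK (\sum_i a i *: w i)) -addrA; exact: submodD.
Qed.

End TwoSpaces.
End Dimension.

(** * The index of a linear map *)

Section Index.
Variables (k : fieldType).

Definition image_of (V W : lmodType k) (f : {linear V -> W}) (P : V -> Prop) : W -> Prop :=
  fun w => exists2 p, P p & w = f p.

Definition sum_of (V : lmodType k) (P Q : V -> Prop) : V -> Prop :=
  fun v => exists p q, [/\ P p, Q q & v = p + q].

Definition zero_of (V : lmodType k) : V -> Prop := fun v => v = 0.

(** [f] maps [P] to [Q] and [P'] to [Q']; the induced map [P / P' -> Q / Q']
    has kernel of dimension [a] and cokernel of dimension [b]. *)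
Definition ker_coker_quo (V W : lmodType k) (f : {linear V -> W})
    (P P' : V -> Prop) (Q Q' : W -> Prop) (a b : nat) :=
  dim_quo (fun v => P v /\ Q' (f v)) P' a /\ dim_quo Q (sum_of (image_of f P) Q') b.

Definition ker_coker (V W : lmodType k) (f : {linear V -> W}) P Q a b :=
  ker_coker_quo f P (@zero_of V) Q (@zero_of W) a b.

Section OneMap.
Variables (V W : lmodType k) (f : {linear V -> W}).
Variables (P P' : V -> Prop) (Q Q' : W -> Prop).
Hypotheses (sP : submodule P) (sP' : submodule P') (sQ : submodule Q) (sQ' : submodule Q').
Hypotheses (P'P : forall v, P' v -> P v) (Q'Q : forall w, Q' w -> Q w).
Hypotheses (fP : forall v, P v -> Q (f v)) (fP' : forall v, P' v -> Q' (f v)).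

Let sX : submodule (fun v => P v /\ Q' (f v)).
Proof. by apply: submodI => //; apply: submod_preim. Qed.

Let sim (R : V -> Prop) : submodule R -> submodule (image_of f R).
Proof. exact: submod_im. Qed.

Let ssum (X : lmodType k) (R S : X -> Prop) :
  submodule R -> submodule S -> submodule (sum_of R S).
Proof. exact: submod_add. Qed.

(** Rank-nullity: the image of the induced map is a quotient of the source and a subspace
    of the target, with the same dimension. *)
Lemma ker_coker_quo_finite m n : dim_quo P P' m -> dim_quo Q Q' n ->
  exists a b, ker_coker_quo f P P' Q Q' a b /\ (a + n = b + m)%N.
Proof.
move=> dm dn.
have [| |t [a [dt da ->]]] := dim_mid sP sX sP' _ _ dm; first by move=> x [].
  by move=> x P'x; split; [apply: P'P | apply: fP'].
have sS : submodule (sum_of (image_of f P) Q') by apply: ssum => //; apply: sim.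
have [| x Q'x|b [t' [db dt' ->]]] := dim_mid sQ sS sQ' _ _ dn.
- move=> x [_ [q [[p Pp ->] Q'q ->]]].
  by apply: submodD => //; [apply: fP | apply: Q'Q].
- exists 0, x; split; rewrite ?add0r //.
  by exists 0; rewrite ?linear0 //; exact: submod0.
have qi : quo_iso f P (fun v => P v /\ Q' (f v)) (sum_of (image_of f P) Q') Q'.
  split=> [p Pp|p Pp|_ [_ [q [[p Pp ->] Q'q ->]]]].
  - by exists (f p), 0; split; rewrite ?addr0 //; [exists p | exact: submod0].
  - by split=> [|[]].
  - by exists p => //; rewrite addrC addKr.
have tt' := dim_uniq sQ' ((dim_iso _ sP sQ' qi).1 dt) dt'.
exists a, b; split; [by split | by rewrite tt'; ring].
Qed.

(** Index is additive along [0 -> P' -> P -> P / P' -> 0]. *)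
Lemma ker_coker_ext a' b' a'' b'' :
  ker_coker f P' Q' a' b' -> ker_coker_quo f P P' Q Q' a'' b'' ->
  exists a b, ker_coker f P Q a b /\ (a + b' + b'' = b + a' + a'')%N.
Proof.
move=> [da' db'] [da'' db''].
pose X v := P v /\ zero_of (f v).
pose K v := P' v /\ zero_of (f v).
have sK : submodule K by apply: submodI => //; apply: submod_preim; exact: submod_zero.
have sXX : submodule X by apply: submodI => //; apply: submod_preim; exact: submod_zero.
have sY : submodule (sum_of P' X) by apply: ssum.
have P'Y v : P' v -> sum_of P' X v.
  by move=> h; exists v, 0; split; rewrite ?addr0 //; exact: submod0.
have [| |c [e [de dc' ->]]] := dim_mid sX sY sP' _ _ da''.
  move=> _ [p [q [P'p [Pq fq] ->]]]; split; first by apply: submodD; auto.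
  by rewrite linearD fq addr0; apply: fP'.
  exact: P'Y.
(* The kernel of the induced map contains [(P' + X) / P'], which is [X / K]. *)
have qXK : quo_iso idfun X K (sum_of P' X) P'.
  split=> [p Xp|p [Pp fp]|].
  - by exists 0, p; split; rewrite ?add0r //; exact: submod0.
  - by split=> [|[]].
  - move=> _ [p [q [P'p Xq ->]]]; exists q => //=.
    by rewrite addrK.
have dXK := (dim_iso _ sXX sP' qXK).2 dc'.
have z0 := submod_zero V; have z0' := submod_zero W.
have da : dim_quo X (@zero_of V) (e + a').
  apply: dim_trans sK z0 _ _ dXK da'; first by move=> x [/P'P].
  by move=> x ->; split; [exact: submod0 | rewrite /zero_of linear0].
pose Z w := sum_of (image_of f (fun v => P v /\ Q' (f v))) (@zero_of W) w.
have sZ : submodule Z by apply: ssum => //; apply: sim.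
have sI' : submodule (sum_of (image_of f P') (@zero_of W)) by apply: ssum => //; apply: sim.
have sI : submodule (sum_of (image_of f P) (@zero_of W)) by apply: ssum => //; apply: sim.
have sJ : submodule (sum_of (image_of f P) Q') by apply: ssum => //; apply: sim.
have [| |g [e' [dg de' e2]]] := dim_mid sQ' sZ sI' _ _ db'.
- by move=> _ [_ [_ [[p [Pp Q'p] ->] -> ->]]]; rewrite addr0.
- move=> _ [_ [_ [[p P'p ->] -> ->]]]; exists (f p), 0; split=> //.
  by exists p => //; split; auto.
have qe : quo_iso f (fun v => P v /\ Q' (f v)) (sum_of P' X) Z
    (sum_of (image_of f P') (@zero_of W)).
  split=> [p Xp|p [Pp Q'p]|_ [_ [_ [[p Xp ->] -> ->]]]].
  - by exists (f p), 0; split; rewrite ?addr0 //; exists p.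
  - split=> [[_ [_ [[q P'q ->] -> /esym fpq]]]|[q [r [P'q [Pr fr] ->]]]].
      exists q, (p - q); split; rewrite ?subrKC //.
      split; first by apply: submodB => //; apply: P'P.
      by rewrite /zero_of linearB -fpq addr0 subrr.
    by exists (f q), 0; split=> //; [exists q | rewrite linearD fr].
  - exists p => //; rewrite addr0 subrr; exact: submod0.
have ee := dim_uniq sI' ((dim_iso _ sX sI' qe).1 de) de'.
have qJ : quo_iso idfun Q' Z (sum_of (image_of f P) Q') (sum_of (image_of f P) (@zero_of W)).
  split=> [q Q'q|q Q'q|].
  - exists 0, q; split; rewrite ?add0r //.
    by exists 0; rewrite ?linear0 //; exact: submod0.
  - split=> [[_ [_ [[p Pp ->] -> /= qE]]]|[_ [_ [[p [Pp _] ->] -> ->]]]].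
      exists (f p), 0; split=> //; exists p => //; split=> //.
      by move: qE; rewrite addr0 => <-.
    by exists (f p), 0; split=> //; exists p.
  - move=> _ [_ [q [[p Pp ->] Q'q ->]]]; exists q => //=.
    by rewrite addrK; exists (f p), 0; split; rewrite ?addr0 //; exists p.
have dJI := (dim_iso _ sQ' sI qJ).1 dg.
exists (e + a')%N, (b'' + g)%N; split.
  split=> //; apply: dim_trans sJ sI _ _ db'' dJI.
    by move=> x [_ [q [[p Pp ->] Q'q ->]]]; apply: submodD; auto.
  move=> _ [_ [_ [[p Pp ->] -> ->]]]; exists (f p), 0; split=> //; first by exists p.
  exact: submod0.
by rewrite e2 ee; ring.
Qed.

(** On a subspace of finite codimension the kernel can only shrink, and the cokernel grows by
    at most the codimension. *)
Lemma ker_coker_sub a b m n : dim_quo P P' m -> dim_quo Q Q' n ->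
  ker_coker f P Q a b -> exists a' b', ker_coker f P' Q' a' b'.
Proof.
move=> dm dn [da db].
have z0 := submod_zero V; have z0' := submod_zero W.
have sK : submodule (fun v => P' v /\ zero_of (f v)).
  by apply: submodI => //; apply: submod_preim.
have sK1 : submodule (fun v => P v /\ zero_of (f v)).
  by apply: submodI => //; apply: submod_preim.
have sI' : submodule (sum_of (image_of f P') (@zero_of W)) by apply: ssum => //; apply: sim.
have sI : submodule (sum_of (image_of f P) (@zero_of W)) by apply: ssum => //; apply: sim.
have [| |c [a' [_ da' _]]] := dim_mid sK1 sK z0 _ _ da.
- by move=> x [/P'P].
- by move=> x ->; split; [exact: submod0 | rewrite /zero_of linear0].
have [v [Pv _ vs]] := dm.
have [|c' dc' _] := @dim_of_span _ _ (sum_of (image_of f P) (@zero_of W))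
                  (sum_of (image_of f P') (@zero_of W)) _ (f \o v) sI sI'.
  move=> _ [_ [_ [[p Pp ->] -> ->]]]; have [x xP] := vs _ Pp; exists x.
  exists (f (p - \sum_i x i *: v i)), 0; split=> //; first by exists (p - \sum_i x i *: v i).
  by rewrite linearB (lc_linear f) addrAC.
have dQI' : dim_quo Q (sum_of (image_of f P') (@zero_of W)) (b + c').
  apply: dim_trans sI sI' _ _ db dc'.
    by move=> _ [_ [_ [[p Pp ->] -> ->]]]; rewrite addr0; apply: fP.
  by move=> _ [_ [_ [[p Pp ->] -> ->]]]; exists (f p), 0; split=> //; exists p; auto.
have [| |h [b' [_ db' _]]] := dim_mid sQ sQ' sI' _ _ dQI'.
- by [].
- by move=> _ [_ [_ [[p P'p ->] -> ->]]]; rewrite addr0; apply: fP'.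
by exists a', b'.
Qed.

End OneMap.

Lemma ker_coker_uniq (V W : lmodType k) (f : {linear V -> W}) P Q a b a' b' :
  submodule P ->
  ker_coker f P Q a b -> ker_coker f P Q a' b' -> a = a' /\ b = b'.
Proof.
move=> sP [da db] [da' db']; split; first exact: dim_uniq (submod_zero V) da da'.
by apply: dim_uniq db db'; apply: submod_add; [exact: submod_im | exact: submod_zero].
Qed.

(** A morphism between two maps which is an isomorphism on the source and the
    target preserves kernel and cokernel. *)
Lemma ker_coker_quo_iso (V W V1 W1 : lmodType k) (f : {linear V -> W}) (f1 : {linear V1 -> W1})
    (al : {linear V -> V1}) (be : {linear W -> W1}) P P' Q Q' P1 P1' Q1 Q1' a b :
  submodule P -> submodule P' -> submodule Q -> submodule Q' ->
  submodule P1 -> submodule P1' -> submodule Q1 -> submodule Q1' ->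
  (forall w, Q' w -> Q w) -> (forall v, P v -> Q (f v)) ->
  (forall v, P1' v -> Q1' (f1 v)) ->
  (forall v, P v -> be (f v) = f1 (al v)) ->
  quo_iso al P P' P1 P1' -> quo_iso be Q Q' Q1 Q1' ->
  ker_coker_quo f P P' Q Q' a b <-> ker_coker_quo f1 P1 P1' Q1 Q1' a b.
Proof.
move=> sP sP' sQ sQ' sP1 sP1' sQ1 sQ1' Q'Q fP fP1' com [aP aP' aS] [bQ bQ' bS].
have e1 : dim_quo (fun v => P v /\ Q' (f v)) P' a <->
          dim_quo (fun v => P1 v /\ Q1' (f1 v)) P1' a.
  apply: (dim_iso (f := al)) => //.
    by apply: submodI => //; apply: submod_preim.
  split=> [p [Pp Q'p]|p [Pp Q'p]|p1 [P1p Q1p]].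
  - split; first exact: aP.
    by rewrite -com //; apply/bQ' => //; apply: fP.
  - exact: aP'.
  - have [p Pp P1'p] := aS _ P1p; exists p => //; split=> //.
    apply/bQ'; first exact: fP.
    rewrite com //; apply: (submod_eq sQ1' _ Q1p).
    by rewrite -linearB; apply: fP1'; apply: submodBC.
have e2 : dim_quo Q (sum_of (image_of f P) Q') b <->
          dim_quo Q1 (sum_of (image_of f1 P1) Q1') b.
  apply: (dim_iso (f := be)) => //.
    by apply: submod_add => //; apply: submod_im.
  split=> // [p Qp|p1 Q1p].
  - split=> [[_ [r [[p1 P1p1 ->] Q1'r bp]]]|].
      have [p2 Pp2 P1'p2] := aS _ P1p1.
      exists (f p2), (p - f p2); split; [by exists p2 | | by rewrite subrKC].
      apply/bQ'; first by apply: submodB => //; apply: fP.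
      rewrite linearB bp com // addrAC -linearB; apply: submodD => //.
      exact: fP1'.
    move=> [_ [r [[p1 Pp1 ->] Q'r ->]]]; exists (f1 (al p1)), (be r); split.
    + by exists (al p1) => //; apply: aP.
    + by apply/bQ' => //; apply: Q'Q.
    + by rewrite linearD com.
  - have [q Qq Q1'q] := bS _ Q1p; exists q => //.
    by exists 0, (p1 - be q); split; rewrite ?add0r //; exists 0; rewrite ?linear0 //; exact: submod0.
by split=> [[/e1 ? /e2 ?]|[/e1 ? /e2 ?]].
Qed.
End Index.

(** * Modules over an algebra over a field *)

(** An alias of [M] that carries the structure of vector space over [k]. *)
Definition restr (k : fieldType) (A : pzRingType) (phi : {rmorphism k -> A})
  (M : lmodType A) : Type := M.

Section RestrictionOfScalars.
Variables (k : fieldType) (A : pzRingType) (phi : {rmorphism k -> A}).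

Section Instances.
Variable M : lmodType A.
HB.instance Definition _ := GRing.Zmodule.on (restr phi M).
Definition restr_scale (c : k) (m : restr phi M) : restr phi M := phi c *: (m : M).
Fact restr_scaleA a b v : restr_scale a (restr_scale b v) = restr_scale (a * b) v.
Proof. by rewrite /restr_scale scalerA rmorphM. Qed.
Fact restr_scale1 : left_id 1 restr_scale.
Proof. by move=> v; rewrite /restr_scale rmorph1 scale1r. Qed.
Fact restr_scaleDr : right_distributive restr_scale +%R.
Proof. by move=> a u v; rewrite /restr_scale scalerDr. Qed.
Fact restr_scaleDl v : {morph restr_scale^~ v : a b / a + b}.
Proof. by move=> a b; rewrite /restr_scale rmorphD scalerDl. Qed.
HB.instance Definition _ := GRing.Zmodule_isLmodule.Build k (restr phi M)
  restr_scaleA restr_scale1 restr_scaleDr restr_scaleDl.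
End Instances.

Lemma restrZ (M : lmodType A) (c : k) (m : restr phi M) : c *: m = phi c *: (m : M).
Proof. by []. Qed.

Lemma restr_submod (M : lmodType A) (P : M -> Prop) :
  submodule P -> submodule (P : restr phi M -> Prop).
Proof.
move=> sP; split; first exact: (submod0 sP).
by move=> a u v Pu Pv; apply: (submodD sP) => //; apply: (submodZ (phi a) sP).
Qed.

(** Linearity of bare functions, which are often obtained by choice. *)
Definition a_linear (M N : lmodType A) (f : M -> N) :=
  forall a u v, f (a *: u + v) = a *: f u + f v.

Lemma a_linear0 (M N : lmodType A) (f : M -> N) : a_linear f -> f 0 = 0.
Proof. by move=> l; have := l (-1) 0 0; rewrite scaler0 add0r scaleN1r addNr. Qed.

Lemma a_linearZ (M N : lmodType A) (f : M -> N) a u : a_linear f -> f (a *: u) = a *: f u.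
Proof. by move=> l; rewrite -[a *: u]addr0 l a_linear0 // addr0. Qed.

Lemma a_linearD (M N : lmodType A) (f : M -> N) u v : a_linear f -> f (u + v) = f u + f v.
Proof. by move=> l; rewrite -[u]scale1r l !scale1r. Qed.

Lemma a_linearB (M N : lmodType A) (f : M -> N) u v : a_linear f -> f (u - v) = f u - f v.
Proof. by move=> l; rewrite a_linearD // -scaleN1r a_linearZ // scaleN1r. Qed.

Lemma a_linear_sum (M N : lmodType A) (f : M -> N) I (r : seq I) (P : pred I) (F : I -> M) :
  a_linear f -> f (\sum_(i <- r | P i) F i) = \sum_(i <- r | P i) f (F i).
Proof.
move=> l; elim/big_rec2: _ => [|i y1 y2 _ <-]; first exact: a_linear0.
exact: a_linearD.
Qed.

Lemma a_linear_lc (M N : lmodType A) (f : M -> N) n (a : 'I_n -> A) (v : 'I_n -> M) :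
  a_linear f -> f (\sum_i a i *: v i) = \sum_i a i *: f (v i).
Proof. by move=> l; rewrite a_linear_sum //; apply: eq_bigr => i _; rewrite a_linearZ. Qed.

Lemma linear_a_linear (M N : lmodType A) (f : {linear M -> N}) : a_linear f.
Proof. exact: linearP. Qed.

(** A predicate on all functions, so that the spaces of homomorphisms considered below are
    subspaces of one vector space over [k]. *)
Definition hom_to (E F : lmodType A) (L : F -> Prop) : (E -> restr phi F) -> Prop :=
  fun f => a_linear (f : E -> F) /\ forall m, L (f m).

Definition generated_by (z1 z2 : A) := forall S : A -> Prop,
  (forall c, S (phi c)) -> (forall a b, S a -> S b -> S (a + b)) ->
  (forall a, S a -> S (z1 * a)) -> (forall a, S a -> S (z2 * a)) -> forall a, S a.

(** A basis of the localization of [E] at the point [ev]. *)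
Definition local_basis (E : lmodType A) (ev : {rmorphism A -> k}) (r : nat) :=
  exists (m : 'I_r -> E) (h : A),
    [/\ ev h != 0, indep_mod (fun x => x = 0) m & forall e, span_of m (h *: e)].

End RestrictionOfScalars.

Lemma submod_hom_to (k : fieldType) (A : comNzRingType) (phi : {rmorphism k -> A})
    (E F : lmodType A) (L : F -> Prop) :
  submodule L -> submodule (@hom_to k A phi E F L).
Proof.
move=> sL; split.
  split=> [a u v|m]; last exact: (submod0 sL).
  by change ((0 : F) = a *: (0 : F) + 0); rewrite scaler0 addr0.
move=> c f g [lf Lf] [lg Lg]; split.
  move=> a u v; change (phi c *: (f (a *: u + v) : F) + (g (a *: u + v) : F)
    = a *: (phi c *: (f u : F) + (g u : F)) + (phi c *: (f v : F) + (g v : F))).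
  by rewrite lf lg !scalerDr !scalerA (mulrC (phi c)) addrACA.
by move=> m; apply: (submodD sL) => //; apply: (submodZ (phi c) sL).
Qed.

Arguments hom_to {k A} phi {E F} L _.
Arguments submod_hom_to {k A} phi {E F L} _.

Section Eigenvectors.
Variables (k : closedFieldType) (A : comNzRingType) (phi : {rmorphism k -> A}).
Variable (M : lmodType A).
Implicit Types (L P : M -> Prop).

Definition peval (q : {poly k}) (z : A) : A := (map_poly phi q).[z].

Lemma pevalM p q z : peval (p * q) z = peval p z * peval q z.
Proof. by rewrite /peval rmorphM hornerM. Qed.

Lemma pevalXsubC c z : peval ('X - c%:P) z = z - phi c.
Proof. by rewrite /peval rmorphB /= map_polyX map_polyC hornerXsubC. Qed.

Lemma pevalC c z : peval c%:P z = phi c.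
Proof. by rewrite /peval map_polyC hornerC. Qed.

Lemma peval_poly n (a : nat -> k) z :
  peval (\poly_(i < n) a i) z = \sum_(i < n) phi (a i) * z ^+ i.
Proof.
rewrite /peval poly_def rmorph_sum horner_sum; apply: eq_bigr => i _.
by rewrite -mul_polyC rmorphM /= map_polyC map_polyXn hornerCM hornerXn.
Qed.

(** The powers of [z] applied to [f] are dependent modulo [L]. *)
Lemma finite_annihilator P L n z f : submodule P -> submodule L ->
  dim_quo (V := restr phi M) P L n -> P f ->
  exists2 q : {poly k}, q != 0 & L (peval q z *: f).
Proof.
move=> sP sL dn Pf.
have nind : ~ indep_mod (M := restr phi M) L (fun i : 'I_n.+1 => z ^+ i *: f).
  move=> ind; have := dim_bound (restr_submod phi sL) dn _ ind.
  by move/(_ (fun i => submodZ _ sP Pf)); rewrite ltnn.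
move: nind => /existsNP[a /not_implyP[La /existsNP[i ai]]].
exists (\poly_(i < n.+1) a (inord i)).
  apply/eqP => /(congr1 (fun p : {poly k} => p`_i)); rewrite coef_poly ltn_ord coef0.
  by rewrite inord_val.
rewrite peval_poly scaler_suml; congr (L _): La; apply: eq_bigr => j _.
by rewrite inord_val restrZ scalerA.
Qed.

(** Factor [q] into linear polynomials, and stop just before the factor that moves [f]
    into [L]. *)
Lemma eigenvector1 L z f q : submodule L -> q != 0 -> ~ L f -> L (peval q z *: f) ->
  exists2 p : {poly k}, ~ L (peval p z *: f) &
    exists al : k, L ((z - phi al) *: (peval p z *: f)).
Proof.
move=> sL q0 nLf; have [rs qE] := closed_field_poly_normal q.
have lc0 : lead_coef q != 0 by rewrite lead_coef_eq0.
rewrite qE -mul_polyC pevalM pevalC => /(submodZ (phi ((lead_coef q)^-1)) sL).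
rewrite scalerA mulrA -(rmorphM phi) mulVf // rmorph1 mul1r {qE}.
have nL1 : ~ L (peval 1 z *: f) by rewrite -[1]/(1%:P) pevalC rmorph1 scale1r.
rewrite -[\prod_(_ <- _) _]mul1r.
suff: forall p, ~ L (peval p z *: f) ->
    L (peval (p * \prod_(z0 <- rs) ('X - z0%:P)) z *: f) ->
  exists2 p : {poly k}, ~ L (peval p z *: f) &
    exists al : k, L ((z - phi al) *: (peval p z *: f)) by apply.
elim: rs => [|al rs IH] p nLp; first by rewrite big_nil mulr1.
rewrite big_cons mulrA; have [Lp|nL] := pselect (L (peval (p * ('X - al%:P)) z *: f)).
  move=> _; exists p => //; exists al.
  by rewrite scalerA mulrC -pevalXsubC -pevalM.
exact: IH nL.
Qed.

(** Over an algebra generated by two elements, a common eigenvector of the two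
    generators spans a copy of the residue field of a point. *)
Lemma eigenvector_point z1 z2 P L f : generated_by phi z1 z2 ->
  submodule P -> submodule L -> P f -> ~ L f ->
  (forall g z, P g -> exists2 q : {poly k}, q != 0 & L (peval q z *: g)) ->
  exists e a (ev : {rmorphism A -> k}),
    [/\ P e, e = a *: f, ~ L e, forall c, ev (phi c) = c &
        forall b, L (b *: e - phi (ev b) *: e)].
Proof.
move=> gen sP sL Pf nLf fin.
have [q1 q1n0 Lq1] := fin f z1 Pf.
have [p1 nL1 [al Lal]] := eigenvector1 sL q1n0 nLf Lq1.
set f1 := _ *: f in nL1 Lal.
have Pf1 : P f1 by apply: submodZ.
have [q2 q2n0 Lq2] := fin f1 z2 Pf1.
have [p2 nL2 [be Lbe]] := eigenvector1 sL q2n0 nL1 Lq2.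
set e := _ *: f1 in nL2 Lbe.
have Pe : P e by apply: submodZ.
have Lale : L ((z1 - phi al) *: e).
  by rewrite /e scalerA mulrC -scalerA; apply: submodZ.
have sc c : L (phi c *: e) -> c = 0.
  move=> Lc; apply/eqP; apply: contra_notT nL2 => c0.
  by rewrite -[e]scale1r -(rmorph1 phi) -(mulVf c0) rmorphM -scalerA; apply: submodZ.
have ex b : exists c, L (b *: e - phi c *: e).
  elim/gen: b => [c|a b [c Lc] [d Ld]|a [c Lc]|a [c Lc]].
  - by exists c; rewrite subrr; exact: submod0.
  - exists (c + d); rewrite rmorphD !scalerDl opprD addrACA; exact: submodD.
  - exists (al * c); have := submodD sL (submodZ z1 sL Lc) (submodZ (phi c) sL Lale).
    congr (L _); rewrite -!scalerBl !scalerA -scalerDl; congr (_ *: _).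
    by rewrite rmorphM; ring.
  - exists (be * c); have := submodD sL (submodZ z2 sL Lc) (submodZ (phi c) sL Lbe).
    congr (L _); rewrite -!scalerBl !scalerA -scalerDl; congr (_ *: _).
    by rewrite rmorphM; ring.
have [ev evP] := choice ex.
have evU b c : L (b *: e - phi c *: e) -> ev b = c.
  move=> Lc; apply/eqP; rewrite -subr_eq0; apply/eqP; apply: sc.
  have := submodB sL Lc (evP b); congr (L _).
  by rewrite -!scalerBl; congr (_ *: _); rewrite rmorphB; ring.
have evphi c : ev (phi c) = c by apply: evU; rewrite subrr; exact: submod0.
have evB : zmod_morphism ev.
  move=> a b; apply: evU; have := submodB sL (evP a) (evP b); congr (L _).
  by rewrite -!scalerBl; congr (_ *: _); rewrite rmorphB; ring.
have evM : monoid_morphism ev.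
  split; first by rewrite -(rmorph1 phi).
  move=> a b; apply: evU.
  have := submodD sL (submodZ a sL (evP b)) (submodZ (phi (ev b)) sL (evP a)).
  congr (L _); rewrite -!scalerBl !scalerA -scalerDl; congr (_ *: _).
  by rewrite rmorphM; ring.
pose m1 := GRing.isZmodMorphism.Build A k ev evB.
pose m2 := GRing.isMonoidMorphism.Build A k ev evM.
pose EV : {rmorphism A -> k} := HB.pack ev m1 m2.
exists e, (peval p2 z2 * peval p1 z1), EV; split => //.
by rewrite -scalerA.
Qed.

Lemma finite_eigenvector z1 z2 P L n : generated_by phi z1 z2 ->
  submodule P -> submodule L -> dim_quo (V := restr phi M) P L n.+1 ->
  exists e (ev : {rmorphism A -> k}),
    [/\ P e, ~ L e, forall c, ev (phi c) = c & forall b, L (b *: e - phi (ev b) *: e)].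
Proof.
move=> gen sP sL dn; have [v [Pv iv _]] := dn.
have nLv : ~ L (v ord0).
  move=> Lv; have := iv (fun i => (i == ord0)%:R).
  rewrite (bigD1 ord0) //= ?eqxx ?mulr1n scale1r big1 ?addr0; last first.
    by move=> i /negPf ->; rewrite scale0r.
  by move=> /(_ Lv ord0)/eqP; rewrite eqxx oner_eq0.
have [|e [a [ev [Pe _ nLe evphi evP]]]] := eigenvector_point gen sP sL (Pv ord0) nLv.
  by move=> g z Pg; apply: finite_annihilator dn Pg.
by exists e, ev.
Qed.

End Eigenvectors.

Section HomIntoFiniteQuotient.
Variables (k : closedFieldType) (A : comNzRingType) (phi : {rmorphism k -> A}).
Variables (z1 z2 : A) (gen : generated_by phi z1 z2).
Variables (E : lmodType A) (r : nat).

Lemma fct_lcE (T : Type) (V : lmodType k) n (c : 'I_n -> k) (f : 'I_n -> T -> V) x :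
  (\sum_i c i *: f i) x = \sum_i c i *: f i x.
Proof. by rewrite fct_sumE. Qed.

Section OnePoint.
Variables (F : lmodType A) (L P : F -> Prop) (sL : submodule L) (e : F).
Variables (ev : {rmorphism A -> k}).
Hypotheses (nLe : ~ L e) (evP : forall b, L (b *: e - phi (ev b) *: e)).

Definition add_vector : F -> Prop := fun m => exists c, L (m - phi c *: e).

Lemma submod_add_vector : submodule add_vector.
Proof.
split; first by exists 0; rewrite rmorph0 scale0r subrr; exact: submod0.
move=> a u v [c Lc] [d Ld]; exists (ev a * c + d).
have := submodD sL (submodD sL (submodZ a sL Lc) Ld) (submodZ (phi c) sL (evP a)).
congr (L _); rewrite rmorphD rmorphM scalerDl !scalerBr !scalerA.
rewrite (mulrC (phi c) a) (mulrC (phi c)); zmod.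
Qed.

Lemma sub_add_vector m : L m -> add_vector m.
Proof. by exists 0; rewrite rmorph0 scale0r subr0. Qed.

Lemma scalar_zero c : L (phi c *: e) -> c = 0.
Proof.
move=> Lc; apply/eqP; apply: contra_notT nLe => c0.
by rewrite -[e]scale1r -(rmorph1 phi) -(mulVf c0) rmorphM -scalerA; apply: submodZ.
Qed.

Lemma dim_add_vector : dim_quo (V := restr phi F) add_vector L 1.
Proof.
exists (fun=> e); split.
- by move=> _; exists 1; rewrite rmorph1 scale1r subrr; exact: submod0.
- by move=> a; rewrite big_ord1 => /scalar_zero h i; rewrite ord1.
- by move=> p [c Lc]; exists (fun=> c); rewrite big_ord1.
Qed.

(** A local basis at the point turns linear maps into the residue field into
    coordinate vectors; [ev h] being nonzero, denominators are harmless. *)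
Lemma dim_hom_add_vector : local_basis E ev r ->
  dim_quo (hom_to phi add_vector) (hom_to phi L : (E -> restr phi F) -> Prop) r.
Proof.
case=> m [h [h0 ind sp]].
have [co [coP co_lin co_m]] := coordinates ind sp.
pose B (i : 'I_r) : E -> restr phi F := fun x => phi (ev h)^-1 *: (co x i *: e).
have BP i : hom_to phi add_vector (B i).
  split; first by move=> a u v; rewrite /B co_lin scalerDl scalerDr !scalerA mulrCA mulrA.
  move=> x; apply: (submodZ _ submod_add_vector); exists (ev (co x i)); exact: evP.
have Bm i j : L (B i (m j) - phi ((i == j)%:R) *: e).
  have -> : phi (i == j)%:R *: e = phi (ev h)^-1 *: (phi (ev (h * (i == j)%:R)) *: e).
    by rewrite scalerA -(rmorphM phi) (rmorphM ev) (rmorph_nat ev) mulrA mulVf // mul1r.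
  by rewrite /B co_m -scalerBr; apply: (submodZ _ sL).
have sumB (c : 'I_r -> k) j : L ((\sum_i c i *: B i) (m j) - phi (c j) *: e).
  rewrite fct_lcE (bigD1 j) //= addrAC; apply: (submodD sL).
    have := submodZ (phi (c j)) sL (Bm j j).
    by rewrite eqxx rmorph1 scale1r scalerBr.
  apply: (submod_sum _ sL) => i ij; have := submodZ (phi (c i)) sL (Bm i j).
  by rewrite (negPf ij) rmorph0 scale0r subr0.
exists B; split=> //.
  move=> c [_ Lc] j; apply: scalar_zero.
  by apply: (submod_eq sL _ (Lc (m j))); apply: submodBC.
move=> f [lf fL].
have [c cP] := choice (fun i => fL (m i)).
exists c; set g := f - _.
have [lg gL] : hom_to phi add_vector g.
  apply: (submodB (submod_hom_to phi submod_add_vector)); first by split.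
  by apply: submod_lc => //; apply: submod_hom_to; exact: submod_add_vector.
have gm j : L (g (m j)).
  have := submodB sL (cP j) (sumB c j); congr (L _).
  by rewrite opprB addrA subrK.
split=> // x; have [d Ld] := gL x.
have Lhg : L (h *: (g x : F)).
  by rewrite -(a_linearZ _ _ lg) coP (a_linear_lc _ _ lg); apply: submod_lc.
suff d0 : d = 0 by move: Ld; rewrite d0 rmorph0 scale0r subr0.
have hd : L (phi (ev h * d) *: e).
  have h1 := submodB sL Lhg (submodZ h sL Ld).
  have h2 := submodZ (phi d) sL (evP h).
  have := submodB sL h1 h2; congr (L _).
  rewrite !scalerBr !scalerA rmorphM (mulrC (phi d) h) (mulrC (phi d)); zmod.
by move: (scalar_zero hd) => /eqP; rewrite mulf_eq0 (negPf h0) => /eqP.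
Qed.

End OnePoint.

(** If [E] has local bases of size [r] everywhere, [Hom(E, -)] multiplies
    finite lengths by [r]: split off one point of the quotient at a time. *)
Theorem dim_hom_to (F : lmodType A) (P : F -> Prop) n :
  (forall ev : {rmorphism A -> k}, (forall c, ev (phi c) = c) -> local_basis E ev r) ->
  submodule P -> forall L : F -> Prop, submodule L -> (forall x, L x -> P x) ->
  dim_quo (V := restr phi F) P L n ->
  dim_quo (hom_to phi P) (hom_to phi L : (E -> restr phi F) -> Prop) (r * n).
Proof.
move=> lb sP; elim: n => [|n IH] L sL LP dn.
  rewrite muln0; apply: (dim_ext _ _ (dim_refl (submod_hom_to phi sP))) => //.
  move=> f; split=> -[lf fP]; split=> // m; last exact: LP.
  exact: dim0_sub dn (fP m).
have [e [ev [Pe nLe evphi evP]]] := finite_eigenvector gen sP sL dn.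
pose L1 := add_vector L e.
have sL1 : submodule L1 by exact: submod_add_vector evP.
have L1P x : L1 x -> P x.
  move=> [c /LP h]; rewrite -[x](subrK (phi c *: e)).
  by apply: submodD => //; apply: submodZ.
have LL1 x : L x -> L1 x by exact: sub_add_vector.
have [a [b [da db ab]]] := dim_mid (restr_submod phi sP) (restr_submod phi sL1)
  (restr_submod phi sL) L1P LL1 dn.
have b1 : b = 1%N := dim_uniq (restr_submod phi sL) db (dim_add_vector sL nLe).
have an : a = n by move: ab; rewrite b1 addn1 => -[].
rewrite an in da; have hL1 := IH L1 sL1 L1P da.
have hL := dim_hom_add_vector sL nLe evP (lb ev evphi).
rewrite mulnS addnC; apply: dim_trans hL1 hL.
- exact: submod_hom_to.
- exact: submod_hom_to.
- by move=> f [lf fP]; split=> // m; apply: L1P.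
- by move=> f [lf fP]; split=> // m; apply: LL1.
Qed.

End HomIntoFiniteQuotient.

(** * Rank and local bases of modules over a domain *)

Definition zero_pred (A : pzRingType) (M : lmodType A) : M -> Prop := fun x => x = 0.

Section NearBases.
Variables (A : comNzRingType) (dom : is_domain A).

(** A basis after inverting one nonzero element. *)
Definition near_basis (M : lmodType A) (r : nat) :=
  exists (m : 'I_r -> M) (h : A),
    [/\ h <> 0, indep_mod (@zero_pred A M) m & forall x, span_of m (h *: x)].

Lemma near_basis_bound (M : lmodType A) r s (v : 'I_s -> M) :
  near_basis M r -> indep_mod (@zero_pred A M) v -> (s <= r)%N.
Proof.
move=> [m [h [h0 _ sp]]]; apply: (indep_bound dom (submod_zero M) (w := m) h0).
by move=> i; have [a aP] := sp (v i); exists a; rewrite aP subrr.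
Qed.

Lemma near_basis_uniq (M : lmodType A) r s : near_basis M r -> near_basis M s -> r = s.
Proof.
move=> br bs; apply/eqP; rewrite eqn_leq; apply/andP; split.
  by case: (br) => m [h [_ ind _]]; apply: near_basis_bound bs ind.
by case: (bs) => m [h [_ ind _]]; apply: near_basis_bound br ind.
Qed.

Lemma near_basis_ext (M' M M'' : lmodType A) (i : {linear M' -> M})
    (p : {linear M -> M''}) r' r'' : injective i -> (forall y, exists x, p x = y) ->
  (forall x, p x = 0 <-> exists x', i x' = x) ->
  near_basis M' r' -> near_basis M'' r'' -> near_basis M (r' + r'').
Proof.
move=> inji surj ex [m' [h' [h'0 ind' sp']]] [m'' [h'' [h''0 ind'' sp'']]].
have [l lP] := choice surj.
pose m (j : 'I_(r' + r'')) :=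
  match fintype.split j with inl a => i (m' a) | inr b => l (m'' b) end.
have mE (c : 'I_(r' + r'') -> A) : \sum_j c j *: m j
    = i (\sum_j c (lshift r'' j) *: m' j) + \sum_j c (rshift r' j) *: l (m'' j).
  rewrite big_split_ord linear_sum /=; congr (_ + _); apply: eq_bigr => j _; rewrite /m.
    by rewrite -/(fintype.unsplit (inl j)) fintype.unsplitK linearZ.
  by rewrite -/(fintype.unsplit (inr j)) fintype.unsplitK.
have pi0 x' : p (i x') = 0 by apply/ex; exists x'.
have pm (c : 'I_(r' + r'') -> A) : p (\sum_j c j *: m j) = \sum_j c (rshift r' j) *: m'' j.
  rewrite mE linearD pi0 add0r linear_sum; apply: eq_bigr => j _.
  by rewrite linearZ /= lP.
exists m, (h'' * h'); split.
- by move=> /dom[].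
- move=> c c0; have cr : forall j, c (rshift r' j) = 0.
    by apply: ind''; rewrite /zero_pred -pm c0 linear0.
  have cl : forall j, c (lshift r'' j) = 0.
    apply: ind'; apply: inji; rewrite linear0; move: c0; rewrite mE => <-.
    by rewrite [X in _ + X]big1 ?addr0 // => j _; rewrite cr scale0r.
  move=> j; rewrite -(fintype.splitK j).
  by case: (fintype.split j) => a /=; [exact: cl | exact: cr].
- move=> x; have [c cP] := sp'' (p x).
  have /ex[x' x'E] : p (h'' *: x - \sum_j c j *: l (m'' j)) = 0.
    rewrite linearB linearZ /= cP linear_sum -sumrB big1 // => j _.
    by rewrite linearZ /= lP subrr.
  have [d dP] := sp' x'.
  exists (fun j => match fintype.split j with inl a => d a | inr b => h' * c b end).
  rewrite mE.
  under eq_bigr do rewrite -/(fintype.unsplit (inl _)) fintype.unsplitK.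
  under [X in _ + X]eq_bigr do rewrite -/(fintype.unsplit (inr _)) fintype.unsplitK -scalerA.
  by rewrite -dP linearZ /= x'E -scaler_sumr -scalerDr subrK scalerA mulrC.
Qed.

Lemma near_basis_of_zero (M : lmodType A) : (forall x : M, x = 0) -> near_basis M 0.
Proof.
move=> z; exists (fun=> 0), 1; split.
- by apply/eqP; exact: oner_neq0.
- by move=> ? ? [].
- by move=> x; rewrite [_ *: x]z; exact: (submod0 (submod_span _)).
Qed.

End NearBases.

Section LocalBases.
Variables (k : fieldType) (A : comNzRingType) (ev : {rmorphism A -> k}).

Lemma ev_neq0 a : ev a != 0 -> a <> 0.
Proof. by move=> h a0; move: h; rewrite a0 rmorph0 eqxx. Qed.

Lemma ev_prod_neq0 n (h : 'I_n -> A) (P : pred 'I_n) : (forall i, ev (h i) != 0) ->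
  ev (\prod_(i | P i) h i) != 0.
Proof. by move=> hn; rewrite rmorph_prod; apply/prodf_neq0 => i _. Qed.

Lemma local_near_basis (E : lmodType A) r : local_basis E ev r -> near_basis E r.
Proof. by move=> [m [h [h0 ind sp]]]; exists m, h; split=> //; apply: ev_neq0. Qed.

(** The local ring at the point is a discrete valuation ring with
    uniformizer [pi]. *)
Definition uniformizer (pi : A) := forall a, a <> 0 -> exists (n : nat) (u h : A),
  [/\ ev u != 0, ev h != 0 & h * a = u * pi ^+ n].

(** A generating family over the local ring of minimal size is independent:
    dividing a relation by the smallest power of [pi] occurring in it makes one
    coefficient a unit. *)
Lemma local_basis_exists (E : lmodType A) pi : finitely_generated E -> uniformizer pi ->
  (forall x : E, pi *: x = 0 -> x = 0) -> exists r, local_basis E ev r.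
Proof.
move=> [n [g gP]] unif tf.
pose good s := `[< exists (m : 'I_s -> E) h, ev h != 0 /\ forall x, span_of m (h *: x) >].
have exg : exists s, good s.
  exists n; apply/asboolP; exists g, 1; rewrite rmorph1 oner_neq0; split=> // x.
  by rewrite scale1r; have [a ->] := gP x; exists a.
case: (ex_minnP exg) => s /asboolP[m [h [h0 sp]]] smin.
exists s, m, h; split=> // a a0; apply: contrapT => /existsNP[i0 ai0].
have tfn e (x : E) : pi ^+ e *: x = 0 -> x = 0.
  elim: e => [|e IH]; first by rewrite scale1r.
  by rewrite exprS -scalerA => /tf/IH.
have /choice[N NP] : forall i, exists e, a i <> 0 ->
    exists u h', [/\ ev u != 0, ev h' != 0 & h' * a i = u * pi ^+ e].
  move=> i; have [ai|ai] := pselect (a i = 0); first by exists 0%N.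
  by have [e [u [h' ?]]] := unif _ ai; exists e => _; exists u, h'.
have [j aj jmin] : exists2 j, a j <> 0 & forall i, a i <> 0 -> (N j <= N i)%N.
  have p0 : `[< a i0 <> 0 >] by apply/asboolP.
  have [j pj jmin] := @arg_minnP _ i0 (fun i => `[< a i <> 0 >]) N p0.
  exists j; first exact/asboolP.
  by move=> i ai; apply: jmin; apply/asboolP.
have /choice[H /choice[b HbP]] : forall i, exists H, exists b,
    [/\ ev H != 0, H * a i = b * pi ^+ N j & i = j -> ev b != 0].
  move=> i; have [ai|ai] := pselect (a i = 0).
    exists 1, 0; rewrite rmorph1 oner_neq0 ai mulr0 mul0r; split=> // ij.
    by case: aj; rewrite -ij.
  have [u [h' [u0 h'0 e]]] := NP i ai.
  exists h', (u * pi ^+ (N i - N j)); split=> //.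
    by rewrite e -mulrA -exprD subnK // jmin.
  by move=> ->; rewrite subnn mulr1.
pose B i := (\prod_(l | l != i) H l) * b i.
have Bj : ev (B j) != 0.
  rewrite rmorphM mulf_neq0 //; first by apply: ev_prod_neq0 => i; case: (HbP i).
  by case: (HbP j) => _ _; apply.
have B0 : \sum_i B i *: m i = 0.
  apply: (tfn (N j)); transitivity ((\prod_l H l) *: \sum_i a i *: m i).
    rewrite !scaler_sumr; apply: eq_bigr => i _.
    rewrite !scalerA; congr (_ *: _); have [_ e _] := HbP i.
    by rewrite /B [in RHS](bigD1 i) //= [pi ^+ _ * _]mulrC -mulrA -e; ring.
  by rewrite a0 scaler0.
have sgt0 : (0 < s)%N by apply: leq_trans (ltn_ord i0).
case: s => // s in m sp smin a a0 i0 ai0 N NP j aj jmin H b HbP B Bj B0 sgt0 *.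
suff /smin : good s by rewrite ltnn.
apply/asboolP; exists (fun l => m (lift j l)), (B j * h); rewrite rmorphM mulf_neq0 //.
split=> // x; have [c cP] := sp x.
exists (fun l => B j * c (lift j l) - c j * B (lift j l)).
rewrite -scalerA cP (bigD1_ord j) //= scalerDr scaler_sumr.
move: B0; rewrite (bigD1_ord j) //= => /eqP; rewrite addr_eq0 => /eqP Bm.
rewrite scalerA mulrC -scalerA Bm scalerN addrC scaler_sumr -sumrB.
by apply: eq_bigr => l _; rewrite scalerBl !scalerA.
Qed.

End LocalBases.

(** * Finite quotients *)

Section FiniteQuotients.
Variables (k : closedFieldType) (A : comNzRingType) (phi : {rmorphism k -> A}).

Definition cofinite_mod (b : A) (S : seq A) (a : A) :=
  exists (c : nat -> k) a', a = \sum_(i < size S) phi (c i) * S`_i + b * a'.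

Lemma cofinite_modD b S u v :
  cofinite_mod b S u -> cofinite_mod b S v -> cofinite_mod b S (u + v).
Proof.
move=> [c [a ->]] [d [e ->]]; exists (fun i => c i + d i), (a + e).
rewrite mulrDr addrACA -big_split; congr (_ + _); apply: eq_bigr => i _.
by rewrite rmorphD mulrDl.
Qed.

Lemma cofinite_modZ b S t u : cofinite_mod b S u -> cofinite_mod b S (phi t * u).
Proof.
move=> [c [a ->]]; exists (fun i => t * c i), (phi t * a).
rewrite mulrDr mulr_sumr mulrCA; congr (_ + _); apply: eq_bigr => i _.
by rewrite rmorphM mulrA.
Qed.

Lemma cofinite_modB b S u v :
  cofinite_mod b S u -> cofinite_mod b S v -> cofinite_mod b S (u - v).
Proof.
move=> hu hv; apply: cofinite_modD => //.
by rewrite -mulN1r -(rmorph1 phi) -rmorphN; apply: cofinite_modZ.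
Qed.

Lemma cofinite_mod_mem b S s : s \in S -> cofinite_mod b S s.
Proof.
move=> sS; exists (fun i => (i == index s S)%:R), 0.
have lt : (index s S < size S)%N by rewrite index_mem.
rewrite mulr0 addr0 (bigD1 (Ordinal lt)) //= eqxx rmorph1 mul1r nth_index //.
rewrite big1 ?addr0 // => i; rewrite -val_eqE /= => /negPf ->.
by rewrite rmorph0 mul0r.
Qed.

Lemma cofinite_mod_mul b S a : cofinite_mod b S (b * a).
Proof.
by exists (fun=> 0), a; rewrite big1 ?add0r // => i _; rewrite rmorph0 mul0r.
Qed.

Lemma cofinite_mod_sum b S n (c : 'I_n -> k) (F : 'I_n -> A) :
  (forall i, cofinite_mod b S (F i)) -> cofinite_mod b S (\sum_i phi (c i) * F i).
Proof.
move=> h; elim/big_ind: _ => [|u v|i _]; last by apply: cofinite_modZ.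
- by rewrite -(mulr0 b); exact: cofinite_mod_mul.
- exact: cofinite_modD.
Qed.

(** [A / b A] is a finite-dimensional vector space over [k]. *)
Definition cofinite (b : A) := exists S, forall a, cofinite_mod b S a.

(** The span of [S] together with the multiples of [b] contains [1] and is stable under the
    generators. *)
Lemma cofinite_gen z1 z2 b S : generated_by phi z1 z2 -> cofinite_mod b S 1 ->
  {in S, forall s, cofinite_mod b S (z1 * s)} ->
  {in S, forall s, cofinite_mod b S (z2 * s)} -> cofinite b.
Proof.
move=> gen S1 Sz1 Sz2; exists S => a.
have stable z : {in S, forall s, cofinite_mod b S (z * s)} ->
    forall u, cofinite_mod b S u -> cofinite_mod b S (z * u).
  move=> h u [c [a' ->]]; rewrite mulrDr mulr_sumr mulrCA; apply: cofinite_modD.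
    under eq_bigr do rewrite mulrCA.
    by apply: cofinite_mod_sum => i; apply: h; rewrite mem_nth.
  exact: cofinite_mod_mul.
elim/gen: a => [c|u v hu hv|u hu|u hu]; [|exact: cofinite_modD|exact: stable|exact: stable].
by rewrite -[phi c]mulr1; apply: cofinite_modZ.
Qed.

Lemma cofinite_unit b b' : b * b' = 1 -> cofinite b.
Proof. by move=> bb'; exists [::] => a; rewrite -[a]mul1r -bb' -mulrA; exact: cofinite_mod_mul. Qed.

(** [A / b b' A] is filtered by [A / b A] and a quotient of [A / b' A]. *)
Lemma cofinite_mul b b' : cofinite b -> cofinite b' -> cofinite (b * b').
Proof.
move=> [S SP] [S' S'P]; exists (S ++ map (fun s => b * s) S') => a.
have [c [a' ->]] := SP a; have [c' [a'' ->]] := S'P a'.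
apply: cofinite_modD.
  apply: (@cofinite_mod_sum _ _ _ (fun i => c i)) => i; apply: cofinite_mod_mem.
  by rewrite mem_cat mem_nth.
rewrite mulrDr mulr_sumr; apply: cofinite_modD.
  under eq_bigr do rewrite mulrCA.
  apply: (@cofinite_mod_sum _ _ _ (fun i => c' i)) => i; apply: cofinite_mod_mem.
  by rewrite mem_cat; apply/orP; right; apply: map_f; rewrite mem_nth.
by rewrite mulrA; exact: cofinite_mod_mul.
Qed.

Lemma cofinite_dvd b c : cofinite (b * c) -> cofinite b.
Proof.
move=> [S SP]; exists S => a; have [d [a' ->]] := SP a.
by exists d, (c * a'); rewrite mulrA.
Qed.

(** [M / L] is a quotient of a finite power of [A / b A]. *)
Lemma cofinite_dim (M : lmodType A) (L : M -> Prop) b : cofinite b ->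
  finitely_generated M -> submodule L -> (forall m, L (b *: m)) ->
  exists n, dim_quo (V := restr phi M) (fun=> True) L n.
Proof.
move=> [S SP] [d [g gP]] sL bL.
pose I := ('I_d * 'I_(size S))%type.
pose w (j : 'I_#|{: I}|) : restr phi M := S`_(enum_val j).2 *: g (enum_val j).1.
have [||//|n dn _] := @dim_of_span _ (restr phi M) (fun=> True) L _ w.
- exact: submod_top.
- exact: restr_submod.
- move=> m _; have [a ->] := gP m.
  have /choice[c cP] : forall i, exists c : nat -> k, exists a',
    a i = \sum_(l < size S) phi (c l) * S`_l + b * a' by move=> i; exact: SP.
  have [a' aP] := choice cP.
  exists (fun j : 'I_#|{: I}| => c (enum_val j).1 (enum_val j).2).
  have -> : \sum_(j : 'I_#|{: I}|) c (enum_val j).1 (enum_val j).2 *: w j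
     = \sum_i \sum_(l < size S) (phi (c i l) * S`_l) *: g i.
    rewrite pair_bigA /= [RHS](reindex (@enum_val _ {: I})) /=; last first.
      by exists enum_rank => p _; rewrite ?enum_valK ?enum_rankK.
    by apply: eq_bigr => j _; rewrite restrZ scalerA.
  rewrite -sumrB; apply: (submod_sum _ sL) => i _.
  have -> : a i *: g i - \sum_(l < size S) (phi (c i l) * S`_l) *: g i = b *: (a' i *: g i).
    by rewrite -scaler_suml -scalerBl aP addrAC subrr add0r scalerA.
  exact: bL.
- by exists n.
Qed.

(** The powers of [z] are dependent in [A / b A]. *)
Lemma cofinite_poly b z : cofinite b -> exists2 q : {poly k}, q != 0 &
  exists a, peval phi q z = b * a.
Proof.
move=> cb; pose L (x : A^o) := exists a, x = b * a.
have sL : submodule L.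
  split; first by exists 0; rewrite mulr0.
  by move=> a _ _ [u ->] [v ->]; exists (a * u + v); rewrite mulrDr mulrCA.
have fg : finitely_generated A^o.
  by exists 1%N, (fun=> 1) => a; exists (fun=> a); rewrite big_ord1 /GRing.scale /= mulr1.
have [n dn] := cofinite_dim cb fg sL (fun m => ex_intro _ m erefl).
have [q q0 [a aE]] := finite_annihilator z (submod_top _) sL dn (f := 1) I.
by exists q => //; exists a; rewrite -aE /GRing.scale /= mulr1.
Qed.

End FiniteQuotients.

Section Nakayama.
Variables (k : closedFieldType) (A : comNzRingType) (phi : {rmorphism k -> A}).
Variables (ev : {rmorphism A -> k}) (evphi : forall c, ev (phi c) = c).
Variables (E : lmodType A) (fgE : finitely_generated E).

(** If some nonzero element of [E] is killed by the maximal ideal, then [E] is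
    not equal to that ideal times itself, so it has the residue field as a
    quotient. *)
Lemma residue_functional (e : E) : e <> 0 -> (forall b, b *: e = phi (ev b) *: e) ->
  exists la : E -> k, [/\ exists x, la x <> 0, forall x y, la (x + y) = la x + la y &
    forall a x, la (a *: x) = ev a * la x].
Proof.
move=> e0 eP; have [d [g gP]] := fgE.
pose mE x := exists a : 'I_d -> A, (forall i, ev (a i) = 0) /\ x = \sum_i a i *: g i.
have smE : submodule mE.
  split; first by exists (fun=> 0); rewrite rmorph0 big1 // => i _; rewrite scale0r.
  move=> c _ _ [a [a0 ->]] [b [b0 ->]]; exists (fun i => c * a i + b i); split.
    by move=> i; rewrite rmorphD rmorphM a0 b0 mulr0 addr0.
  by rewrite scaler_sumr -big_split; apply: eq_bigr => i _; rewrite scalerDl scalerA.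
have mEx a x : ev a = 0 -> mE (a *: x).
  move=> a0; have [b ->] := gP x; exists (fun i => a * b i); split.
    by move=> i; rewrite rmorphM a0 mul0r.
  by rewrite scaler_sumr; apply: eq_bigr => i _; rewrite scalerA.
have mEev a x : mE (a *: x - phi (ev a) *: x).
  by rewrite -scalerBl; apply: mEx; rewrite rmorphB evphi subrr.
have [||x _|n dn _] := @dim_of_span _ (restr phi E) (fun=> True) mE d g.
- exact: submod_top.
- exact: restr_submod.
- have [a ->] := gP x; exists (fun i => ev (a i)); rewrite -sumrB.
  by apply: (submod_sum _ smE) => i _; exact: mEev.
(* Were [E] the maximal ideal times itself, the determinant trick would kill [e]. *)
case: n dn => [|n] dn.
  have /choice[B BP] : forall i, exists a : 'I_d -> A, (forall j, ev (a j) = 0) /\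
      g i = \sum_j a j *: g j by move=> i; exact: dim0_sub dn I.
  pose D := 1%:M - \matrix_(i, j) B i j.
  have D0 i : \sum_j D i j *: g j = 0.
    have [_ gi] := BP i; under eq_bigr do rewrite !mxE scalerBl.
    rewrite sumrB -gi (bigD1 i) //= eqxx scale1r big1 ?addr0 ?subrr //.
    by move=> j; rewrite eq_sym => /negPf ->; rewrite scale0r.
  have detD i : \det D *: g i = 0.
    have <- : \sum_j (\adj D *m D) i j *: g j = \det D *: g i.
      rewrite mul_adj_mx (bigD1 i) //= mxE eqxx mulr1n big1 ?addr0 // => j.
      by rewrite mxE eq_sym => /negPf ->; rewrite scale0r.
    under eq_bigr do rewrite mxE scaler_suml.
    rewrite exchange_big big1 //= => j _.
    by under eq_bigr do rewrite -scalerA; rewrite -scaler_sumr D0 scaler0.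
  have evD : ev (\det D) = 1.
    rewrite -det_map_mx -(det1 k d); congr (\det _).
    apply/matrixP => i j; rewrite !mxE rmorphB rmorph_nat; have [Bi _] := BP i.
    by rewrite Bi subr0.
  case: e0; rewrite -[e]scale1r -(rmorph1 phi) -evD -eP; have [a ->] := gP e.
  rewrite scaler_sumr big1 // => i _.
  by rewrite scalerA mulrC -scalerA detD scaler0.
have [v [_ ind sp]] := dn.
have [co coP] := choice (fun x => sp x I).
have coU x (c : 'I_n.+1 -> k) : mE (x - \sum_i phi (c i) *: v i) -> co x ord0 = c ord0.
  move=> h; apply/eqP; rewrite -subr_eq0; apply/eqP; apply: (ind (fun i => co x i - c i)).
  have := submodB smE h (coP x); congr mE.
  under [in RHS]eq_bigr do rewrite scalerBl.
  by rewrite sumrB opprB addrC addrA subrK.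
exists (fun x => co x ord0); split.
- exists (v ord0); rewrite (coU _ (fun i => (i == ord0)%:R)).
    by apply/eqP; rewrite eqxx oner_neq0.
  rewrite (bigD1 ord0) //= rmorph1 scale1r big1 ?addr0 ?subrr; first exact: submod0.
  by move=> i /negPf ->; rewrite rmorph0 scale0r.
- move=> x y; apply: (coU _ (fun i => co x i + co y i)).
  have := submodD smE (coP x) (coP y); congr mE.
  under [in RHS]eq_bigr do rewrite rmorphD scalerDl.
  by rewrite big_split opprD addrACA.
- move=> a x; apply: (coU _ (fun i => ev a * co x i)).
  have := submodD smE (mEev a x) (submodZ (phi (ev a)) smE (coP x)); congr mE.
  rewrite scalerBr scaler_sumr addrA subrK; congr (_ - _).
  by apply: eq_bigr => i _; rewrite restrZ scalerA rmorphM.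
Qed.

End Nakayama.

(** * The coordinate ring of the affine curve *)

Section RingU.
Variables (k : closedFieldType) (X : elliptic_curve k).
Local Notation U := (ringU X).

Definition cubic : {poly k} := 'X^3 + a2 X *: 'X^2 + a4 X *: 'X + (a6 X)%:P.
Definition slant : {poly k} := a1 X *: 'X + (a3 X)%:P.

Definition classU (p : {poly {poly k}}) : U := in_qpoly (eqnU X) p.

Fact classU_zmod : zmod_morphism classU.
Proof. by move=> p q; rewrite /classU raddfB. Qed.
Fact classU_monoid : monoid_morphism classU.
Proof. by split; [exact: in_qpoly1 | move=> p q; exact: in_qpolyM]. Qed.
HB.instance Definition _ := GRing.isZmodMorphism.Build {poly {poly k}} U classU classU_zmod.
HB.instance Definition _ := GRing.isMonoidMorphism.Build {poly {poly k}} U classU classU_monoid.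

Lemma classU_eqn : classU (eqnU X) = 0.
Proof.
apply: val_inj => /=; rewrite mk_monic_eqnU Pdiv.RingMonic.rmodpp //.
by apply/monicP; case: (eqnU_size_lead X).
Qed.

Definition polyU (p : {poly k}) : U := classU p%:P.

Fact polyU_zmod : zmod_morphism polyU.
Proof. by move=> p q; rewrite /polyU polyCB rmorphB. Qed.
Fact polyU_monoid : monoid_morphism polyU.
Proof.
split; first by rewrite /polyU polyC1 rmorph1.
by move=> p q; rewrite /polyU polyCM rmorphM.
Qed.
HB.instance Definition _ := GRing.isZmodMorphism.Build {poly k} U polyU polyU_zmod.
HB.instance Definition _ := GRing.isMonoidMorphism.Build {poly k} U polyU polyU_monoid.

Definition scalU : {rmorphism k -> U} := polyU \o polyC.

Lemma scalUE c : scalU c = constU c. Proof. by []. Qed.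

Lemma polyUX : polyU 'X = xU. Proof. by []. Qed.
Lemma polyUC c : polyU c%:P = scalU c. Proof. by []. Qed.

Definition partA (u : U) : {poly k} := (u : {poly %/ eqnU X})`_0.
Definition partB (u : U) : {poly k} := (u : {poly %/ eqnU X})`_1.

Lemma partAB (u : U) : u = polyU (partA u) + polyU (partB u) * yU.
Proof.
rewrite /polyU -[yU]/(classU 'X) -rmorphM -rmorphD; apply: val_inj.
have sz : (size (polyn u) <= 2)%N.
  rewrite -ltnS; apply: leq_trans (size_mk_monic (u : {poly %/ eqnU X})) _.
  by rewrite mk_monic_eqnU (eqnU_size_lead X).1.
have e : polyn u = (partA u)%:P + (partB u)%:P * 'X.
  apply/polyP => i; rewrite coefD coefC coefCM coefX /partA /partB.
  case: i => [|[|i]] /=; rewrite ?mulr0 ?addr0 ?mulr1 ?add0r //.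
  by rewrite nth_default // (leq_trans sz).
by rewrite -e; symmetry; apply: in_qpoly_small; exact: (size_mk_monic (u : {poly %/ eqnU X})).
Qed.

Lemma partU a b : partA (polyU a + polyU b * yU) = a /\ partB (polyU a + polyU b * yU) = b.
Proof.
rewrite /partA /partB /polyU -[yU]/(classU 'X) -rmorphM -rmorphD /classU in_qpoly_small.
  by rewrite !coefD !coefC !coefCM !coefX /= mulr0 addr0 mulr1 add0r.
rewrite mk_monic_eqnU (eqnU_size_lead X).1 addrC -cons_poly_def size_cons_poly.
by case: ifP => // _; rewrite ltnS (leq_ltn_trans (size_polyC_leq1 _)).
Qed.

Lemma eqU : yU ^+ 2 = polyU cubic - polyU slant * yU :> U.
Proof.
have : classU ('X^2 + slant%:P * 'X - cubic%:P) = 0 by exact: classU_eqn.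
rewrite rmorphB rmorphD !rmorphM => /eqP; rewrite subr_eq0 => /eqP e.
change (yU * yU + polyU slant * yU = polyU cubic) in e.
by rewrite expr2 -e addrK.
Qed.

Lemma mulU a b c d : (polyU a + polyU b * yU) * (polyU c + polyU d * yU) =
  polyU (a * c + b * d * cubic) + polyU (a * d + b * c - b * d * slant) * yU.
Proof.
rewrite rmorphB !rmorphD !rmorphM mulrDl !mulrDr.
have -> : polyU b * yU * (polyU d * yU) = polyU b * polyU d * yU ^+ 2 by ring.
rewrite eqU; ring.
Qed.

Lemma partAM u v : partA (u * v) = partA u * partA v + partB u * partB v * cubic.
Proof. by rewrite {1}(partAB u) {1}(partAB v) mulU; case: (partU (partA u * partA v + partB u * partB v * cubic) (partA u * partB v + partB u * partA v - partB u * partB v * slant)). Qed.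

Lemma partBM u v : partB (u * v) =
  partA u * partB v + partB u * partA v - partB u * partB v * slant.
Proof. by rewrite {1}(partAB u) {1}(partAB v) mulU; case: (partU (partA u * partA v + partB u * partB v * cubic) (partA u * partB v + partB u * partA v - partB u * partB v * slant)). Qed.

Lemma partAD u v : partA (u + v) = partA u + partA v.
Proof. by rewrite /partA -coefD. Qed.
Lemma partBD u v : partB (u + v) = partB u + partB v.
Proof. by rewrite /partB -coefD. Qed.

Lemma partA_poly p : partA (polyU p) = p.
Proof. by have [h _] := partU p 0; move: h; rewrite rmorph0 mul0r addr0. Qed.
Lemma partB_poly p : partB (polyU p) = 0.
Proof. by have [_ h] := partU p 0; move: h; rewrite rmorph0 mul0r addr0. Qed.

Lemma polyU_inj p : polyU p = 0 -> p = 0.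
Proof. by move=> h; rewrite -(partA_poly p) h -[0](rmorph0 polyU) partA_poly. Qed.

(** The norm from the coordinate ring, free of rank two, down to [k[x]]. *)
Definition normU (u : U) : {poly k} :=
  partA u ^+ 2 - partA u * partB u * slant - partB u ^+ 2 * cubic.

Lemma normUM u v : normU (u * v) = normU u * normU v.
Proof. by rewrite /normU partAM partBM; ring. Qed.

Lemma normU_poly p : normU (polyU p) = p ^+ 2.
Proof. by rewrite /normU partA_poly partB_poly; ring. Qed.

Lemma normU_mult u : exists v, u * v = polyU (normU u).
Proof.
exists (polyU (partA u - slant * partB u) + polyU (- partB u) * yU).
rewrite {1}(partAB u) mulU /normU.
set a := partA u; set b := partB u.
have -> : a * - b + b * (a - slant * b) - b * - b * slant = 0 by ring.
by rewrite rmorph0 mul0r addr0; congr polyU; ring.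
Qed.

Lemma size_cubic : size cubic = 4%N.
Proof.
rewrite /cubic -2!addrA size_polyDl ?size_polyXn // addrA.
rewrite (leq_ltn_trans (size_polyD _ _)) // gtn_max (leq_ltn_trans (size_polyC_leq1 _)) // andbT.
rewrite (leq_ltn_trans (size_polyD _ _)) // gtn_max.
by rewrite !(leq_ltn_trans (size_scale_leq _ _)) // ?size_polyXn ?size_polyX.
Qed.

Lemma size_slant : (size slant <= 2)%N.
Proof.
rewrite /slant (leq_trans (size_polyD _ _)) // geq_max (leq_trans (size_polyC_leq1 _)) // andbT.
by rewrite (leq_trans (size_scale_leq _ _)) // size_polyX.
Qed.

Definition weight_bound (a b : {poly k}) : nat :=
  maxn ((size a).*2.-1) (if b == 0 then 0 else (size b).*2.+2).

(** The two leading terms have degrees of different parity. *)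
Lemma size_normU u : size (normU u) = weight_bound (partA u) (partB u).
Proof.
rewrite /normU /weight_bound; move: (partA u) (partB u) => a b.
have [->|b0] := eqVneq b 0.
  rewrite mulr0 mul0r expr0n /= mul0r !subr0 maxn0.
  have [->|a0] := eqVneq a 0; first by rewrite expr0n size_poly0.
  by rewrite expr2 size_mul // addnn.
have C0 : cubic != 0 by rewrite -size_poly_eq0 size_cubic.
have sb : (0 < size b)%N by rewrite size_poly_gt0.
have sbC : size (b ^+ 2 * cubic) = (size b).*2.+2.
  by rewrite size_mul ?expf_neq0 // size_cubic expr2 size_mul //; move: (size b) sb => n; lia.
have [->|a0] := eqVneq a 0.
  by rewrite expr0n !mul0r subr0 sub0r size_polyN sbC size_poly0 max0n.
have sa : (0 < size a)%N by rewrite size_poly_gt0.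
have sa2 : size (a ^+ 2) = (size a).*2.-1 by rewrite expr2 size_mul // addnn.
have sabl : (size (a * b * slant)%R <= size a + size b)%N.
  apply: leq_trans (size_polyMleq _ _) _; rewrite size_mul //.
  by have := size_slant; move: (size slant) (size a) (size b) sa sb => p q r; lia.
have := size_polyD (- (a * b * slant)) (- (b ^+ 2 * cubic)).
have := size_polyD (- (a * b * slant)) (a ^+ 2).
rewrite !size_polyN -opprD size_polyN sbC sa2.
have [lt|ge] := ltnP (size b).+1 (size a) => h1 h2.
  rewrite -addrA -opprD size_polyDl sa2.
    by rewrite (maxn_idPl _) //; move: (size a) (size b) lt => p q; lia.
  rewrite size_polyN; apply: leq_ltn_trans h2 _; rewrite gtn_max.
  by move: sabl; move: (size a) (size b) (size (a * b * slant)%R) lt sa sb => p q r; lia.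
have lt2 : (size (a ^+ 2 - a * b * slant)%R < (size b).*2.+2)%N.
  rewrite addrC; apply: leq_ltn_trans h1 _; rewrite gtn_max.
  by move: sabl; move: (size a) (size b) (size (a * b * slant)%R) ge sa sb => p q r; lia.
rewrite addrC size_polyDl size_polyN sbC //.
by rewrite (maxn_idPr _) //; move: (size a) (size b) ge => p q; lia.
Qed.

Lemma normU_eq0 u : normU u = 0 -> u = 0.
Proof.
move=> /eqP; rewrite -size_poly_eq0 size_normU /weight_bound => /eqP.
have [b0|b0] := eqVneq (partB u) 0; last by move=> h; have := leq_maxr ((size (partA u)).*2.-1) ((size (partB u)).*2.+2); rewrite h.
rewrite maxn0 => h; rewrite (partAB u) b0 rmorph0 mul0r addr0.
suff -> : partA u = 0 by rewrite rmorph0.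
by apply/eqP; rewrite -size_poly_eq0; apply/eqP; lia.
Qed.

(** The norm is multiplicative and vanishes only at zero. *)
Lemma domainU : is_domain U.
Proof.
move=> u v uv; have : normU u * normU v = 0.
  by rewrite -normUM uv -[0](rmorph0 polyU) normU_poly expr0n.
by move=> /eqP; rewrite mulf_eq0 => /orP[] /eqP /normU_eq0; auto.
Qed.

(** [weight u m]: the pole order of [u] at infinity is less than [m]. *)
Definition weight (u : U) (m : nat) := (size (normU u) <= m)%N.

Lemma weightD u v m : weight u m -> weight v m -> weight (u + v) m.
Proof.
rewrite /weight !size_normU /weight_bound partAD partBD.
set a := partA u; set b := partB u; set c := partA v; set d := partB v.
rewrite !geq_max => /andP[ha hb] /andP[hc hd].
have := size_polyD a c; have := size_polyD b d; rewrite !leq_max => hbd hac.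
apply/andP; split; first by case/orP: hac => ?; lia.
case: eqVneq => // bd0.
have [b0|b0] := eqVneq b 0.
  move: hd; have [d0|d0] := eqVneq d 0; first by rewrite b0 d0 addr0 eqxx in bd0.
  by rewrite b0 add0r.
rewrite (negPf b0) in hb.
have [d0|d0] := eqVneq d 0; first by rewrite d0 addr0.
rewrite (negPf d0) in hd.
by case/orP: hbd => ?; lia.
Qed.

Lemma weightM u v m n : weight u m -> weight v n.+1 -> weight (u * v) (m + n).
Proof.
rewrite /weight normUM => hu hv.
have [->|u0] := eqVneq (normU u) 0; first by rewrite mul0r size_poly0.
have [->|v0] := eqVneq (normU v) 0; first by rewrite mulr0 size_poly0.
by rewrite size_mul //; move: (size (normU u)) (size (normU v)) hu hv => p q; lia.
Qed.

Lemma weight_scal c : weight (scalU c) 1.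
Proof.
by rewrite /weight -polyUC normU_poly -polyC_exp size_polyC_leq1.
Qed.

Lemma partA_y : partA (yU : U) = 0.
Proof. by have [h _] := partU 0 1; move: h; rewrite rmorph0 rmorph1 add0r mul1r. Qed.
Lemma partB_y : partB (yU : U) = 1.
Proof. by have [_ h] := partU 0 1; move: h; rewrite rmorph0 rmorph1 add0r mul1r. Qed.

Lemma normU_yn n : size (normU (yU ^+ n)) = (3 * n).+1.
Proof.
elim: n => [|n IH]; first by rewrite expr0 -(rmorph1 polyU) normU_poly expr1n size_poly1.
rewrite exprS normUM.
have -> : normU yU = - cubic by rewrite /normU partA_y partB_y; ring.
rewrite size_mul ?oppr_eq0 -?size_poly_eq0 ?size_polyN ?size_cubic ?IH //; lia.
Qed.

Lemma weight_x : weight xU 3.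
Proof. by rewrite /weight -polyUX normU_poly size_polyXn. Qed.

Lemma yU_neq0 : (yU : U) <> 0.
Proof.
by move=> y0; have := normU_yn 1; rewrite expr1 y0 -[0](rmorph0 polyU) normU_poly expr0n size_poly0.
Qed.

Lemma xU_sub_neq0 c : (xU : U) - scalU c <> 0.
Proof.
by rewrite -polyUX -polyUC -rmorphB => /polyU_inj/eqP; rewrite polyXsubC_eq0.
Qed.

Lemma yU_sub_neq0 c : (yU : U) - scalU c <> 0.
Proof.
move=> /(congr1 partB); rewrite -[- _]rmorphN partBD partB_y partB_poly addr0.
by rewrite -[0](rmorph0 polyU) partB_poly => /eqP; rewrite oner_eq0.
Qed.

Lemma generatedU : generated_by scalU xU yU.
Proof.
move=> S Sc SD Sx Sy u.
have Sp p : S (polyU p).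
  elim/poly_ind: p => [|p c IH]; first by rewrite rmorph0 -(rmorph0 scalU).
  by rewrite rmorphD rmorphM mulrC; apply: SD; [apply: Sx | exact: Sc].
by rewrite (partAB u); apply: SD => //; rewrite mulrC; apply: Sy.
Qed.

Lemma polyU_mod p al : exists a, polyU p = scalU p.[al] + (xU - scalU al) * a.
Proof.
have : root (p - p.[al]%:P) al by rewrite /root !hornerE subrr.
move=> /factor_theorem[q /eqP]; rewrite subr_eq => /eqP e.
exists (polyU q); rewrite {1}e rmorphD rmorphM rmorphB /= polyUX !polyUC; ring.
Qed.

Lemma cofinite_x al : cofinite scalU ((xU : U) - scalU al).
Proof.
have C1 : cofinite_mod scalU (xU - scalU al) [:: 1; yU : U] 1 by apply: cofinite_mod_mem; rewrite inE eqxx.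
have Cy : cofinite_mod scalU (xU - scalU al) [:: 1; yU : U] yU by apply: cofinite_mod_mem; rewrite !inE eqxx orbT.
apply: (cofinite_gen (S := [:: 1; yU]) generatedU) => // s; rewrite !inE => /orP[] /eqP ->.
- have -> : xU * 1 = (xU - scalU al) * 1 + scalU al * 1 :> U by ring.
  by apply: cofinite_modD; [exact: cofinite_mod_mul | exact: cofinite_modZ].
- have -> : xU * yU = (xU - scalU al) * yU + scalU al * yU :> U by ring.
  by apply: cofinite_modD; [exact: cofinite_mod_mul | exact: cofinite_modZ].
- by rewrite mulr1.
- rewrite -expr2 eqU; have [a ->] := polyU_mod cubic al; have [b ->] := polyU_mod slant al.
  rewrite [(_ + _ * _) * yU]mulrDl; apply: cofinite_modB; apply: cofinite_modD.
  + by rewrite -[scalU cubic.[al]]mulr1; apply: cofinite_modZ.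
  + exact: cofinite_mod_mul.
  + exact: cofinite_modZ.
  + by rewrite -mulrA; exact: cofinite_mod_mul.
Qed.

Lemma cofinite_polyU p : p != 0 -> cofinite scalU (polyU p).
Proof.
move=> p0; have [rs ->] := closed_field_poly_normal p.
rewrite -mul_polyC rmorphM; apply: cofinite_mul.
  apply: (@cofinite_unit _ _ _ _ (scalU (lead_coef p)^-1)).
  change (polyU (lead_coef p)%:P * polyU ((lead_coef p)^-1)%:P = 1).
  by rewrite -rmorphM -polyCM mulfV ?rmorph1 // lead_coef_eq0.
elim: rs => [|al rs IH].
  by rewrite big_nil rmorph1; apply: (@cofinite_unit _ _ _ _ 1); rewrite mulr1.
rewrite big_cons rmorphM; apply: cofinite_mul => //.
by rewrite rmorphB; exact: cofinite_x.
Qed.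

(** An element divides its norm, which is a polynomial in [x]. *)
Lemma cofiniteU (u : U) : u <> 0 -> cofinite scalU u.
Proof.
move=> u0; have [v uv] := normU_mult u.
apply: (@cofinite_dvd _ _ _ _ v); rewrite uv; apply: cofinite_polyU.
by apply/eqP => /normU_eq0.
Qed.

(** * Points of the affine curve *)

Section EvalU.
Variables al be : k.
Hypothesis on_curve : be ^+ 2 = cubic.[al] - slant.[al] * be.

Definition evalU_fun (u : U) : k := (partA u).[al] + (partB u).[al] * be.

Fact evalU_zmod : zmod_morphism evalU_fun.
Proof.
move=> u v; rewrite /evalU_fun partAD partBD.
have -> : partA (- v) = - partA v by rewrite /partA -coefN.
have -> : partB (- v) = - partB v by rewrite /partB -coefN.
rewrite !hornerE; ring.
Qed.

Fact evalU_monoid : monoid_morphism evalU_fun.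
Proof.
split.
  by rewrite /evalU_fun -(rmorph1 polyU) partA_poly partB_poly !hornerE; ring.
move=> u v; rewrite /evalU_fun partAM partBM.
move: cubic slant on_curve => C l oc; rewrite !hornerE.
set a := (partA u).[al]; set b := (partB u).[al].
set c := (partA v).[al]; set d := (partB v).[al].
have -> : (a + b * be) * (c + d * be) = a * c + (a * d + b * c) * be + b * d * be ^+ 2 by ring.
rewrite oc; ring.
Qed.

HB.instance Definition _ := GRing.isZmodMorphism.Build U k evalU_fun evalU_zmod.
HB.instance Definition _ := GRing.isMonoidMorphism.Build U k evalU_fun evalU_monoid.

Definition eval_pt : {rmorphism U -> k} := evalU_fun.

Lemma eval_pt_scal c : eval_pt (scalU c) = c.
Proof. by rewrite /eval_pt /= /evalU_fun partA_poly partB_poly !hornerE; ring. Qed.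
Lemma eval_pt_x : eval_pt xU = al.
Proof. by rewrite -polyUX /eval_pt /= /evalU_fun partA_poly partB_poly !hornerE; ring. Qed.
Lemma eval_pt_y : eval_pt yU = be.
Proof. by rewrite /eval_pt /= /evalU_fun partA_y partB_y !hornerE; ring. Qed.

End EvalU.

Section Uniformizer.
Variable (ev : {rmorphism U -> k}) (evphi : forall c, ev (scalU c) = c).
Let al := ev xU.
Let be := ev yU.

Lemma ev_polyU p : ev (polyU p) = p.[al].
Proof. by have [a ->] := polyU_mod p al; rewrite rmorphD rmorphM rmorphB !evphi subrr mul0r addr0. Qed.

Lemma ev_curve : be ^+ 2 = cubic.[al] - slant.[al] * be.
Proof. by rewrite -rmorphXn eqU rmorphB rmorphM !ev_polyU. Qed.

(** It suffices that [pi] generates the maximal ideal up to an element [B] not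
    vanishing at the point, and that every nonzero element divides a power of
    [pi] times such an element. *)
Lemma uniformizer_criterion pi B : pi <> 0 -> ev pi = 0 -> ev B != 0 ->
  (forall a, ev a = 0 -> exists a', B * a = pi * a') ->
  (forall a, a <> 0 -> exists m a' c, ev c != 0 /\ a * a' = pi ^+ m * c) ->
  uniformizer ev pi.
Proof.
move=> pi0 evpi B0 div mult a a0; have [m [a' [c [c0 aa']]]] := mult a a0.
apply: contrapT => no.
have all n : exists h u, ev h != 0 /\ h * a = u * pi ^+ n.
  elim: n => [|n [h [u [h0 hu]]]]; first by exists 1, a; rewrite rmorph1 oner_neq0 mul1r mulr1.
  have u0 : ev u = 0.
    by apply/eqP; apply: contra_notT no => u0; exists n, u, h.
  have [u' uu'] := div u u0; exists (B * h), u'; rewrite rmorphM mulf_neq0 //; split=> //.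
  by rewrite -mulrA hu mulrA uu' exprS; ring.
have [h [u [h0 hu]]] := all m.+1.
have pim : pi ^+ m <> 0.
  elim: m {aa' hu} => [|n IH]; first by apply/eqP; exact: oner_neq0.
  by rewrite exprS => /domainU[].
have /domainU[//|e] : pi ^+ m * (h * c - pi * (u * a')) = 0.
  have : h * a * a' = u * pi ^+ m.+1 * a' by rewrite hu.
  rewrite -mulrA aa' exprS => e; rewrite mulrBr.
  have -> : pi ^+ m * (h * c) = h * (pi ^+ m * c) by ring.
  rewrite e; ring.
have : ev (h * c - pi * (u * a')) = 0 by rewrite e rmorph0.
rewrite rmorphB !rmorphM evpi mul0r subr0 => /eqP.
by rewrite mulf_eq0 (negPf h0) (negPf c0).
Qed.

Let xx : U := xU - scalU al.
Let yy : U := yU - scalU be.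
Let gy := be + be + a1 X * al + a3 X.
Let gx := a1 X * be - (al * al * 3%:R + 2%:R * a2 X * al + a4 X).

Lemma divisible_gen pi B : (exists a, B * xx = pi * a) -> (exists a, B * yy = pi * a) ->
  forall a, ev a = 0 -> exists a', B * a = pi * a'.
Proof.
move=> [dx dxP] [dy dyP] a a0.
suff [a' a'P] : exists a', B * (a - scalU (ev a)) = pi * a'.
  by exists a'; rewrite -a'P a0 rmorph0 subr0.
elim/generatedU: a {a0} => [c|u v [u' uP] [v' vP]|u [u' uP]|u [u' uP]].
- by exists 0; rewrite evphi subrr !mulr0.
- exists (u' + v'); rewrite [RHS]mulrDr -uP -vP !rmorphD; ring.
- exists (dx * u + scalU al * u').
  have -> : pi * (dx * u + scalU al * u') = pi * dx * u + scalU al * (pi * u') by ring.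
  rewrite -uP -dxP !rmorphM -/al /xx; ring.
- exists (dy * u + scalU be * u').
  have -> : pi * (dy * u + scalU be * u') = pi * dy * u + scalU be * (pi * u') by ring.
  rewrite -uP -dyP !rmorphM -/be /yy; ring.
Qed.

(** The equation of the curve expanded at the point: [gy] and [- gx] are the partial
    derivatives. *)
Lemma taylor : yy * (yy + scalU (a1 X) * xx + scalU gy)
  = xx * (xx ^+ 2 + scalU (3%:R * al + a2 X) * xx - scalU gx).
Proof.
have e := eqU; have e0 := congr1 scalU ev_curve.
have cU : polyU cubic = xU ^+ 3 + scalU (a2 X) * xU ^+ 2 + scalU (a4 X) * xU + scalU (a6 X).
  by rewrite /cubic -!mul_polyC !(rmorphD, rmorphXn, rmorphM).
have lU : polyU slant = scalU (a1 X) * xU + scalU (a3 X).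
  by rewrite /slant -!mul_polyC !(rmorphD, rmorphM).
rewrite cU lU in e.
have cA : cubic.[al] = al ^+ 3 + a2 X * al ^+ 2 + a4 X * al + a6 X by rewrite /cubic !hornerE; ring.
have lA : slant.[al] = a1 X * al + a3 X by rewrite /slant !hornerE; ring.
rewrite cA lA !(rmorphB, rmorphD, rmorphM, rmorphXn) in e0.
rewrite /xx /yy /gx /gy !(rmorphB, rmorphD, rmorphM, rmorphXn, rmorph_nat).
have e' : yU ^+ 2 - (xU ^+ 3 + scalU (a2 X) * xU ^+ 2 + scalU (a4 X) * xU + scalU (a6 X)
   - (scalU (a1 X) * xU + scalU (a3 X)) * yU) = 0 :> U by rewrite e subrr.
have e0' : scalU be ^+ 2 - (scalU al ^+ 3 + scalU (a2 X) * scalU al ^+ 2 + scalU (a4 X) * scalU al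
   + scalU (a6 X) - (scalU (a1 X) * scalU al + scalU (a3 X)) * scalU be) = 0 by rewrite e0 subrr.
apply/eqP; rewrite -subr_eq0 -[X in _ == X](subrr 0) -{1}e' -e0'; apply/eqP; ring.
Qed.

Lemma smooth_gradient : gy != 0 \/ gx != 0.
Proof.
have [gy0|] := eqVneq gy 0; last by left.
have [gx0|] := eqVneq gx 0; last by right.
have c := ev_curve.
have [] := @smooth_affine _ X al be.
  have -> : be ^+ 2 = cubic.[al] - slant.[al] * be := c.
  by rewrite /cubic /slant !hornerE; ring.
split; first by rewrite -gx0 /gx; ring.
by rewrite -gy0 /gy; ring.
Qed.

Lemma polyU_order p : p != 0 -> exists m c, ev c != 0 /\ polyU p = xx ^+ m * c.
Proof.
move=> p0; have [m [q nq pE]] := multiplicity_XsubC p al.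
rewrite p0 /= in nq; rewrite pE; exists m, (polyU q); rewrite ev_polyU; split=> //.
by rewrite rmorphM rmorphXn rmorphB mulrC.
Qed.

(** The coordinate [x - x0] is a uniformizer where the derivative with respect to [y] does not
    vanish; elsewhere [y - y0] is one, by smoothness. *)
Theorem uniformizerU : exists pi, [/\ pi <> 0 & uniformizer ev pi].
Proof.
have evx : ev xx = 0 by rewrite /xx rmorphB evphi subrr.
have evy : ev yy = 0 by rewrite /yy rmorphB evphi subrr.
have evD (p q : U) c d : ev (p + scalU c * q + scalU d) = ev p + c * ev q + d.
  by rewrite !rmorphD rmorphM !evphi.
have evB' (p q : U) c d e :
    ev (q ^+ 2 + scalU c * q - scalU d - scalU e * p) = ev q ^+ 2 + c * ev q - d - e * ev p.
  by rewrite !(rmorphB, rmorphD) rmorphXn !rmorphM !evphi.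
have divn a : a <> 0 -> exists m a' c, ev c != 0 /\ a * a' = xx ^+ m * c.
  move=> a0; have [v av] := normU_mult a.
  have [|m [c [c0 e]]] := @polyU_order (normU a); first by apply/eqP => /normU_eq0.
  by exists m, v, c; rewrite av.
have [gy0|gy0] := eqVneq gy 0; last first.
  exists xx; split; first exact: xU_sub_neq0.
  apply: (@uniformizer_criterion _ (yy + scalU (a1 X) * xx + scalU gy)) => //.
  - exact: xU_sub_neq0.
  - by rewrite evD evx evy mulr0 !add0r.
  - apply: divisible_gen; first by eexists; rewrite mulrC.
    by exists (xx ^+ 2 + scalU (3%:R * al + a2 X) * xx - scalU gx); rewrite -taylor mulrC.
have gx0 : gx != 0 by case: smooth_gradient => //; rewrite gy0 eqxx.
(* The tangent is vertical: [yy] is a uniformizer and [xx] has order at least two. *)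
pose B := xx ^+ 2 + scalU (3%:R * al + a2 X) * xx - scalU gx - scalU (a1 X) * yy.
have evB : ev B != 0.
  by rewrite evB' evx evy expr0n /= !mulr0 !add0r subr0 oppr_eq0.
have Bx : B * xx = yy ^+ 2.
  have := taylor; rewrite gy0 rmorph0 addr0 /B => e.
  rewrite expr2 mulrBl mulrC -e; ring.
exists yy; split; first exact: yU_sub_neq0.
apply: (@uniformizer_criterion yy B (@yU_sub_neq0 be) evy evB).
- apply: divisible_gen; first by exists yy; rewrite Bx expr2.
  by exists B; rewrite mulrC.
- move=> a /divn[m [a' [c [c0 e]]]]; exists (2 * m)%N, (a' * B ^+ m), c; split=> //.
  by rewrite mulrA e exprM -Bx exprMn; ring.
Qed.

End Uniformizer.
End RingU.

(** * The coordinate ring of the curve near infinity *)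

Section RingV.
Variables (k : closedFieldType) (X : elliptic_curve k).
Local Notation U := (ringU X).
Local Notation V := (ringV X).

Definition classV (p : {poly {poly k}}) : V := in_qpoly (eqnV X) p.

Fact classV_zmod : zmod_morphism classV.
Proof. by move=> p q; rewrite /classV raddfB. Qed.
Fact classV_monoid : monoid_morphism classV.
Proof. by split; [exact: in_qpoly1 | move=> p q; exact: in_qpolyM]. Qed.
HB.instance Definition _ := GRing.isZmodMorphism.Build {poly {poly k}} V classV classV_zmod.
HB.instance Definition _ := GRing.isMonoidMorphism.Build {poly {poly k}} V classV classV_monoid.

Lemma classV_eqn : classV (eqnV X) = 0.
Proof.
apply: val_inj => /=; rewrite mk_monic_eqnV Pdiv.RingMonic.rmodpp //.
by apply/monicP; case: (eqnV_size_lead X).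
Qed.

Definition polyV (p : {poly k}) : V := classV p%:P.

Fact polyV_zmod : zmod_morphism polyV.
Proof. by move=> p q; rewrite /polyV polyCB rmorphB. Qed.
Fact polyV_monoid : monoid_morphism polyV.
Proof.
split; first by rewrite /polyV polyC1 rmorph1.
by move=> p q; rewrite /polyV polyCM rmorphM.
Qed.
HB.instance Definition _ := GRing.isZmodMorphism.Build {poly k} V polyV polyV_zmod.
HB.instance Definition _ := GRing.isMonoidMorphism.Build {poly k} V polyV polyV_monoid.

Definition scalV : {rmorphism k -> V} := polyV \o polyC.

Lemma scalVE c : scalV c = constV c. Proof. by []. Qed.
Lemma polyVX : polyV 'X = sV. Proof. by []. Qed.
Lemma polyVC c : polyV c%:P = scalV c. Proof. by []. Qed.

Lemma partsV (v : V) : exists b0 b1 b2, v = polyV b0 + polyV b1 * tV + polyV b2 * tV ^+ 2.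
Proof.
pose f := (v : {poly %/ eqnV X}).
exists f`_0, f`_1, f`_2.
rewrite /polyV -[tV]/(classV 'X) -rmorphXn -!rmorphM -!rmorphD; apply: val_inj.
have sz : (size (polyn f) <= 3)%N.
  rewrite -ltnS; apply: leq_trans (size_mk_monic f) _.
  by rewrite mk_monic_eqnV (eqnV_size_lead X).1.
have e : polyn f = (f`_0)%:P + (f`_1)%:P * 'X + (f`_2)%:P * 'X^2.
  apply/polyP => i; rewrite !coefD coefC !coefCM coefX coefXn.
  case: i => [|[|[|i]]] /=; rewrite ?mulr0 ?addr0 ?mulr1 ?add0r //.
  by rewrite nth_default // (leq_trans sz).
by rewrite -e; symmetry; apply: in_qpoly_small; exact: (size_mk_monic f).
Qed.

Definition coefV1 : {poly k} := a4 X *: 'X^2 - a1 X *: 'X.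
Definition coefV0 : {poly k} := a6 X *: 'X^3 - a3 X *: 'X^2 - 'X.

Lemma eqV : tV ^+ 3 = - (polyV (a2 X *: 'X) * tV ^+ 2 + polyV coefV1 * tV + polyV coefV0) :> V.
Proof.
have : classV ('X * ('X * 'X) + (a2 X *: 'X)%:P * ('X * 'X) + coefV1%:P * 'X + coefV0%:P) = 0.
  exact: classV_eqn.
rewrite !(rmorphD, rmorphM) => /eqP; rewrite -!addrA addr_eq0 !addrA => /eqP e.
exact: e.
Qed.

(** The equation near infinity reads [unitV * s = t ^ 3], and [unitV] is [1] at infinity. *)
Definition unitV : V := 1 + scalV (a1 X) * tV + scalV (a3 X) * sV - scalV (a4 X) * sV * tV
  - scalV (a2 X) * tV ^+ 2 - scalV (a6 X) * sV ^+ 2.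

Lemma unitV_s : unitV * sV = tV ^+ 3.
Proof.
rewrite eqV /unitV.
have -> : polyV (a2 X *: 'X) = scalV (a2 X) * sV by rewrite -mul_polyC rmorphM.
have -> : polyV coefV1 = scalV (a4 X) * sV ^+ 2 - scalV (a1 X) * sV.
  by rewrite /coefV1 -!mul_polyC !(rmorphB, rmorphXn, rmorphM).
have -> : polyV coefV0 = scalV (a6 X) * sV ^+ 3 - scalV (a3 X) * sV ^+ 2 - sV.
  by rewrite /coefV0 -!mul_polyC !(rmorphB, rmorphXn, rmorphM).
ring.
Qed.

Lemma generatedV : generated_by scalV sV tV.
Proof.
move=> S Sc SD Ss St v.
have Sp p : S (polyV p).
  elim/poly_ind: p => [|p c IH]; first by rewrite rmorph0 -(rmorph0 scalV).
  by rewrite rmorphD rmorphM mulrC; apply: SD; [apply: Ss | exact: Sc].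
have [b0 [b1 [b2 ->]]] := partsV v.
apply: (SD); first by apply: (SD) => //; rewrite mulrC; apply: (St).
by rewrite mulrC expr2 -mulrA; apply: (St); apply: (St).
Qed.

Lemma polyV_mod p al : exists a, polyV p = scalV p.[al] + (sV - scalV al) * a.
Proof.
have : root (p - p.[al]%:P) al by rewrite /root !hornerE subrr.
move=> /factor_theorem[q /eqP]; rewrite subr_eq => /eqP e.
exists (polyV q); rewrite {1}e rmorphD rmorphM rmorphB /= polyVX !polyVC; ring.
Qed.

Lemma cofinite_s al : cofinite scalV ((sV : V) - scalV al).
Proof.
set b := _ - _; pose S : seq V := [:: 1; tV; tV ^+ 2].
have mem s : s \in S -> cofinite_mod scalV b S s by exact: cofinite_mod_mem.
have m1 : cofinite_mod scalV b S 1 by apply: mem; rewrite !inE eqxx.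
have mt : cofinite_mod scalV b S tV by apply: mem; rewrite !inE eqxx !orbT.
have mt2 : cofinite_mod scalV b S (tV ^+ 2) by apply: mem; rewrite !inE eqxx !orbT.
have mp p s : cofinite_mod scalV b S s -> cofinite_mod scalV b S (polyV p * s).
  move=> ms; have [a ->] := polyV_mod p al; rewrite -/b.
  have -> : (scalV p.[al] + b * a) * s = scalV p.[al] * s + b * (a * s) by ring.
  by apply: cofinite_modD; [exact: cofinite_modZ | exact: cofinite_mod_mul].
apply: (cofinite_gen (S := S) generatedV) => // s sS.
  by rewrite -polyVX; apply: mp; apply: mem.
move: sS; rewrite !inE => /or3P[] /eqP ->; rewrite ?mulr1 -?expr2 -?exprS //.
rewrite eqV -mulN1r -[-1](rmorphN1 scalV); apply: cofinite_modZ.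
by apply: cofinite_modD; [apply: cofinite_modD; apply: mp | rewrite -[polyV _]mulr1; apply: mp].
Qed.

(** * Gluing the two rings *)

(** [bridge b n a]: the functions [b] near infinity and [a] on the affine curve
    satisfy [y ^ n b = a] where both are defined. *)
Inductive bridge : V -> nat -> U -> Prop :=
| bridge_scal c : bridge (scalV c) 0 (scalU X c)
| bridge_s : bridge sV 1 1
| bridge_t : bridge tV 1 xU
| bridge_add b b' n a a' : bridge b n a -> bridge b' n a' -> bridge (b + b') n (a + a')
| bridge_mul b b' n n' a a' :
    bridge b n a -> bridge b' n' a' -> bridge (b * b') (n + n') (a * a')
| bridge_raise b n a : bridge b n a -> bridge b n.+1 (yU * a).

Lemma bridge_raise_n b n a m : bridge b n a -> bridge b (m + n) (yU ^+ m * a).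
Proof.
move=> h; elim: m => [|m IH]; first by rewrite mul1r.
by rewrite exprS -mulrA addSn; apply: bridge_raise.
Qed.

Lemma bridge_sn b n a m : bridge b n a -> bridge (sV ^+ m * b) (m + n) a.
Proof.
move=> h; elim: m => [|m IH]; first by rewrite mul1r.
by rewrite exprS -mulrA -[a]mul1r addSn -add1n; apply: bridge_mul => //; exact: bridge_s.
Qed.

Lemma bridge_onto b : exists n a, bridge b n a.
Proof.
elim/generatedV: b => [c|b b' [n [a ba]] [n' [a' ba']]|b [n [a ba]]|b [n [a ba]]].
- by exists 0%N, (scalU X c); exact: bridge_scal.
- exists (n' + n)%N, (yU ^+ n' * a + yU ^+ n * a'); apply: bridge_add.
    exact: bridge_raise_n.
  by rewrite addnC; exact: bridge_raise_n.
- by exists (1 + n)%N, (1 * a); apply: bridge_mul => //; exact: bridge_s.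
- by exists (1 + n)%N, (xU * a); apply: bridge_mul => //; exact: bridge_t.
Qed.

(** A function on the affine curve has a pole of finite order at infinity. *)
Lemma bridge_cover a : exists N, forall n, (N <= n)%N -> exists b, bridge b n a.
Proof.
suff [N [b h]] : exists N b, bridge b N a.
  exists N => n Nn; exists (sV ^+ (n - N) * b).
  by have := bridge_sn (n - N) h; rewrite subnK.
elim/generatedU: a => [c|a a' [n [b ba]] [n' [b' ba']]|a [n [b ba]]|a [n [b ba]]].
- by exists 0%N, (scalV c); exact: bridge_scal.
- exists (n' + n)%N, (sV ^+ n' * b + sV ^+ n * b'); apply: bridge_add.
    exact: bridge_sn.
  by rewrite addnC; exact: bridge_sn.
- by exists (1 + n)%N, (tV * b); apply: bridge_mul => //; exact: bridge_t.
- by exists n.+1, b; exact: bridge_raise.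
Qed.

Section Points.
Variables (ev : {rmorphism V -> k}) (evphi : forall c, ev (scalV c) = c).

(** At infinity the value of [b] is the leading coefficient of [y ^ n b]. *)
Lemma bridge_weight b n a : ev sV = 0 -> ev tV = 0 -> bridge b n a ->
  weight (a - scalU X (ev b) * yU ^+ n) (3 * n).
Proof.
move=> s0 t0.
have w0 (m : nat) : weight (0 : U) m.
  by rewrite /weight -[0](rmorph0 (polyU X)) normU_poly expr0n size_poly0.
have wy (m : nat) : weight (yU ^+ m : U) (3 * m).+1 by rewrite /weight normU_yn.
have wc c (u : U) m : weight u m -> weight (scalU X c * u) m.
  case: m => [|m] h; last by rewrite mulrC -[m.+1]addn0; apply: weightM h (weight_scal X c).
  have : normU u = 0 by apply/eqP; rewrite -size_poly_leq0.
  by move=> /normU_eq0 ->; rewrite mulr0.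
elim=> {b n a} [c|||b b' n a a' _ IH _ IH'|b b' n n' a a' _ IH _ IH'|b n a _ IH].
- by rewrite evphi expr0 mulr1 subrr.
- by rewrite s0 rmorph0 mul0r subr0 -(rmorph1 (scalU X)); apply: leq_trans (weight_scal X 1) _.
- by rewrite t0 rmorph0 mul0r subr0; exact: weight_x.
- have -> : a + a' - scalU X (ev (b + b')) * yU ^+ n
      = (a - scalU X (ev b) * yU ^+ n) + (a' - scalU X (ev b') * yU ^+ n).
    by rewrite !rmorphD; ring.
  exact: weightD.
- have -> : a * a' - scalU X (ev (b * b')) * yU ^+ (n + n')
      = (a - scalU X (ev b) * yU ^+ n) * a'
        + (a' - scalU X (ev b') * yU ^+ n') * (scalU X (ev b) * yU ^+ n).
    by rewrite !rmorphM exprD; ring.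
  apply: weightD.
    rewrite mulnDr; apply: weightM IH _.
    rewrite -[a'](subrK (scalU X (ev b') * yU ^+ n')); apply: weightD.
      exact: leq_trans IH' (leqnSn _).
    exact: wc.
  by rewrite mulnDr addnC; apply: weightM IH' _; apply: wc.
- have -> : yU * a - scalU X (ev b) * yU ^+ n.+1 = (a - scalU X (ev b) * yU ^+ n) * yU.
    by rewrite exprS; ring.
  by rewrite mulnS addnC; apply: weightM IH _; exact: (wy 1%N).
Qed.

Lemma bridge_ev_neq0 b n a : ev sV = 0 -> ev tV = 0 -> bridge b n a -> ev b != 0 -> a <> 0.
Proof.
move=> s0 t0 h b0 a0; have := bridge_weight s0 t0 h; rewrite a0 sub0r -mulNr -rmorphN.
rewrite /weight normUM -polyUC normU_poly size_mul ?normU_yn.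
- by rewrite -polyC_exp size_polyC expf_eq0 /= oppr_eq0 b0 ltnn.
- by rewrite -polyC_exp polyC_eq0 expf_eq0 /= oppr_eq0.
- by rewrite -size_poly_eq0 normU_yn.
Qed.

Lemma ev_t_of_s : ev sV = 0 -> ev tV = 0.
Proof.
move=> s0; have := congr1 ev unitV_s; rewrite rmorphM s0 mulr0 rmorphXn => /esym/eqP.
by rewrite expf_eq0 => /eqP.
Qed.

(** Away from infinity, points near infinity are points of the affine curve. *)
Lemma point_on_U : ev sV != 0 -> exists evU : {rmorphism U -> k},
  (forall c, evU (scalU X c) = c) /\
  forall b n a, bridge b n a -> evU a = (ev sV)^-1 ^+ n * ev b.
Proof.
move=> s0; pose be := (ev sV)^-1; pose al := be * ev tV.
have bes : be * ev sV = 1 by rewrite mulVf.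
have on_curve : be ^+ 2 = (cubic X).[al] - (slant X).[al] * be.
  have := congr1 ev unitV_s; rewrite rmorphM rmorphXn.
  have -> : ev unitV = 1 + a1 X * ev tV + a3 X * ev sV - a4 X * ev sV * ev tV
     - a2 X * ev tV ^+ 2 - a6 X * ev sV ^+ 2.
    have ev6 (R : comNzRingType) (f : {rmorphism R -> k}) (c1 c2 c3 c4 c6 s t : R) :
        f (1 + c1 * t + c3 * s - c4 * s * t - c2 * t ^+ 2 - c6 * s ^+ 2)
        = 1 + f c1 * f t + f c3 * f s - f c4 * f s * f t - f c2 * f t ^+ 2 - f c6 * f s ^+ 2.
      by rewrite !(rmorphB, rmorphD, rmorphXn, rmorphM) rmorph1.
    by rewrite /unitV ev6 (evphi (a1 X)) (evphi (a2 X)) (evphi (a3 X)) (evphi (a4 X)) (evphi (a6 X)).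
  move=> e.
  have -> : (cubic X).[al] = al ^+ 3 + a2 X * al ^+ 2 + a4 X * al + a6 X by rewrite /cubic !hornerE; ring.
  have -> : (slant X).[al] = a1 X * al + a3 X by rewrite /slant !hornerE; ring.
  rewrite /al exprMn -e.
  have : (be * ev sV - 1) = 0 by rewrite bes subrr.
  move: (be) (ev sV) (ev tV) bes => B S T BS _.
  have -> : B ^+ 3 * ((1 + a1 X * T + a3 X * S - a4 X * S * T - a2 X * T ^+ 2 - a6 X * S ^+ 2) * S)
    = (B * S) * B ^+ 2 + a1 X * (B * S) * B ^+ 2 * T + a3 X * (B * S) ^+ 2 * B
      - a4 X * (B * S) ^+ 2 * B * T - a2 X * (B * S) * B ^+ 2 * T ^+ 2 - a6 X * (B * S) ^+ 3 by ring.
  rewrite BS; ring.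
exists (eval_pt on_curve); split; first exact: eval_pt_scal.
move=> b n a; elim=> {b n a} [c|||b b' n a a' _ IH _ IH'|b b' n n' a a' _ IH _ IH'|b n a _ IH].
- by rewrite eval_pt_scal evphi mul1r.
- by rewrite rmorph1 expr1 mulVf.
- by rewrite eval_pt_x expr1.
- by rewrite rmorphD IH IH' rmorphD mulrDr.
- by rewrite rmorphM IH IH' rmorphM exprD; ring.
- by rewrite rmorphM IH eval_pt_y exprS mulrA.
Qed.

Section Infinity.
Hypothesis s0 : ev sV = 0.
Let t0 : ev tV = 0 := ev_t_of_s s0.

Definition order_at (e : nat) (b : V) := exists u h,
  [/\ ev u != 0, ev h != 0 & h * b = u * tV ^+ e].

Lemma order_atD e e' b b' : order_at e b -> order_at e' b' -> (e < e')%N -> order_at e (b + b').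
Proof.
move=> [u [h [u0 h0 hu]]] [u' [h' [u'0 h'0 hu']]] lt.
exists (h' * u + h * u' * tV ^+ (e' - e)), (h * h'); split.
- rewrite rmorphD !rmorphM rmorphXn t0 expr0n subn_eq0 leqNgt lt mulr0 addr0.
  by rewrite mulf_neq0.
- by rewrite rmorphM mulf_neq0.
- have -> : h * h' * (b + b') = h' * (h * b) + h * (h' * b') by ring.
  rewrite hu hu' -{1}(subnK (ltnW lt)) exprD; ring.
Qed.

Lemma ev_unitV : ev unitV = 1.
Proof.
rewrite /unitV !(rmorphB, rmorphD, rmorphXn, rmorphM) rmorph1 s0 t0 !expr0n /=.
by rewrite !mulr0 !subr0 !addr0.
Qed.

Lemma order_polyV p j : p != 0 -> exists m, order_at (3 * m + j) (polyV p * tV ^+ j).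
Proof.
move=> p0; have [m [q nq pE]] := multiplicity_XsubC p 0.
rewrite p0 /= in nq; exists m, (polyV q), (unitV ^+ m).
have evq : ev (polyV q) != 0.
  have [a ->] := polyV_mod q 0; rewrite rmorphD rmorphM rmorphB !evphi s0 subrr mul0r addr0.
  exact: nq.
split=> //; first by rewrite rmorphXn ev_unitV expr1n oner_neq0.
rewrite pE subr0 rmorphM rmorphXn /= polyVX.
rewrite exprD exprM -unitV_s exprMn; ring.
Qed.

Lemma order_atDor b b' (r r' : nat) : (r < 3)%N -> (r' < 3)%N ->
  (b = 0 \/ exists2 e, (e %% 3 <= r)%N & order_at e b) ->
  (b' = 0 \/ exists2 e, (r < e %% 3 <= r')%N & order_at e b') ->
  b + b' = 0 \/ exists2 e, (e %% 3 <= maxn r r')%N & order_at e (b + b').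
Proof.
move=> _ _ [->|[e er ob]] [->|[e' er' ob']].
- by left; rewrite addr0.
- by right; rewrite add0r; exists e' => //; case/andP: er' => _ h; rewrite leq_max h orbT.
- by right; rewrite addr0; exists e => //; rewrite leq_max er.
- right; have [lt|gt|ee] := ltngtP e e'.
  + by exists e; [rewrite leq_max er | exact: order_atD ob ob' lt].
  + exists e'; first by case/andP: er' => _ h; rewrite leq_max h orbT.
    by rewrite addrC; exact: order_atD ob' ob gt.
  + by move: er'; rewrite -ee ltnNge er.
Qed.

(** Write an element as [p0(s) + p1(s) t + p2(s) t ^ 2]. As [s] is [t ^ 3] up to a unit, the
    orders of the three terms differ modulo 3, so they do not cancel. *)
Theorem uniformizer_inf : uniformizer ev (tV : V).
Proof.
move=> b b0; have [p0 [p1 [p2 bE]]] := partsV b.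
have term p (j : nat) : (j < 3)%N ->
    polyV p * tV ^+ j = 0 \/ exists2 e, (e %% 3 = j)%N & order_at e (polyV p * tV ^+ j).
  move=> j3; have [->|np] := eqVneq p 0; first by left; rewrite rmorph0 mul0r.
  right; have [m om] := order_polyV j np; exists (3 * m + j)%N => //.
  by rewrite mulnC modnMDl modn_small.
have e0 : polyV p0 * tV ^+ 0 = 0 \/
    exists2 e, (e %% 3 <= 0)%N & order_at e (polyV p0 * tV ^+ 0).
  by case: (term p0 0%N isT) => [|[e em oe]]; [left | right; exists e; rewrite ?em].
have e1 : polyV p1 * tV ^+ 1 = 0 \/
    exists2 e, (0 < e %% 3 <= 1)%N & order_at e (polyV p1 * tV ^+ 1).
  by case: (term p1 1%N isT) => [|[e em oe]]; [left | right; exists e; rewrite ?em].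
have e2 : polyV p2 * tV ^+ 2 = 0 \/
    exists2 e, (1 < e %% 3 <= 2)%N & order_at e (polyV p2 * tV ^+ 2).
  by case: (term p2 2%N isT) => [|[e em oe]]; [left | right; exists e; rewrite ?em].
have := order_atDor (r := 1) (r' := 2) isT isT (order_atDor (r := 0) (r' := 1) isT isT e0 e1) e2.
rewrite expr0 mulr1 expr1 -bE => -[//|[e _ [u [h [u0 h0 hu]]]]].
by exists e, u, h.
Qed.

End Infinity.
End Points.
End RingV.

(** * Sections over the intersection of the charts *)

Definition pack_linear (A : pzRingType) (M N : lmodType A) (f : M -> N)
    (l : a_linear f) : {linear M -> N} :=
  let g : M -> N := f in
  HB.pack g (GRing.isLinear.Build A M N *:%R g l).

Section Sections.
Variables (k : closedFieldType) (X : elliptic_curve k).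
Implicit Types F G : coh X.
Local Notation U := (ringU X).
Local Notation V := (ringV X).

Lemma y_inj F (w w' : secUV F) : yU *: w = yU *: w' -> w = w'.
Proof. exact: (bij_inj (secUV_y F)). Qed.

Lemma yn_inj F n (w w' : secUV F) : yU ^+ n *: w = yU ^+ n *: w' -> w = w'.
Proof.
elim: n w w' => [|n IH] w w'; first by rewrite !scale1r.
by rewrite exprS -!scalerA => /y_inj/IH.
Qed.

Lemma yn_surj F n (w : secUV F) : exists w', yU ^+ n *: w' = w.
Proof.
elim: n w => [|n IH] w; first by exists w; rewrite scale1r.
have [g _ gK] := secUV_y F; have [w' <-] := IH w.
by exists (g w'); rewrite exprSr -scalerA gK.
Qed.

Lemma bridge_act b n a : bridge b n a -> forall F (v : secV F),
  yU ^+ n *: resV F (b *: v) = a *: resV F v.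
Proof.
elim=> {b n a} [c|||b b' n a a' _ IH _ IH'|b b' n n' a a' _ IH _ IH'|b n a _ IH] F v.
- by rewrite scale1r resV_const.
- by rewrite expr1 resV_s scale1r.
- by rewrite expr1 resV_t.
- by rewrite !scalerDl raddfD scalerDr IH IH'.
- by rewrite exprD mulrC -!scalerA [b *: _ in LHS]scalerA -scalerA IH scalerA mulrC -scalerA IH' scalerA mulrC.
- by rewrite exprS -scalerA IH scalerA.
Qed.

Lemma resV_scal F c (v : secV F) : resV F (scalV X c *: v) = scalU X c *: resV F v.
Proof. exact: resV_const. Qed.

Lemma resV_sn F n (v : secV F) : yU ^+ n *: resV F (sV ^+ n *: v) = resV F v.
Proof.
elim: n v => [|n IH] v; first by rewrite !scale1r.
by rewrite exprSr exprS -!scalerA resV_s IH.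
Qed.

(** [N] is the module over the intersection of the target; as [y] is invertible on it, maps into
    [N] extend along the localization at [y], and those from [V] along the one at [s]. *)
Section Extension.
Variables (F : coh X) (N : lmodType U) (ybij : bijective (fun w : N => yU *: w)).

Let yinj n (w w' : N) : yU ^+ n *: w = yU ^+ n *: w' -> w = w'.
Proof.
elim: n w w' => [|n IH] w w'; first by rewrite !scale1r.
by rewrite exprS -!scalerA => /(bij_inj ybij)/IH.
Qed.

Let ysurj n (w : N) : exists w', yU ^+ n *: w' = w.
Proof.
elim: n w => [|n IH] w; first by exists w; rewrite scale1r.
have [g _ gK] := ybij; have [w' <-] := IH w.
by exists (g w'); rewrite exprSr -scalerA gK.
Qed.

Lemma extend_resU (f : secU F -> N) : a_linear f ->
  exists2 g : secUV F -> N, a_linear g & forall m, g (resU F m) = f m.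
Proof.
move=> lf.
have ex w : exists u, forall n m, yU ^+ n *: w = resU F m -> yU ^+ n *: u = f m.
  have [n [m wE]] := resU_surj w; have [u uE] := ysurj n (f m); exists u => n' m' w'E.
  have : resU F (yU ^+ n *: m' - yU ^+ n' *: m) = 0.
    by rewrite linearB !linearZ /= -wE -w'E ?scalerN !scalerA mulrC subrr.
  move=> /resU_ker[e]; rewrite scalerBr => /eqP; rewrite subr_eq0 => /eqP /(congr1 f).
  rewrite !(a_linearZ _ _ lf) => /yinj; rewrite -uE !scalerA mulrC -scalerA.
  by move=> /yinj ->.
have [g gP] := choice ex.
have gU w u n m : yU ^+ n *: w = resU F m -> yU ^+ n *: u = f m -> g w = u.
  by move=> wE uE; apply: (@yinj n); rewrite uE; apply: gP.
exists g; last by move=> m; apply: (gU _ _ 0%N m); rewrite !scale1r.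
move=> a w w'; have [n [m wE]] := resU_surj w; have [n' [m' w'E]] := resU_surj w'.
apply: (gU _ _ (n + n')%N (yU ^+ n' *: (a *: m) + yU ^+ n *: m')).
  rewrite (linearD (resU F)) !(linearZ_LR (resU F)) /= -wE -w'E scalerDr !scalerA; congr (_ *: _ + _ *: _).
    by rewrite exprD; ring.
  by rewrite exprD mulrC.
rewrite (a_linearD _ _ lf) !(a_linearZ _ _ lf) -(gP _ _ _ wE) -(gP _ _ _ w'E) scalerDr !scalerA.
by congr (_ *: _ + _ *: _); rewrite exprD; ring.
Qed.

Lemma extend_resV (f : secV F -> N) :
  (forall v, resV F v = 0 -> v = 0) ->
  (forall u v, f (u + v) = f u + f v) ->
  (forall c v, f (scalV X c *: v) = scalU X c *: f v) ->
  (forall v, yU *: f (sV *: v) = f v) -> (forall v, yU *: f (tV *: v) = xU *: f v) ->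
  exists2 g : secUV F -> N, a_linear g & forall v, g (resV F v) = f v.
Proof.
move=> inj fD fc fs ft.
have fsn n v : yU ^+ n *: f (sV ^+ n *: v) = f v.
  elim: n v => [|n IH] v; first by rewrite !scale1r.
  by rewrite exprSr exprS -!scalerA fs IH.
have resV_inj u v : resV F u = resV F v -> u = v.
  move=> e; apply/eqP; rewrite -subr_eq0; apply/eqP; apply: inj.
  by rewrite raddfB e subrr.
have shiftV n m v : yU ^+ (n + m) *: resV F (sV ^+ m *: v) = yU ^+ n *: resV F v.
  by rewrite exprD -scalerA resV_sn.
have shiftf n m v : yU ^+ (n + m) *: f (sV ^+ m *: v) = yU ^+ n *: f v.
  by rewrite exprD -scalerA fsn.
have ex w : exists u, forall n v, w = yU ^+ n *: resV F v -> u = yU ^+ n *: f v.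
  have [n [v wE]] := resV_surj w; exists (yU ^+ n *: f v) => n' v' w'E.
  have e : sV ^+ n' *: v = sV ^+ n *: v'.
    apply: resV_inj; apply: (@yn_inj _ (n + n')).
    by rewrite (shiftV n n') -wE w'E -(shiftV n' n) addnC.
  by rewrite -(shiftf n n') e addnC (shiftf n' n).
have [g gP] := choice ex.
have gD w w' : g (w + w') = g w + g w'.
  have [n [v wE]] := resV_surj w; have [n' [v' w'E]] := resV_surj w'.
  rewrite (gP _ _ _ wE) (gP _ _ _ w'E) -(shiftf n n') -(shiftf n' n) (addnC n').
  rewrite -scalerDr -fD; apply: gP.
  by rewrite raddfD scalerDr (shiftV n n') addnC (shiftV n' n) wE w'E.
have gZ a w : g (a *: w) = a *: g w.
  elim/generatedU: a w => [c|a b IHa IHb|a IH|a IH] w.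
  - have [n [v wE]] := resV_surj w; rewrite (gP _ _ _ wE) scalerA mulrC -scalerA -fc.
    by apply: gP; rewrite resV_scal wE !scalerA [in LHS]mulrC.
  - by rewrite !scalerDl gD IHa IHb.
  - rewrite -!scalerA -IH; have [n [v wE]] := resV_surj (a *: w).
    rewrite (gP _ _ _ wE) [RHS]scalerA mulrC -scalerA -ft [RHS]scalerA -exprSr.
    by apply: gP; rewrite wE exprSr -[in RHS]scalerA resV_t !scalerA mulrC.
  - rewrite -!scalerA -IH; have [n [v wE]] := resV_surj (a *: w).
    by rewrite (gP _ _ _ wE) [RHS]scalerA -exprS; apply: gP; rewrite wE scalerA -exprS.
exists g; first by move=> a u v; rewrite gD gZ.
by move=> v; rewrite (gP _ 0%N v) ?scale1r.
Qed.

End Extension.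
End Sections.

(** * Torsion-free sheaves *)

Lemma eventually_all (I : finType) (P : I -> nat -> Prop) :
  (forall i, exists N, forall n, (N <= n)%N -> P i n) ->
  exists N, forall n, (N <= n)%N -> forall i, P i n.
Proof.
move=> /choice[N NP]; exists (\max_i N i) => n h i; apply: NP.
by apply: leq_trans h; exact: leq_bigmax.
Qed.

Section TorsionFree.
Variables (k : closedFieldType) (X : elliptic_curve k).
Implicit Types F G : coh X.
Local Notation U := (ringU X).
Local Notation V := (ringV X).

(** A section over [V] that dies on the intersection is supported at infinity; the two
    conditions rule out torsion on the affine curve and at infinity. *)
Definition torsion_free F :=
  (forall a (m : secU F), a <> 0 -> a *: m = 0 -> m = 0) /\
  (forall v, resV F v = 0 -> v = 0).

(** The point at infinity. *)
Definition ev_inf_fun (v : V) : k := (v : {poly %/ eqnV X}).[0].[0].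

Lemma eqnV_inf : (eqnV X).[0].[0] = 0.
Proof. by rewrite /eqnV !hornerE !expr0n /= !mulr0 !add0r; ring. Qed.

Lemma ev_inf_class p : ev_inf_fun (classV X p) = p.[0].[0].
Proof.
have mon : mk_monic (eqnV X) \is monic by exact: monic_mk_monic.
rewrite /ev_inf_fun /=.
rewrite [in RHS](Pdiv.RingMonic.rdivp_eq mon p) hornerD hornerM hornerD hornerM.
by rewrite mk_monic_eqnV eqnV_inf mulr0 add0r.
Qed.

Fact ev_inf_zmod : zmod_morphism ev_inf_fun.
Proof. by move=> u v; rewrite /ev_inf_fun /= !hornerE. Qed.
Fact ev_inf_monoid : monoid_morphism ev_inf_fun.
Proof.
split; first by rewrite -(rmorph1 (classV X)) ev_inf_class !hornerE.
move=> u v.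
have cK (w : V) : w = classV X (w : {poly %/ eqnV X}).
  by apply: val_inj; symmetry; apply: in_qpoly_small; exact: (size_mk_monic (w : {poly %/ eqnV X})).
by rewrite {1}(cK u) {1}(cK v) -rmorphM ev_inf_class !hornerE.
Qed.
HB.instance Definition _ := GRing.isZmodMorphism.Build V k ev_inf_fun ev_inf_zmod.
HB.instance Definition _ := GRing.isMonoidMorphism.Build V k ev_inf_fun ev_inf_monoid.
Definition ev_inf : {rmorphism V -> k} := ev_inf_fun.

Lemma ev_inf_scal c : ev_inf (scalV X c) = c.
Proof. by rewrite [LHS]ev_inf_class !hornerE. Qed.
Lemma ev_inf_s : ev_inf sV = 0.
Proof. by rewrite -polyVX [LHS]ev_inf_class !hornerE. Qed.

(** Over an algebraically closed field the equation has a solution with [x = 0]. *)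
Lemma exists_pointU : exists ev : {rmorphism U -> k}, forall c, ev (scalU X c) = c.
Proof.
pose p : {poly k} := 'X^2 + ((slant X).[0] *: 'X - ((cubic X).[0])%:P).
have sp : size p != 1.
  rewrite size_polyDl ?size_polyXn //.
  rewrite (leq_ltn_trans (size_polyD _ _)) // size_polyN gtn_max.
  rewrite (leq_ltn_trans (size_scale_leq _ _)) ?size_polyX //.
  by rewrite (leq_ltn_trans (size_polyC_leq1 _)).
have [be rt] := closed_rootP p sp.
have oc : be ^+ 2 = (cubic X).[0] - (slant X).[0] * be.
  move: rt; rewrite /root /p; move: (cubic X).[0] (slant X).[0] => c l.
  rewrite hornerD hornerXn hornerD hornerZ hornerX hornerN hornerC => /eqP h.
  by apply/eqP; rewrite -subr_eq0 -h; apply/eqP; ring.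
by exists (eval_pt oc) => c; exact: eval_pt_scal.
Qed.

Lemma xU_neq0 : (xU : U) <> 0.
Proof. by have := @xU_sub_neq0 _ X 0; rewrite rmorph0 subr0. Qed.

Lemma tf_y F (tf : torsion_free F) n (m : secU F) : yU ^+ n *: m = 0 -> m = 0.
Proof.
elim: n m => [|n IH] m; first by rewrite scale1r.
by rewrite exprS -scalerA => /(tf.1 _ _ (@yU_neq0 _ _))/IH.
Qed.

Lemma tf_resU F (tf : torsion_free F) (m : secU F) : resU F m = 0 -> m = 0.
Proof. by move=> /resU_ker[n]; exact: tf_y. Qed.

Lemma tf_resV_inj F (tf : torsion_free F) : injective (resV F).
Proof.
move=> m m' e; apply/eqP; rewrite -subr_eq0; apply/eqP; apply: tf.2.
by rewrite raddfB e subrr.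
Qed.

Lemma tf_UV F (tf : torsion_free F) a (w : secUV F) : a <> 0 -> a *: w = 0 -> w = 0.
Proof.
move=> a0 aw; have [n [m wE]] := resU_surj w; apply: (@yn_inj _ _ _ n).
rewrite scaler0 wE; suff -> : m = 0 by rewrite linear0.
apply: (tf.1 _ _ a0); apply: (tf_resU tf).
by rewrite linearZ /= -wE scalerA mulrC -scalerA aw scaler0.
Qed.

Lemma tf_near_basis F : torsion_free F -> exists r, near_basis (secU F) r.
Proof.
move=> tf; have [ev evphi] := exists_pointU.
have [pi [pi0 un]] := uniformizerU evphi.
have [r lb] := local_basis_exists (secU_fg F) un (fun x => tf.1 _ x pi0).
by exists r; exact: local_near_basis lb.
Qed.

Lemma tf_local_basisU F r : torsion_free F -> near_basis (secU F) r ->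
  forall ev : {rmorphism U -> k}, (forall c, ev (scalU X c) = c) -> local_basis (secU F) ev r.
Proof.
move=> tf nb ev evphi; have [pi [pi0 un]] := uniformizerU evphi.
have [r' lb] := local_basis_exists (secU_fg F) un (fun x => tf.1 _ x pi0).
by rewrite (near_basis_uniq (@domainU _ X) nb (local_near_basis lb)).
Qed.

Section Faithful.
Variables (F : coh X) (tf : torsion_free F) (nz : exists m : secU F, m <> 0).

Lemma kills_resV a : (forall v, a *: resV F v = 0) -> a = 0.
Proof.
move=> kill; apply: contrapT => a0; have [m []] := nz; apply: (tf_resU tf).
have [n [v ->]] := resV_surj (resU F m); have /(tf_UV tf a0) -> := kill v.
by rewrite scaler0.
Qed.

Lemma bridge_zero (b : V) n (a : U) : bridge b n a -> b = 0 <-> a = 0.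
Proof.
move=> br; split=> [b0|a0].
  apply: kills_resV => v; rewrite -(bridge_act br) b0 scale0r raddf0; exact: scaler0.
apply: contrapT => b0.
have [e [u [h [u0 _ hb]]]] := uniformizer_inf ev_inf_scal ev_inf_s b0.
have bv v : b *: v = 0 :> secV F.
  by apply: tf.2; apply: (@yn_inj _ _ _ n); rewrite (bridge_act br) a0 scale0r scaler0.
have [nu [au bu]] := bridge_onto u.
have bt : bridge (tV ^+ e : V) e (xU ^+ e : U).
  elim: e {hb} => [|e IH].
    by rewrite !expr0 -(rmorph1 (scalV X)) -(rmorph1 (scalU X)); exact: bridge_scal.
  by rewrite !exprS -add1n; apply: bridge_mul => //; exact: bridge_t.
have /domainU[|] : au * xU ^+ e = 0.
- apply: kills_resV => v; rewrite -(bridge_act (bridge_mul bu bt)) -hb -scalerA bv scaler0 raddf0.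
  exact: scaler0.
- exact: (bridge_ev_neq0 ev_inf_scal ev_inf_s (ev_t_of_s ev_inf_s) bu u0).
- elim: e {hb bt} => [|e IH]; first by apply/eqP; exact: oner_neq0.
  by rewrite exprS => /domainU[/xU_neq0|].
Qed.

Lemma domainV : is_domain V.
Proof.
move=> b b' bb'; have [n [a ba]] := bridge_onto b; have [n' [a' ba']] := bridge_onto b'.
have /bridge_zero/iffLR/(_ bb')/domainU := bridge_mul ba ba'.
by case=> [/(bridge_zero ba)|/(bridge_zero ba')]; auto.
Qed.

Lemma indep_UtoV r (m : 'I_r -> secU F) (v : 'I_r -> secV F) (c : 'I_r -> nat) :
  (forall i, resU F (m i) = yU ^+ c i *: resV F (v i)) ->
  indep_mod (@zero_pred _ _) m -> indep_mod (@zero_pred _ _) v.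
Proof.
move=> mv ind b b0.
have /choice[n /choice[a ba]] := fun i => bridge_onto (b i).
pose N := (\sum_i (n i + c i))%N.
have leN i : (n i + c i <= N)%N by rewrite /N (bigD1 i) //= leq_addr.
have a0 : \sum_i (yU ^+ (N - (n i + c i)) * a i) *: m i = 0.
  apply: (tf_resU tf); rewrite linear_sum /=.
  transitivity (yU ^+ N *: resV F (\sum_i b i *: v i)).
    rewrite raddf_sum scaler_sumr; apply: eq_bigr => i _.
    transitivity ((yU ^+ (N - (n i + c i)) * yU ^+ c i) *: (a i *: resV F (v i))).
      by rewrite linearZ /= mv !scalerA; congr (_ *: _); ring.
    rewrite -(bridge_act (ba i)) scalerA -!exprD; congr (_ ^+ _ *: _).
    by have := leN i; lia.
  by rewrite b0 raddf0; exact: scaler0.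
move=> i; apply/(bridge_zero (ba i)); have /domainU[|//] := ind _ a0 i.
move: (N - _)%N => e; elim: e => [|e IH].
  by move=> /eqP; rewrite oner_eq0.
by rewrite exprS => /domainU[/yU_neq0|].
Qed.

Lemma indep_VtoU r (m : 'I_r -> secU F) (v : 'I_r -> secV F) (c : 'I_r -> nat) :
  (forall i, resU F (m i) = yU ^+ c i *: resV F (v i)) ->
  indep_mod (@zero_pred _ _) v -> indep_mod (@zero_pred _ _) m.
Proof.
move=> mv ind a a0.
have [N NP] := eventually_all (fun i => bridge_cover (a i * yU ^+ c i)).
have /choice[b ba] := NP N (leqnn N).
have b0 : \sum_i b i *: v i = 0.
  apply: tf.2; apply: (@yn_inj _ _ _ N); rewrite raddf_sum scaler_sumr scaler0.
  under eq_bigr do rewrite (bridge_act (ba _)) -scalerA -mv -linearZ.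
  by rewrite -linear_sum a0 linear0.
move=> i; have /(bridge_zero (ba i))/domainU[//|] := ind _ b0 i.
move: (c i) => e; elim: e => [|e IH]; first by move=> /eqP; rewrite oner_eq0.
by rewrite exprS => /domainU[/yU_neq0|].
Qed.

(** Away from infinity a local basis is carried over from the affine chart; at
    infinity there is one, and its size is the rank because independence can be
    tested in either chart. *)
Lemma tf_local_basisV r : near_basis (secU F) r ->
  forall ev : {rmorphism V -> k}, (forall c, ev (scalV X c) = c) -> local_basis (secV F) ev r.
Proof.
move=> nb ev evphi; have [s0|s0] := eqVneq (ev sV) 0.
  have un := uniformizer_inf evphi s0.
  have tft (v : secV F) : tV *: v = 0 -> v = 0.
    move=> tv; apply: tf.2; apply: (tf_UV tf (a := xU)); last by rewrite -resV_t tv raddf0 scaler0.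
    exact: xU_neq0.
  have [r' lb] := local_basis_exists (secV_fg F) un tft.
  suff -> : r = r' by [].
  apply/eqP; rewrite eqn_leq; apply/andP; split.
    have [m [_ [_ ind _]]] := nb.
    have /choice[c /choice[v mv]] := fun i => resV_surj (resU F (m i)).
    exact: (near_basis_bound domainV (local_near_basis lb) (indep_UtoV mv ind)).
  have [v [_ [_ ind _]]] := lb.
  have /choice[c /choice[m mv]] := fun i => resU_surj (resV F (v i)).
  apply: (near_basis_bound (@domainU _ X) nb (v := m)).
  exact: (indep_VtoU (fun i => esym (mv i)) ind).
have [evU [evUphi evUP]] := point_on_U evphi s0.
have [m [h [h0 ind sp]]] := tf_local_basisU tf nb evUphi.
have /choice[c /choice[v mv]] := fun i => resV_surj (resU F (m i)).
have [q [e eP]] := secV_fg F.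
have /choice[d /choice[x xE]] := fun j => resU_surj (resV F (e j)).
have /choice[a aE] := fun j => sp (x j).
have [N NP] := eventually_all (fun p : 'I_q * 'I_r => bridge_cover (a p.1 p.2 * yU ^+ c p.2)).
have [N' N'P] := bridge_cover h.
have [hV bh] := N'P _ (leq_maxr N N').
exists v, hV; split.
- have := evUP _ _ _ bh => e1; apply/eqP => hV0.
  by move: h0; rewrite e1 hV0 mulr0 eqxx.
- exact: indep_UtoV mv ind.
- suff spe j : span_of v (hV *: e j).
    move=> w; have [f ->] := eP w; rewrite scaler_sumr.
    apply: (submod_sum _ (submod_span v)) => j _; rewrite scalerA mulrC -scalerA.
    by apply: submodZ => //; exact: submod_span.
  have /choice[b ba] : forall i, exists b, bridge b (maxn N N' + d j) (a j i * yU ^+ c i).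
    move=> i; apply: (NP _ _ (j, i)); apply: leq_trans (leq_maxl _ _) (leq_addr _ _).
  exists b; apply: (tf_resV_inj tf); apply: (@yn_inj _ _ _ (maxn N N' + d j)).
  transitivity (h *: (yU ^+ d j *: resV F (e j))).
    by rewrite addnC exprD -scalerA (bridge_act bh) !scalerA mulrC.
  rewrite xE -linearZ aE linear_sum raddf_sum scaler_sumr; apply: eq_bigr => i _.
  by rewrite (bridge_act (ba i)) /= (linearZ_LR (resU F)) /= mv scalerA.
Qed.

End Faithful.
End TorsionFree.

(** * Comparing indices *)

Section IndexComparison.
Variables (k : fieldType).

Lemma submod_image (V W : lmodType k) (f : {linear V -> W}) P :
  submodule P -> submodule (image_of f P).
Proof. exact: submod_im. Qed.

Lemma quo_iso_image (V W : lmodType k) (f : {linear V -> W}) P :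
  (forall v, P v -> f v = 0 -> v = 0) ->
  quo_iso f P (@zero_of _ V) (image_of f P) (@zero_of _ W).
Proof.
move=> inj; split=> [p Pp|p Pp|_ [p Pp ->]]; first by exists p.
- by split=> [/(inj _ Pp)|->]; rewrite /zero_of ?linear0.
- by exists p => //; rewrite /zero_of subrr.
Qed.

Section Maps.
Variables (V W V1 W1 : lmodType k) (f : {linear V -> W}) (f1 : {linear V1 -> W1}).
Variables (al : {linear V1 -> V}) (be : {linear W1 -> W}).
Variables (V2 W2 : lmodType k) (f2 : {linear V2 -> W2}).
Variables (al2 : {linear V -> V2}) (be2 : {linear W -> W2}).
Variables (P : V -> Prop) (Q : W -> Prop) (P1 : V1 -> Prop) (Q1 : W1 -> Prop).
Hypotheses (sP : submodule P) (sQ : submodule Q) (sP1 : submodule P1) (sQ1 : submodule Q1).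
Hypotheses (fP : forall v, P v -> Q (f v)) (f1P : forall v, P1 v -> Q1 (f1 v)).
Hypotheses (alP : forall v, P1 v -> P (al v)) (beQ : forall v, Q1 v -> Q (be v)).
Hypothesis com : forall v, P1 v -> be (f1 v) = f (al v).
Hypothesis al_inj : forall v, P1 v -> al v = 0 -> v = 0.
Hypothesis be_inj : forall v, Q1 v -> be v = 0 -> v = 0.

Let im_f v : image_of al P1 v -> image_of be Q1 (f v).
Proof. by move=> [p Pp ->]; exists (f1 p); [exact: f1P | rewrite com]. Qed.

Let sub_iso a b : ker_coker f1 P1 Q1 a b <-> ker_coker f (image_of al P1) (image_of be Q1) a b.
Proof.
apply: (ker_coker_quo_iso (al := al) (be := be)) => //.
- exact: submod_zero.
- exact: submod_zero.
- exact: submod_image.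
- exact: submod_zero.
- exact: submod_image.
- exact: submod_zero.
- by move=> w ->; exact: submod0.
- by move=> v ->; rewrite /zero_of linear0.
- exact: quo_iso_image.
- exact: quo_iso_image.
Qed.

Let im_P v : image_of al P1 v -> P v. Proof. by move=> [p Pp ->]; exact: alP. Qed.
Let im_Q w : image_of be Q1 w -> Q w. Proof. by move=> [p Pp ->]; exact: beQ. Qed.

(** [al] and [be] identify [f1] with the restriction of [f] to subspaces of finite codimension,
    along which the index is additive. *)
Lemma index_finite m n a1 b1 : dim_quo P (image_of al P1) m -> dim_quo Q (image_of be Q1) n ->
  ker_coker f1 P1 Q1 a1 b1 ->
  exists a b, ker_coker f P Q a b /\ (a + b1 + n = b + a1 + m)%N.
Proof.
move=> dm dn /sub_iso i1.
have sI := submod_image al sP1; have sJ := submod_image be sQ1.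
have [a2 [b2 [i2 e2]]] := ker_coker_quo_finite sP sI sQ sJ im_P im_Q fP im_f dm dn.
have [a [b [i e]]] := ker_coker_ext sP sI sQ sJ im_P im_Q fP im_f i1 i2.
exists a, b; split=> //; lia.
Qed.

Lemma index_finite_sub m n a b : dim_quo P (image_of al P1) m -> dim_quo Q (image_of be Q1) n ->
  ker_coker f P Q a b -> exists a1 b1, ker_coker f1 P1 Q1 a1 b1.
Proof.
move=> dm dn i; have sI := submod_image al sP1; have sJ := submod_image be sQ1.
have [a1 [b1 i1]] := ker_coker_sub sP sI sQ sJ im_P im_Q fP im_f dm dn i.
by exists a1, b1; apply/sub_iso.
Qed.

Lemma index_exact P2 Q2 a1 b1 a2 b2 :
  submodule P2 -> submodule Q2 ->
  (forall v, P v -> be2 (f v) = f2 (al2 v)) ->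
  quo_iso al2 P (image_of al P1) P2 (@zero_of _ V2) ->
  quo_iso be2 Q (image_of be Q1) Q2 (@zero_of _ W2) ->
  ker_coker f1 P1 Q1 a1 b1 -> ker_coker f2 P2 Q2 a2 b2 ->
  exists a b, ker_coker f P Q a b /\ (a + b1 + b2 = b + a1 + a2)%N.
Proof.
move=> sP2 sQ2 com2 q1 q2 /sub_iso i1 i2.
have sI := submod_image al sP1; have sJ := submod_image be sQ1.
apply: (ker_coker_ext sP sI sQ sJ im_P im_Q fP im_f i1).
apply/(ker_coker_quo_iso a2 b2 sP sI sQ sJ _ _ _ _ im_Q fP _ com2 q1 q2) => //.
- exact: submod_zero.
- exact: submod_zero.
- by move=> v ->; rewrite /zero_of linear0.
Qed.

End Maps.
End IndexComparison.

(** * Cohomology of sheaves and of sheaves of homomorphisms *)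

Lemma fct_linE (k : fieldType) (T : Type) (V : lmodType k) (c : k) (f g : T -> V) x :
  (c *: f + g) x = c *: f x + g x.
Proof. by []. Qed.

Lemma pair_lin1 (k : fieldType) (V W : lmodType k) (c : k) (p q : (V * W)%type) :
  (c *: p + q).1 = c *: p.1 + q.1.
Proof. by []. Qed.

Lemma pair_lin2 (k : fieldType) (V W : lmodType k) (c : k) (p q : (V * W)%type) :
  (c *: p + q).2 = c *: p.2 + q.2.
Proof. by []. Qed.

Lemma pair_01 (k : fieldType) (V W : lmodType k) : (0 : (V * W)%type).1 = 0.
Proof. by []. Qed.

Lemma pair_02 (k : fieldType) (V W : lmodType k) : (0 : (V * W)%type).2 = 0.
Proof. by []. Qed.

Section RestrictedMap.
Variables (k : fieldType) (A : pzRingType) (phi : {rmorphism k -> A}).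
Variables (M N : lmodType A) (f : {linear M -> N}).
Definition restr_map_fun (m : restr phi M) : restr phi N := f m.
Fact restr_map_linear : a_linear restr_map_fun.
Proof. by move=> c m m'; exact: (linearP f (phi c)). Qed.
Definition restr_map : {linear restr phi M -> restr phi N} := pack_linear restr_map_linear.
End RestrictedMap.

Section Postcomposition.
Variables (k : fieldType) (T1 T2 T3 : Type) (V1 V2 V3 W1 W2 W3 : lmodType k).
Variables (f1 : {linear V1 -> W1}) (f2 : {linear V2 -> W2}) (f3 : {linear V3 -> W3}).

Definition post1_fun (g : T1 -> V1) : T1 -> W1 := fun x => f1 (g x).
Fact post1_linear : a_linear post1_fun.
Proof. by move=> c g g'; apply/funext => x; exact: linearP. Qed.
Definition post1 : {linear (T1 -> V1) -> (T1 -> W1)} := pack_linear post1_linear.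

Definition post3_fun (t : ((T1 -> V1) * (T2 -> V2) * (T3 -> V3))%type) :
    ((T1 -> W1) * (T2 -> W2) * (T3 -> W3))%type :=
  (fun x => f1 (t.1.1 x), fun x => f2 (t.1.2 x), fun x => f3 (t.2 x)).
Fact post3_linear : a_linear post3_fun.
Proof. by move=> c t t'; congr (_, _, _); apply/funext => x; exact: linearP. Qed.
Definition post3 : {linear ((T1 -> V1) * (T2 -> V2) * (T3 -> V3))%type ->
    ((T1 -> W1) * (T2 -> W2) * (T3 -> W3))%type} := pack_linear post3_linear.
End Postcomposition.

Section Complexes.
Variables (k : closedFieldType) (X : elliptic_curve k).
Implicit Types E F G L : coh X.
Local Notation U := (ringU X).
Local Notation V := (ringV X).
Local Notation kU F := (restr (scalU X) (secU F)).
Local Notation kV F := (restr (scalV X) (secV F)).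
Local Notation kUV F := (restr (scalU X) (secUV F)).

Lemma resU_lin F : a_linear (resU F). Proof. exact: linearP. Qed.
Lemma homU_lin F G (i : hom F G) : a_linear (homU i). Proof. exact: linearP. Qed.
Lemma homV_lin F G (i : hom F G) : a_linear (homV i). Proof. exact: linearP. Qed.
Lemma homUV_lin F G (i : hom F G) : a_linear (homUV i). Proof. exact: linearP. Qed.

(* Comparing modules over the two rings must not unfold quotients of polynomial rings. *)
Opaque ringU ringV scalU scalV constU constV xU yU sV tV.

(** Its kernel is [H^0] and its cokernel is [H^1]. *)
Definition cech_fun F (p : kU F * kV F) : kUV F := resU F p.1 - resV F p.2.
Fact cech_linear F : a_linear (@cech_fun F).
Proof.
move=> c [m v] [m' v'].
change (resU F (scalU X c *: (m : secU F) + m') - resV F (scalV X c *: (v : secV F) + v')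
  = scalU X c *: (resU F m - resV F v) + (resU F m' - resV F v')).
by rewrite resU_lin raddfD resV_scal scalerBr opprD addrACA.
Qed.
Definition cech F : {linear (kU F * kV F)%type -> kUV F} := pack_linear (@cech_linear F).

Definition cech_index F a b := ker_coker (cech F) (fun _ => True) (fun _ => True) a b.

(** Homomorphisms over [U], over [V] and over the intersection; the last component is
    determined by the second one, but recording it avoids a choice. *)
Definition hom_space E F := ((secU E -> kU F) * (secV E -> kV F) * (secUV E -> kUV F))%type.

Lemma hom_space_eq E F (t t' : hom_space E F) :
  t.1.1 = t'.1.1 -> t.1.2 = t'.1.2 -> t.2 = t'.2 -> t = t'.
Proof. by case: t t' => [[? ?] ?] [[? ?] ?] /= -> -> ->. Qed.

Definition hom_delta_fun E F (t : hom_space E F) : secU E -> kUV F :=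
  fun m => resU F (t.1.1 m) - t.2 (resU E m).
Fact hom_delta_linear E F : a_linear (@hom_delta_fun E F).
Proof.
move=> c t t'; apply/funext => m; rewrite fct_linE /hom_delta_fun.
rewrite !pair_lin1 pair_lin2 !fct_linE !restrZ.
by rewrite resU_lin scalerBr opprD addrACA.
Qed.
Definition hom_delta E F : {linear hom_space E F -> (secU E -> kUV F)} :=
  pack_linear (@hom_delta_linear E F).

(** Pairs of homomorphisms over the two charts, with the restriction of the
    second one; [hom_delta] is their difference over the intersection. *)
Definition hom_pairs E F (PU : secU F -> Prop) (PV : secV F -> Prop) : hom_space E F -> Prop :=
  fun t => [/\ hom_to (scalU X) PU t.1.1, hom_to (scalV X) PV t.1.2,
    hom_to (scalU X) (fun _ => True) t.2 & forall v, t.2 (resV E v) = resV F (t.1.2 v)].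

Lemma submod_hom_pairs E F (PU : secU F -> Prop) (PV : secV F -> Prop) :
  submodule PU -> submodule PV -> submodule (@hom_pairs E F PU PV).
Proof.
move=> sPU sPV; have sU := @submod_hom_to _ _ (scalU X) (secU E) _ _ sPU.
have sV := @submod_hom_to _ _ (scalV X) (secV E) _ _ sPV.
have sUV := @submod_hom_to _ _ (scalU X) (secUV E) (secUV F) _ (@submod_top _ _).
split.
  split; rewrite ?pair_02 ?pair_01 ?pair_02; [exact: sU.1 | exact: sV.1 | exact: sUV.1 |].
  by move=> v; symmetry; exact: (raddf0 (resV F)).
move=> c t t' [h1 h2 h3 h4] [h1' h2' h3' h4']; split.
- by rewrite !pair_lin1; apply: sU.2.
- by rewrite pair_lin1 pair_lin2; apply: sV.2.
- by rewrite pair_lin2; apply: sUV.2.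
- by move=> v; rewrite pair_lin2 !pair_lin1 pair_lin2 !fct_linE !restrZ h4 h4' raddfD resV_scal.
Qed.

Definition top_pred T : T -> Prop := fun _ => True.

Definition hom_index E F a b :=
  ker_coker (hom_delta E F) (@hom_pairs E F (@top_pred _) (@top_pred _))
    (@hom_to _ _ (scalU X) (secU E) (secUV F) (@top_pred _)) a b.

Lemma hom_delta_to E F PU PV t : @hom_pairs E F PU PV t ->
  @hom_to _ _ (scalU X) (secU E) (secUV F) (@top_pred _) (hom_delta E F t).
Proof.
move=> [[l1 _] _ [l3 _] _]; split=> // a u v.
change (resU F (t.1.1 (a *: u + v)) - t.2 (resU E (a *: u + v)) =
  a *: (resU F (t.1.1 u) - t.2 (resU E u)) + (resU F (t.1.1 v) - t.2 (resU E v))).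
by rewrite l1 !resU_lin l3 scalerBr opprD addrACA.
Qed.

(** Exactness over the intersection follows from exactness over the charts. *)
Lemma homUV_inj L F (i : hom L F) : injective (homU i) -> injective (homUV i).
Proof.
move=> inj w w' e; apply/eqP; rewrite -subr_eq0; apply/eqP.
have : homUV i (w - w') = 0 by rewrite linearB e subrr.
move: (w - w') => {}w {e w'} iw; have [n [m wE]] := resU_surj w.
have : resU F (homU i m) = 0 by rewrite -hom_resU -wE linearZ /= iw scaler0.
move=> /resU_ker[e]; rewrite -linearZ /= -[0](linear0 (homU i)) => /inj ym.
apply: (@yn_inj _ _ _ (e + n)); rewrite scaler0 exprD -scalerA wE -linearZ /= ym.
exact: linear0.
Qed.

Lemma homUV_im F G (p : hom F G) w : (exists n m, yU ^+ n *: w = resU G (homU p m)) ->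
  exists u, homUV p u = w.
Proof.
move=> [n [m wE]]; have [u uE] := yn_surj n (resU F m); exists u.
by apply: (@yn_inj _ _ _ n); rewrite wE -hom_resU -uE linearZ.
Qed.

Lemma homUV_exact F G K (i : hom F G) (p : hom G K) : short_exact i p ->
  forall w, homUV p w = 0 <-> exists w', homUV i w' = w.
Proof.
move=> [_ _ exU _] w; split.
  move=> pw; have [n [m wE]] := resU_surj w.
  have : resU K (homU p m) = 0 by rewrite -hom_resU -wE linearZ /= pw scaler0.
  move=> /resU_ker[e]; rewrite -linearZ /= => /exU[m' m'E].
  apply: homUV_im; exists (e + n)%N, m'.
  by rewrite exprD -scalerA wE m'E linearZ.
move=> [w' <-]; have [n [m wE]] := resU_surj w'.
apply: (@yn_inj _ _ _ n); rewrite scaler0 -!linearZ /= wE !hom_resU.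
have -> : homU p (homU i m) = 0 by apply/exU; exists m.
exact: linear0.
Qed.

Lemma homUV_surj F G (p : hom F G) : epi p -> forall w, exists u, homUV p u = w.
Proof.
move=> [sU _] w; apply: homUV_im; have [n [m wE]] := resU_surj w.
by have [m' m'E] := sU m; exists n, m'; rewrite m'E.
Qed.

Section Functoriality.
Variables (F G : coh X) (i : hom F G).

Definition cech_map_fun (p : kU F * kV F) : (kU G * kV G)%type := (homU i p.1, homV i p.2).
Fact cech_map_linear : a_linear cech_map_fun.
Proof.
move=> c [m v] [m' v']; rewrite /cech_map_fun /=; congr (_, _).
  exact: (homU_lin i (scalU X c)).
exact: (homV_lin i (scalV X c)).
Qed.
Definition cech_map := pack_linear cech_map_linear.

Definition uv_map : {linear kUV F -> kUV G} := restr_map (scalU X) (homUV i).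

Lemma cech_com p : uv_map (cech F p) = cech G (cech_map p).
Proof.
change (homUV i (resU F p.1 - resV F p.2) = resU G (homU i p.1) - resV G (homV i p.2)).
by rewrite linearB hom_resU hom_resV.
Qed.

Variable E : coh X.
Definition hom_map : {linear hom_space E F -> hom_space E G} :=
  @post3 k (secU E) (secV E) (secUV E) _ _ _ _ _ _ (restr_map (scalU X) (homU i))
    (restr_map (scalV X) (homV i)) (restr_map (scalU X) (homUV i)).

Definition homuv_map : {linear (secU E -> kUV F) -> (secU E -> kUV G)} :=
  @post1 k (secU E) _ _ (restr_map (scalU X) (homUV i)).

Lemma hom_com t : homuv_map (hom_delta E F t) = hom_delta E G (hom_map t).
Proof.
apply/funext => m.
change (homUV i (resU F (t.1.1 m) - t.2 (resU E m)) = resU G (homU i (t.1.1 m)) - homUV i (t.2 (resU E m))).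
by rewrite linearB hom_resU.
Qed.

Lemma hom_map_to t : hom_pairs (@top_pred _) (@top_pred _) t ->
  hom_pairs (@top_pred _) (@top_pred _) (hom_map t).
Proof.
move=> [[l1 _] [l2 _] [l3 _] c]; split; try split=> //.
- by move=> a u v; rewrite /= /restr_map_fun l1 homU_lin.
- by move=> a u v; rewrite /= /restr_map_fun l2 homV_lin.
- by move=> a u v; rewrite /= /restr_map_fun l3 homUV_lin.
- by move=> v; rewrite /= /restr_map_fun c hom_resV.
Qed.

Lemma homuv_map_to f : hom_to (scalU X) (@top_pred _) f ->
  hom_to (scalU X) (@top_pred _) (homuv_map f).
Proof. by move=> [l _]; split=> // a u v; rewrite /= /post1_fun /= /restr_map_fun l homUV_lin. Qed.

End Functoriality.

(** * Injections with finite cokernel *)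

Section FiniteCokernel.
Variables (L F : coh X) (i : hom L F).
Hypotheses (injU : injective (homU i)) (injV : injective (homV i)).

Definition imU (m : secU F) := exists m', homU i m' = m.
Definition imV (v : secV F) := exists v', homV i v' = v.
Definition imUV (w : secUV F) := exists w', homUV i w' = w.

Lemma submod_imU : submodule imU.
Proof.
split; first by exists 0; rewrite linear0.
by move=> a _ _ [u <-] [v <-]; exists (a *: u + v); rewrite linearP.
Qed.
Lemma submod_imV : submodule imV.
Proof.
split; first by exists 0; rewrite linear0.
by move=> a _ _ [u <-] [v <-]; exists (a *: u + v); rewrite linearP.
Qed.
Lemma submod_imUV : submodule imUV.
Proof.
split; first by exists 0; rewrite linear0.
by move=> a _ _ [u <-] [v <-]; exists (a *: u + v); rewrite linearP.
Qed.

Variables (nU nV nUV : nat).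
Hypothesis dU : dim_quo (V := kU F) (@top_pred _) imU nU.
Hypothesis dV : dim_quo (V := kV F) (@top_pred _) imV nV.
Hypothesis dUV : dim_quo (V := kUV F) (@top_pred _) imUV nUV.

Let injUV := homUV_inj injU.

Lemma inj0 (A : comNzRingType) (M N : lmodType A) (f : {linear M -> N}) :
  injective f -> forall x, f x = 0 -> x = 0.
Proof. by move=> inj x; rewrite -[0 in X in X -> _](linear0 f) => /inj. Qed.

Let cech_quo : dim_quo (V := (kU F * kV F)%type) (@top_pred _)
  (image_of (cech_map i) (@top_pred _)) (nU + nV).
Proof.
pose P1 (p : (kU F * kV F)%type) := imU p.1.
have st := @submod_top k (kU F * kV F)%type.
have sU := restr_submod (scalU X) submod_imU; have sV := restr_submod (scalV X) submod_imV.
have s1 : submodule P1 by exact: (submod_preim (fst : {linear (kU F * kV F)%type -> kU F}) sU).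
have sI : submodule (image_of (cech_map i) (@top_pred _)) by apply: submod_image; exact: submod_top.
apply: (dim_trans s1 sI) => //.
- by move=> _ [p _ ->]; exists p.1.
- have qi : quo_iso (fst : {linear (kU F * kV F)%type -> kU F}) (@top_pred _) P1
      (@top_pred _) imU.
    by split=> // m _; exists (m, 0) => //=; rewrite subrr; exact: sU.1.
  exact: (dim_iso _ st sU qi).2 dU.
- have qi : quo_iso (snd : {linear (kU F * kV F)%type -> kV F}) P1
      (image_of (cech_map i) (@top_pred _)) (@top_pred _) imV.
    split=> //.
      move=> [m v] [m' /= mE]; split=> [[v' /= vE]|[[m1 v1] _ [_ ->]]]; last by exists v1.
      by exists (m', v') => //; rewrite -mE -vE.
    move=> v _; exists (0, v) => /=; first exact: sU.1.
    by rewrite subrr; exact: sV.1.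
  exact: (dim_iso _ s1 sV qi).2 dV.
Qed.

Let cech_uv_quo : dim_quo (V := kUV F) (@top_pred _) (image_of (uv_map i) (@top_pred _)) nUV.
Proof.
apply: (dim_ext _ _ dUV) => // w; split=> [[w' <-]|[w' _ ->]]; by exists w'.
Qed.

Lemma cech_index_finite a b : cech_index L a b ->
  exists a' b', cech_index F a' b' /\ (a' + b + nUV = b' + a + (nU + nV))%N.
Proof.
apply: (index_finite (al := cech_map i) (be := uv_map i)); try exact: submod_top; try by [].
- by move=> v _; exact: cech_com.
- by move=> [m v] _ [/(inj0 injU) -> /(inj0 injV) ->].
- by move=> w _ /(inj0 injUV).
Qed.

Lemma cech_index_finite_sub a b : cech_index F a b -> exists a' b', cech_index L a' b'.
Proof.
apply: (index_finite_sub (al := cech_map i) (be := uv_map i)); try exact: submod_top; try by [].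
- by move=> v _; exact: cech_com.
- by move=> [m v] _ [/(inj0 injU) -> /(inj0 injV) ->].
- by move=> w _ /(inj0 injUV).
- exact: cech_quo.
- exact: cech_uv_quo.
Qed.

Variables (E : coh X) (r : nat) (tfE : torsion_free E).
Hypothesis nzE : exists m : secU E, m <> 0.
Hypothesis nbE : near_basis (secU E) r.

Let homU_quo : dim_quo (V := secU E -> kU F) (hom_to (scalU X) (@top_pred _))
  (hom_to (scalU X) imU) (r * nU).
Proof.
apply: (dim_hom_to (@generatedU _ X) (tf_local_basisU tfE nbE)) => //; try exact: submod_imU.
Qed.

Let homV_quo : dim_quo (V := secV E -> kV F) (hom_to (scalV X) (@top_pred _))
  (hom_to (scalV X) imV) (r * nV).
Proof.
apply: (dim_hom_to (@generatedV _ X) (tf_local_basisV tfE nzE nbE)) => //; try exact: submod_imV.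
Qed.

Let homUV_quo : dim_quo (V := secU E -> kUV F) (hom_to (scalU X) (@top_pred _))
  (image_of (homuv_map i E) (hom_to (scalU X) (@top_pred _))) (r * nUV).
Proof.
have h : dim_quo (V := secU E -> kUV F) (hom_to (scalU X) (@top_pred _))
    (hom_to (scalU X) imUV) (r * nUV).
  apply: (dim_hom_to (@generatedU _ X) (tf_local_basisU tfE nbE)) => //; try exact: submod_imUV.
apply: (dim_ext _ _ h) => // f; split=> [[lf /choice[g gE]]|[g [lg _] ->]].
  exists g; last by apply/funext => m; rewrite -gE.
  by split=> // a u v; apply: injUV; rewrite linearP !gE lf.
by split=> [a u v|m]; [rewrite /= /post1_fun /= /restr_map_fun lg homUV_lin | exists (g m)].
Qed.

(** [resV] being injective, the values on [resV E v] determine the extension consistently. *)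
Lemma extend_homV (g : secV E -> secV F) : a_linear g ->
  exists2 h : secUV E -> secUV F, a_linear h & forall v, h (resV E v) = resV F (g v).
Proof.
move=> lg; apply: (extend_resV tfE.2 (f := fun v => resV F (g v))).
- by move=> u v; rewrite (a_linearD _ _ lg) raddfD.
- by move=> c v; rewrite (a_linearZ _ _ lg) -resV_const.
- by move=> v; rewrite (a_linearZ _ _ lg) resV_s.
- by move=> v; rewrite (a_linearZ _ _ lg) resV_t.
Qed.

Let hom_quo : dim_quo (V := hom_space E F) (hom_pairs (@top_pred _) (@top_pred _))
  (image_of (hom_map i E) (hom_pairs (@top_pred _) (@top_pred _))) (r * nU + r * nV).
Proof.
pose P1 := @hom_pairs E F imU (@top_pred _).
have st : submodule (@hom_pairs E F (@top_pred _) (@top_pred _)).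
  by apply: submod_hom_pairs; exact: submod_top.
have s1 : submodule P1.
  by apply: submod_hom_pairs; [exact: submod_imU | exact: submod_top].
have sI : submodule (image_of (hom_map i E) (hom_pairs (@top_pred _) (@top_pred _))).
  by apply: submod_image; apply: submod_hom_pairs; exact: submod_top.
have sh1 := @submod_hom_to _ _ (scalU X) (secU E) _ _ submod_imU.
have sh2 := @submod_hom_to _ _ (scalV X) (secV E) _ _ submod_imV.
have shV := @submod_hom_to _ _ (scalV X) (secV E) (secV F) _ (@submod_top _ _).
have shUV := @submod_hom_to _ _ (scalU X) (secUV E) (secUV F) _ (@submod_top _ _).
apply: (dim_trans s1 sI).
- by move=> t [[l1 _] h2 h3 h4].
- move=> _ [t /(hom_map_to i)[[l1 _] h2 h3 h4] ->]; split=> //; split=> // m.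
  by exists (t.1.1 m).
- pose pr : {linear hom_space E F -> (secU E -> kU F)} :=
    (fst : {linear ((secU E -> kU F) * (secV E -> kV F))%type -> _}) \o
    (fst : {linear hom_space E F -> ((secU E -> kU F) * (secV E -> kV F))%type}).
  have qi : quo_iso pr (hom_pairs (@top_pred _) (@top_pred _)) P1
      (hom_to (scalU X) (@top_pred _)) (hom_to (scalU X) imU).
    split=> [t []//|t [h1 h2 h3 h4]|f lf].
      by split=> [hi|[]].
    exists (f, 0, 0); last by rewrite /= subrr; exact: sh1.1.
    split=> //; [exact: shV.1 | exact: shUV.1 |].
    by move=> v; symmetry; exact: (raddf0 (resV F)).
  exact: (dim_iso _ st sh1 qi).2 homU_quo.
- pose pr : {linear hom_space E F -> (secV E -> kV F)} :=
    (snd : {linear ((secU E -> kU F) * (secV E -> kV F))%type -> _}) \o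
    (fst : {linear hom_space E F -> ((secU E -> kU F) * (secV E -> kV F))%type}).
  have qi : quo_iso pr P1 (image_of (hom_map i E) (hom_pairs (@top_pred _) (@top_pred _)))
      (hom_to (scalV X) (@top_pred _)) (hom_to (scalV X) imV).
    split=> [t []//|t [h1 h2 h3 h4]|g [lg gT]]; last first.
      have [h lh hE] := extend_homV lg; exists (0, g, h).
        by split=> //; exact: sh1.1.
      by rewrite /= subrr; exact: sh2.1.
    split=> [[lv /choice[g gE]]|[t' [_ [l2 _] _ _] ->]]; last first.
      by split=> [a u v|v]; [rewrite /= /restr_map_fun l2 homV_lin | exists (t'.1.2 v)].
    have [lu /choice[f fE]] := h1.
    have /choice[h hE] : forall w, exists w', homUV i w' = t.2 w.
      move=> w; have [n [v ->]] := resV_surj w.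
      exists (yU ^+ n *: resV L (g v)); rewrite linearZ /= hom_resV gE -h4.
      by case: h3 => l3 _; rewrite (a_linearZ _ _ l3).
    have lf : a_linear f by move=> a u v; apply: injU; rewrite linearP !fE lu.
    have lg : a_linear g by move=> a u v; apply: injV; rewrite linearP !gE lv.
    have lh : a_linear h.
      by move=> a u v; apply: injUV; rewrite linearP !hE; case: h3 => l3 _; exact: l3.
    exists (f, g, h).
      by split=> // v; apply: injUV; rewrite hE h4 hom_resV gE.
    by apply: hom_space_eq; apply/funext => x; symmetry; [exact: fE | exact: gE | exact: hE].
  exact: (dim_iso _ s1 sh2 qi).2 homV_quo.
Qed.

Let hom_inj t : hom_pairs (@top_pred _) (@top_pred _) t -> hom_map i E t = 0 -> t = 0.
Proof.
move=> _; case: t => [[f g] h] e.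
have e1 : (fun m => homU i (f m)) = 0 :> (secU E -> kU F) := congr1 (fun t => t.1.1) e.
have e2 : (fun m => homV i (g m)) = 0 :> (secV E -> kV F) := congr1 (fun t => t.1.2) e.
have e3 : (fun m => homUV i (h m)) = 0 :> (secUV E -> kUV F) := congr1 snd e.
congr (_, _, _); apply/funext => m.
- exact: (inj0 injU (congr1 (@^~ m) e1)).
- exact: (inj0 injV (congr1 (@^~ m) e2)).
- exact: (inj0 injUV (congr1 (@^~ m) e3)).
Qed.

(** [E] being locally free of rank [r] at every point, homomorphisms from [E] multiply the
    lengths of the three cokernels by [r]. *)
Lemma hom_index_finite a b : hom_index E L a b ->
  exists a' b', hom_index E F a' b' /\ (a' + b + r * nUV = b' + a + (r * nU + r * nV))%N.
Proof.
have st G : submodule (@hom_pairs E G (@top_pred _) (@top_pred _)).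
  by apply: submod_hom_pairs; exact: submod_top.
have su G := @submod_hom_to _ _ (scalU X) (secU E) (secUV G) _ (@submod_top _ _).
apply: (index_finite (al := hom_map i E) (be := homuv_map i E)) => //.
- by move=> t; exact: hom_delta_to.
- by move=> t; exact: hom_delta_to.
- exact: hom_map_to.
- exact: homuv_map_to.
- by move=> t _; exact: hom_com.
- move=> f _ e; apply/funext => m; exact: (inj0 injUV (congr1 (@^~ m) e)).
Qed.

Lemma hom_index_finite_sub a b : hom_index E F a b -> exists a' b', hom_index E L a' b'.
Proof.
have st G : submodule (@hom_pairs E G (@top_pred _) (@top_pred _)).
  by apply: submod_hom_pairs; exact: submod_top.
have su G := @submod_hom_to _ _ (scalU X) (secU E) (secUV G) _ (@submod_top _ _).
apply: (index_finite_sub (al := hom_map i E) (be := homuv_map i E)) => //.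
- by move=> t; exact: hom_delta_to.
- by move=> t; exact: hom_delta_to.
- exact: hom_map_to.
- exact: homuv_map_to.
- by move=> t _; exact: hom_com.
- move=> f _ e; apply/funext => m; exact: (inj0 injUV (congr1 (@^~ m) e)).
- exact: hom_quo.
- exact: homUV_quo.
Qed.

End FiniteCokernel.
End Complexes.

(** * Twisting and comparing sheaves of the same rank *)

Section Twist.
Variables (k : closedFieldType) (X : elliptic_curve k).
Implicit Types F G L : coh X.
Local Notation U := (ringU X).
Local Notation V := (ringV X).
Local Notation kU F := (restr (scalU X) (secU F)).
Local Notation kV F := (restr (scalV X) (secV F)).
Local Notation kUV F := (restr (scalU X) (secUV F)).

Section TwistDef.
Variables (F : coh X) (N : nat).

Definition twist_resV_fun (v : secV F) : secUV F := resV F (sV ^+ N *: v).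
Fact twist_resV_zmod : zmod_morphism twist_resV_fun.
Proof. by move=> u v; rewrite /twist_resV_fun scalerBr raddfB. Qed.
HB.instance Definition _ :=
  GRing.isZmodMorphism.Build (secV F) (secUV F) twist_resV_fun twist_resV_zmod.

Fact twist_const c v : twist_resV_fun (constV c *: v) = constU c *: twist_resV_fun v.
Proof. by rewrite /twist_resV_fun scalerA mulrC -scalerA resV_const. Qed.
Fact twist_s v : yU *: twist_resV_fun (sV *: v) = twist_resV_fun v.
Proof. by rewrite /twist_resV_fun scalerA mulrC -scalerA resV_s. Qed.
Fact twist_t v : yU *: twist_resV_fun (tV *: v) = xU *: twist_resV_fun v.
Proof. by rewrite /twist_resV_fun scalerA mulrC -scalerA resV_t. Qed.
Fact twist_surj w : exists n v, w = yU ^+ n *: twist_resV_fun v.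
Proof.
have [n [v ->]] := resV_surj w; exists (n + N)%N, v.
by rewrite exprD -scalerA resV_sn.
Qed.
Fact twist_ker v : twist_resV_fun v = 0 -> exists n, sV ^+ n *: v = 0.
Proof. by move=> /resV_ker[n e]; exists (n + N)%N; rewrite exprD -scalerA. Qed.

(** [F(- 3 N)] at the point at infinity, where [s] vanishes to order three: the same modules over
    both charts, glued after multiplication by [s ^ N]. *)
Definition twist : coh X :=
  @Coh k X (secU F) (secV F) (secUV F) (resU F) twist_resV_fun
    (@secU_fg _ _ F) (@secV_fg _ _ F) (secUV_y F)
    twist_const twist_s twist_t (@resU_surj _ _ F) (@resU_ker _ _ F) twist_surj twist_ker.

Definition sN_fun (v : secV F) : secV F := sV ^+ N *: v.
Fact sN_linear : a_linear sN_fun.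
Proof. by move=> a u v; rewrite /sN_fun scalerDr !scalerA mulrC. Qed.

Definition twist_incl : hom twist F :=
  @Hom k X twist F idfun (pack_linear sN_linear) idfun (fun=> erefl) (fun=> erefl).

Lemma twist_torsion_free : torsion_free F -> torsion_free twist.
Proof.
move=> tf; split; first exact: tf.1.
move=> v e; have /tf.2 h : resV F v = 0.
  by rewrite -(resV_sn N); change (yU ^+ N *: twist_resV_fun v = 0); rewrite [X in _ *: X]e scaler0.
exact: h.
Qed.

Lemma twist_incl_inj : torsion_free F -> injective (homV twist_incl).
Proof.
move=> tf u v e; apply: (tf_resV_inj (twist_torsion_free tf)).
exact: (congr1 (resV F) e).
Qed.

End TwistDef.

Lemma cofinite_sn N : cofinite (scalV X) ((sV : V) ^+ N).
Proof.
elim: N => [|N IH]; first by rewrite expr0; apply: (@cofinite_unit _ _ _ _ 1); rewrite mulr1.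
rewrite exprS; apply: cofinite_mul => //.
by have := cofinite_s X 0; rewrite rmorph0 subr0.
Qed.

Lemma twist_incl_dim F N : exists n,
  [/\ dim_quo (V := kU F) (@top_pred _) (imU (twist_incl F N)) 0,
      dim_quo (V := kV F) (@top_pred _) (imV (twist_incl F N)) n &
      dim_quo (V := kUV F) (@top_pred _) (imUV (twist_incl F N)) 0].
Proof.
have [n dn] := cofinite_dim (cofinite_sn N) (secV_fg F) (submod_imV (twist_incl F N))
  (fun v => ex_intro _ v erefl).
exists n; split=> //.
  apply: (dim_ext _ _ (dim_refl (@submod_top _ (kU F)))) => // m.
  by split=> // _; exists m.
apply: (dim_ext _ _ (dim_refl (@submod_top _ (kUV F)))) => // m.
by split=> // _; exists m.
Qed.

(** * Finite cokernels *)

(** [y - be] is [y] times [1 - be s], a function of [s] alone. *)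
Lemma bridge_poly (q : {poly k}) : q != 0 -> exists b n,
  bridge b n (peval (scalU X) q yU) /\ cofinite (scalV X) b.
Proof.
move=> q0; have [rs ->] := closed_field_poly_normal q.
rewrite -mul_polyC pevalM pevalC.
suff [b [n [br cb]]] : exists b n,
    bridge b n (peval (scalU X) (\prod_(z <- rs) ('X - z%:P)) yU) /\ cofinite (scalV X) b.
  exists (scalV X (lead_coef q) * b), (0 + n)%N; split.
    by apply: bridge_mul => //; exact: bridge_scal.
  apply: cofinite_mul => //; apply: (@cofinite_unit _ _ _ _ (scalV X (lead_coef q)^-1)).
  by rewrite -rmorphM mulfV ?rmorph1 // lead_coef_eq0.
elim: rs => [|be rs [b [n [br cb]]]].
  exists (scalV X 1), 0%N; rewrite big_nil -polyC1 pevalC; split; first exact: bridge_scal.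
  by apply: (@cofinite_unit _ _ _ _ 1); rewrite mulr1 rmorph1.
rewrite big_cons pevalM pevalXsubC.
exists ((scalV X 1 + scalV X (- be) * sV) * b), (1 + n)%N; split.
  apply: bridge_mul => //.
  have -> : yU - scalU X be = yU * scalU X 1 + scalU X (- be) * 1 by rewrite rmorph1 rmorphN; ring.
  apply: bridge_add; first by apply: bridge_raise; exact: bridge_scal.
  by apply: (@bridge_mul _ _ _ _ 0 1); [exact: bridge_scal | exact: bridge_s].
apply: cofinite_mul => //.
have [->|be0] := eqVneq be 0.
  by apply: (@cofinite_unit _ _ _ _ 1); rewrite oppr0 rmorph0 rmorph1; ring.
have -> : scalV X 1 + scalV X (- be) * sV = scalV X (- be) * (sV - scalV X be^-1).
  have e : scalV X be * scalV X be^-1 = 1 by rewrite -rmorphM mulfV // rmorph1.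
  by rewrite [scalV X 1]rmorph1 -e rmorphN; ring.
apply: cofinite_mul; last exact: cofinite_s.
apply: (@cofinite_unit _ _ _ _ (scalV X (- be)^-1)).
by rewrite -rmorphM mulfV ?rmorph1 // oppr_eq0.
Qed.

Section FiniteCokernel.
Variables (L G : coh X) (i : hom L G) (tfG : torsion_free G).

Lemma imUV_yinv n w : imUV i (yU ^+ n *: w) -> imUV i w.
Proof.
move=> [u uE]; have [u' u'E] := yn_surj n u; exists u'.
by apply: (@yn_inj _ _ _ n); rewrite -uE -u'E linearZ.
Qed.

Variables (h : U) (h0 : h <> 0) (hG : forall m, imU i (h *: m)).

Lemma imUV_h w : imUV i (h *: w).
Proof.
have [n [m wE]] := resU_surj w; apply: (@imUV_yinv n).
rewrite scalerA mulrC -scalerA wE -linearZ /=; have [m' <-] := hG m.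
by exists (resU L m'); rewrite hom_resU.
Qed.

(** If a nonzero [h] kills the cokernel over [U], then so does a nonzero polynomial in [y],
    which is a function near infinity after division by a power of [y]; multiplied by a further
    power of [s] it kills the cokernel over [V]. *)
Lemma finite_cokernel : exists nU nV nUV,
  [/\ dim_quo (V := kU G) (@top_pred _) (imU i) nU,
      dim_quo (V := kV G) (@top_pred _) (imV i) nV &
      dim_quo (V := kUV G) (@top_pred _) (imUV i) nUV].
Proof.
have [nU dU] := cofinite_dim (cofiniteU h0) (secU_fg G) (submod_imU i) hG.
have sUV := restr_submod (scalU X) (submod_imUV i).
have [nUV dUV _] : exists2 d, dim_quo (V := kUV G) (@top_pred _) (imUV i) d & (d <= nU)%N.
  apply: (dim_exists (@submod_top _ (kUV G)) sUV) => m w _ ind.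
  have [N NP] : exists N, forall n, (N <= n)%N -> forall j, exists x, yU ^+ n *: w j = resU G x.
    apply: eventually_all => j; have [n [x wE]] := resU_surj (w j : secUV G).
    exists n => n' nn'; exists (yU ^+ (n' - n) *: x).
    by rewrite linearZ /= -wE scalerA -exprD subnK.
  have /choice[x xE] := NP N (leqnn N).
  apply: (@dim_bound _ (kU G) _ _ _ _ x (restr_submod (scalU X) (submod_imU i)) dU) => // c [m' m'E].
  apply: ind; apply: (@imUV_yinv N).
  have -> : yU ^+ N *: ((\sum_j c j *: w j : kUV G) : secUV G) = resU G (\sum_j c j *: (x j : kU G) : kU G).
    rewrite scaler_sumr linear_sum; apply: eq_bigr => j _.
    change (yU ^+ N *: (scalU X (c j) *: (w j : secUV G)) = resU G (scalU X (c j) *: (x j : secU G))).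
    by rewrite (a_linearZ _ _ (@resU_lin _ _ G)) -xE !scalerA mulrC.
  by rewrite -m'E; exists (resU L m'); rewrite hom_resU.
have [q q0 [a qE]] := cofinite_poly yU (cofiniteU h0).
have [b [n [br cb]]] := bridge_poly q0.
have [d [g gP]] := secV_fg G.
have bg j : exists M, forall N, (M <= N)%N -> imV i (sV ^+ N *: (b *: g j)).
  have : imUV i (resV G (b *: g j)).
    apply: (@imUV_yinv n); rewrite (bridge_act br) qE -scalerA; exact: imUV_h.
  move=> [u uE]; have [c [v' u'E]] := resV_surj u; exists c => N cN.
  exists (sV ^+ (N - c) *: v'); rewrite linearZ /= -{2}(subnK cN) exprD -scalerA; congr (_ *: _).
  apply: (tf_resV_inj tfG); apply: (@yn_inj _ _ _ c).
  by rewrite resV_sn -uE u'E linearZ /= hom_resV.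
have [M MP] := eventually_all bg.
have bG v : imV i (sV ^+ M * b *: v).
  have [c ->] := gP v; rewrite scaler_sumr.
  apply: (submod_sum _ (submod_imV i)) => j _; rewrite scalerA mulrC -scalerA.
  by apply: (submodZ _ (submod_imV i)); rewrite -scalerA; apply: MP.
have [nV dV] := cofinite_dim (cofinite_mul (cofinite_sn M) cb) (secV_fg G) (submod_imV i) bG.
by exists nU, nV, nUV.
Qed.

End FiniteCokernel.

(** A homomorphism over the overlap extends over [V] when it does so on generators:
    the preimages are unique because the target has no section supported at infinity. *)
Lemma extend_to_V F G (g : secUV F -> secUV G) d (v : 'I_d -> secV F) :
  torsion_free G -> a_linear g -> (forall x, span_of v x) ->
  (forall j, exists u, g (resV F (v j)) = resV G u) ->
  exists2 fV : secV F -> secV G, a_linear fV & forall x, g (resV F x) = resV G (fV x).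
Proof.
move=> tfG lg vP vg.
have ex x : exists u, g (resV F x) = resV G u.
  have [a ->] := vP x; rewrite raddf_sum (a_linear_sum _ _ _ lg).
  elim/big_rec: _ => [|j y _ [u0 ->]]; first by exists 0; rewrite raddf0.
  suff [u' ->] : exists u', g (resV F (a j *: v j)) = resV G u'.
    by exists (u' + u0); rewrite raddfD.
  have [u1 u1E] := vg j.
  move: (v j) u1 u1E; elim/generatedV: (a j) => [c|b b' IH IH'|b IH|b IH] z u uE.
  - by exists (scalV X c *: u); rewrite (@resV_scal _ _ F) (@resV_scal _ _ G) (a_linearZ _ _ lg) uE.
  - have [u1 e1] := IH _ _ uE; have [u2 e2] := IH' _ _ uE.
    by exists (u1 + u2); rewrite scalerDl !raddfD (a_linearD _ _ lg) e1 e2.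
  - have [u1 e1] := IH _ _ uE; exists (sV *: u1); rewrite -scalerA.
    by apply: y_inj; rewrite -(a_linearZ _ _ lg) !resV_s e1.
  - have [u1 e1] := IH _ _ uE; exists (tV *: u1); rewrite -scalerA.
    by apply: y_inj; rewrite -(a_linearZ _ _ lg) !resV_t (a_linearZ _ _ lg) e1.
have [fV fVE] := choice ex.
have act b c a : bridge b c a -> forall x, fV (b *: x) = b *: fV x.
  move=> br x; apply: (tf_resV_inj tfG); apply: (@yn_inj _ _ _ c).
  by rewrite -fVE (bridge_act br) -fVE -(a_linearZ _ _ lg) (bridge_act br) (a_linearZ _ _ lg).
have fVD x z : fV (x + z) = fV x + fV z.
  by apply: (tf_resV_inj tfG); rewrite raddfD -!fVE raddfD (a_linearD _ _ lg).
exists fV => // b x z; have [c [a br]] := bridge_onto b; by rewrite fVD (act _ _ _ br).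
Qed.

(** Matching bases of the generic fibres gives a map with poles at infinity only, and the twist
    absorbs the poles. *)
Lemma generic_injection F G r : torsion_free F -> torsion_free G ->
  near_basis (secU F) r -> near_basis (secU G) r ->
  exists N (i : hom (twist F N) G) (h : U),
    [/\ injective (homU i), injective (homV i), h <> 0 & forall m, imU i (h *: m)].
Proof.
move=> tfF tfG [m [h [h0 ind sp]]] [n [h' [h'0 ind' sp']]].
have [co [coP co_lin co_m]] := coordinates ind sp.
pose f (x : secU F) : secU G := \sum_i co x i *: n i.
have lf : a_linear f.
  move=> a u v; rewrite /f scaler_sumr -big_split; apply: eq_bigr => i _ /=.
  by rewrite scalerA -scalerDl co_lin.
have injf : injective f.
  move=> u v e; apply/eqP; rewrite -subr_eq0; apply/eqP.
  have : f (u - v) = 0 by rewrite (a_linearB _ _ lf) e subrr.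
  move: (u - v) => {}u {e v} fu; apply: (tfF.1 _ _ h0); rewrite coP big1 // => i _.
  by rewrite (ind' _ fu) scale0r.
have fm i : f (m i) = h *: n i.
  rewrite /f (bigD1 i) //= co_m eqxx mulr1 big1 ?addr0 // => j ji.
  by rewrite co_m (negPf ji) mulr0 scale0r.
have [g lg gE] := extend_resU (secUV_y G) (f := fun x => resU G (f x))
  (fun a u v => etrans (congr1 (resU G) (lf a u v)) (resU_lin _ _ _)).
have injg w : g w = 0 -> w = 0.
  move=> gw; have [e [x wE]] := resU_surj w; apply: (@yn_inj _ _ _ e); rewrite scaler0 wE.
  have : resU G (f x) = 0 by rewrite -gE -wE (a_linearZ _ _ lg) gw scaler0.
  move=> /(tf_resU tfG) fx; suff -> : x = 0 by exact: linear0.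
  by apply: injf; rewrite fx (a_linear0 lf).
have [d [v vP]] := secV_fg F.
have [N NP] : exists N, forall n, (N <= n)%N -> forall j, exists u, g (resV F (sV ^+ n *: v j)) = resV G u.
  apply: eventually_all => j; have [c [u uE]] := resV_surj (g (resV F (v j))).
  exists c => e ce; exists (sV ^+ (e - c) *: u); apply: (@yn_inj _ _ _ e).
  transitivity (yU ^+ (c + (e - c)) *: resV G (sV ^+ (e - c) *: u)); last by rewrite subnKC.
  by rewrite -(a_linearZ _ _ lg) resV_sn uE exprD -scalerA resV_sn.
have [fV lfV fVE] := @extend_to_V (twist F N) G g d v tfG lg vP (NP N (leqnn N)).
pose i := @Hom k X (twist F N) G (pack_linear lf) (pack_linear lfV) (pack_linear lg)
  (fun x => gE x) (fun x => fVE x).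
exists N, i, (h' * h); split.
- exact: injf.
- move=> x z e; apply: (tf_resV_inj (twist_torsion_free N tfF)).
  apply/eqP; rewrite -subr_eq0; apply/eqP; apply: injg.
  rewrite (a_linearB _ _ lg); have := congr1 (resV G) e.
  by rewrite /= -!fVE => ->; rewrite subrr.
- by move=> /domainU[].
- move=> x; have [c cE] := sp' x; exists (\sum_j c j *: m j).
  rewrite /= (a_linear_lc _ _ lf) mulrC -scalerA cE scaler_sumr; apply: eq_bigr => j _.
  by rewrite fm !scalerA mulrC.
Qed.

(** Both [F] and [G] contain a twist of [F] with cokernels of finite length, and along such an
    inclusion the index of [Hom(E, -)] changes [r] times as much as the Euler
    characteristic. *)
Theorem index_same_rank (E F G : coh X) r R a b a' b' p q :
  torsion_free E -> (exists m : secU E, m <> 0) -> near_basis (secU E) r ->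
  torsion_free F -> torsion_free G -> near_basis (secU F) R -> near_basis (secU G) R ->
  cech_index F a b -> cech_index G a' b' -> hom_index E F p q ->
  exists p' q', hom_index E G p' q' /\
    ((p'%:Z - q'%:Z) - (p%:Z - q%:Z) = r%:Z * ((a'%:Z - b'%:Z) - (a%:Z - b%:Z)))%R.
Proof.
move=> tfE nzE nbE tfF tfG nbF nbG cF cG hF.
have [N [i [h [injU injV h0 hG]]]] := generic_injection tfF tfG nbF nbG.
have [n [d1 d2 d3]] := twist_incl_dim F N.
have [nU [nV [nUV [e1 e2 e3]]]] := finite_cokernel tfG h0 hG.
have idI : injective (homU (twist_incl F N)) by [].
have sI : injective (homV (twist_incl F N)) by exact: twist_incl_inj.
have [aL [bL cL]] := cech_index_finite_sub idI sI d1 d2 d3 cF.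
have [aF [bF [cF' eF]]] := cech_index_finite idI sI d1 d2 d3 cL.
have [aG [bG [cG' eG]]] := cech_index_finite injU injV e1 e2 e3 cL.
have [pL [qL hL]] := hom_index_finite_sub idI sI d1 d2 d3 tfE nzE nbE hF.
have [pF [qF [hF' fF]]] := hom_index_finite idI sI d1 d2 d3 tfE nzE nbE hL.
have [pG [qG [hG' fG]]] := hom_index_finite injU injV e1 e2 e3 tfE nzE nbE hL.
exists pG, qG; split=> //.
have tt : submodule (fun _ : (kU F * kV F)%type => True) by exact: submod_top.
have [eaF ebF] := ker_coker_uniq tt cF cF'.
have [eaG ebG] := ker_coker_uniq (@submod_top _ _) cG cG'.
have sp : submodule (@hom_pairs _ _ E F (@top_pred _) (@top_pred _)).
  by apply: submod_hom_pairs; exact: submod_top.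
have [epF eqF] := ker_coker_uniq sp hF hF'.
move: eF eG fF fG; rewrite -eaF -ebF -eaG -ebG -epF -eqF => *.
nia.
Qed.

End Twist.

(** * Exact sequences *)

Section Exact.
Variables (k : closedFieldType) (X : elliptic_curve k).
Implicit Types E F G K : coh X.
Local Notation U := (ringU X).
Local Notation V := (ringV X).
Local Notation kU F := (restr (scalU X) (secU F)).
Local Notation kV F := (restr (scalV X) (secV F)).
Local Notation kUV F := (restr (scalU X) (secUV F)).

Section ShortExact.
Variables (F G K : coh X) (i : hom F G) (p : hom G K) (ex : short_exact i p).

Let injU : injective (homU i). Proof. by case: ex => -[]. Qed.
Let injV : injective (homV i). Proof. by case: ex => -[]. Qed.
Let injUV := homUV_inj injU.
Let surjU m : exists m', homU p m' = m. Proof. by case: ex => _ []. Qed.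
Let surjV v : exists v', homV p v' = v. Proof. by case: ex => _ []. Qed.
Let exU m : homU p m = 0 <-> exists m', homU i m' = m. Proof. by case: ex. Qed.
Let exV v : homV p v = 0 <-> exists v', homV i v' = v. Proof. by case: ex. Qed.
Let exUV := homUV_exact ex.
Let surjUV : forall w, exists u, homUV p u = w.
Proof. by apply: homUV_surj; case: ex. Qed.

Lemma cech_index_exact a b a2 b2 : cech_index F a b -> cech_index K a2 b2 ->
  exists a' b', cech_index G a' b' /\ (a' + b + b2 = b' + a + a2)%N.
Proof.
apply: (index_exact (al := cech_map i) (be := uv_map i) (al2 := cech_map p) (be2 := uv_map p));
  try exact: submod_top; try by [].
- by move=> v _; exact: cech_com.
- by move=> [m v] _ [/(inj0 injU) -> /(inj0 injV) ->].
- by move=> w _ /(inj0 injUV).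
- by move=> v _; exact: cech_com.
- split=> // [[m v] _|[m v] _].
    split=> [[/exU[m' <-] /exV[v' <-]]|[[m' v'] _ [-> ->]]]; first by exists (m', v').
    by congr (_, _); [apply/exU; exists m' | apply/exV; exists v'].
  have [m' <-] := surjU m; have [v' <-] := surjV v.
  by exists (m', v') => //; rewrite /zero_of subrr.
- split=> // [w _|w _].
    split=> [/exUV[w' <-]|[w' _ ->]]; first by exists w'.
    by apply/exUV; exists w'.
  by have [w' <-] := surjUV w; exists w' => //; rewrite /zero_of subrr.
Qed.

Lemma hom_index_split E (s : hom K G) a b a2 b2 :
  (forall m, homU p (homU s m) = m) -> (forall v, homV p (homV s v) = v) ->
  hom_index E F a b -> hom_index E K a2 b2 ->
  exists a' b', hom_index E G a' b' /\ (a' + b + b2 = b' + a + a2)%N.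
Proof.
move=> sU sV.
have sUV w : homUV p (homUV s w) = w.
  have [n [m wE]] := resU_surj w; apply: (@yn_inj _ _ _ n).
  by rewrite -(a_linearZ _ _ (@homUV_lin _ _ _ _ p)) -(a_linearZ _ _ (@homUV_lin _ _ _ _ s)) wE !hom_resU sU.
have st G' : submodule (@hom_pairs _ _ E G' (@top_pred _) (@top_pred _)).
  by apply: submod_hom_pairs; exact: submod_top.
have su G' := @submod_hom_to _ _ (scalU X) (secU E) (secUV G') _ (@submod_top _ _).
apply: (index_exact (al := hom_map i E) (be := homuv_map i E)
  (al2 := hom_map p E) (be2 := homuv_map p E)) => //.
- by move=> t; exact: hom_delta_to.
- by move=> t; exact: hom_delta_to.
- exact: hom_map_to.
- exact: homuv_map_to.
- by move=> t _; exact: hom_com.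
- move=> [[f g] h] _ e.
  have e1 : (fun m => homU i (f m)) = 0 :> (secU E -> kU G) := congr1 (fun t => t.1.1) e.
  have e2 : (fun m => homV i (g m)) = 0 :> (secV E -> kV G) := congr1 (fun t => t.1.2) e.
  have e3 : (fun m => homUV i (h m)) = 0 :> (secUV E -> kUV G) := congr1 snd e.
  congr (_, _, _); apply/funext => m.
  + exact: (inj0 injU (congr1 (@^~ m) e1)).
  + exact: (inj0 injV (congr1 (@^~ m) e2)).
  + exact: (inj0 injUV (congr1 (@^~ m) e3)).
- move=> f _ e; apply/funext => m; exact: (inj0 injUV (congr1 (@^~ m) e)).
- by move=> t _; exact: hom_com.
- split=> [t|t [[l1 _] [l2 _] [l3 _] c]|t tP].
  + exact: hom_map_to.
  + split=> [e|[t' _ ->]]; last first.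
      apply: hom_space_eq; apply/funext => m.
      * by apply/exU; exists (t'.1.1 m).
      * by apply/exV; exists (t'.1.2 m).
      * by apply/exUV; exists (t'.2 m).
    have /choice[f fE] : forall m, exists m', homU i m' = t.1.1 m.
      by move=> m; apply/exU; exact: (congr1 (fun t => t.1.1 m) e).
    have /choice[g gE] : forall v, exists v', homV i v' = t.1.2 v.
      by move=> m; apply/exV; exact: (congr1 (fun t => t.1.2 m) e).
    have /choice[h hE] : forall w, exists w', homUV i w' = t.2 w.
      by move=> m; apply/exUV; exact: (congr1 (fun t => t.2 m) e).
    exists (f, g, h).
      split.
      * by split=> // c' u v; apply: injU; rewrite homU_lin !fE l1.
      * by split=> // c' u v; apply: injV; rewrite homV_lin !gE l2.
      * by split=> // c' u v; apply: injUV; rewrite homUV_lin !hE l3.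
      * by move=> v; apply: injUV; rewrite hE c hom_resV gE.
    by apply: hom_space_eq; apply/funext => x; symmetry; [exact: fE | exact: gE | exact: hE].
  + exists (hom_map s E t); first exact: hom_map_to.
    rewrite /zero_of; apply/eqP; rewrite subr_eq0; apply/eqP.
    apply: hom_space_eq; apply/funext => x; symmetry; [exact: sU | exact: sV | exact: sUV].
- split=> [f|f [l _]|f fP].
  + exact: homuv_map_to.
  + split=> [e|[f' _ ->]]; last first.
      by apply/funext => m; apply/exUV; exists (f' m).
    have /choice[g gE] : forall m, exists w', homUV i w' = f m.
      by move=> m; apply/exUV; exact: (congr1 (@^~ m) e).
    exists g; last by apply/funext => m; symmetry; exact: gE.
    by split=> // c' u v; apply: injUV; rewrite homUV_lin !gE l.
  + exists (homuv_map s E f); first exact: homuv_map_to.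
    rewrite /zero_of; apply/eqP; rewrite subr_eq0; apply/eqP.
    by apply/funext => x; symmetry; exact: sUV.
Qed.

Lemma near_basis_exact r r2 : near_basis (secU F) r -> near_basis (secU K) r2 ->
  near_basis (secU G) (r + r2).
Proof. exact: (near_basis_ext (@domainU _ X) injU surjU exU). Qed.

Lemma torsion_free_exact : torsion_free F -> torsion_free K -> torsion_free G.
Proof.
move=> [tU tV] [tU' tV']; split=> [a m a0 am|v v0].
  have /exU[m' mE] : homU p m = 0.
    by apply: (tU' _ _ a0); rewrite -(a_linearZ _ _ (@homU_lin _ _ _ _ p)) am linear0.
  rewrite -mE; suff -> : m' = 0 by rewrite linear0.
  apply: (tU _ _ a0); apply: (inj0 injU).
  by rewrite (a_linearZ _ _ (@homU_lin _ _ _ _ i)) mE.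
have /exV[v' vE] : homV p v = 0 by apply: tV'; rewrite -hom_resV v0 linear0.
rewrite -vE; suff -> : v' = 0 by rewrite linear0.
by apply: tV; apply: (inj0 injUV); rewrite hom_resV vE.
Qed.

End ShortExact.

(** * Powers of a sheaf *)

Section Powers.
Variables (F : coh X) (n : nat).

Section OneModule.
Variables (A : comNzRingType) (M : lmodType A).
Definition pincl_fun (m : M) : {ffun 'I_n.+1 -> M} := [ffun i => if i == ord0 then m else 0].
Definition pproj_fun (f : {ffun 'I_n.+1 -> M}) : {ffun 'I_n -> M} := [ffun i => f (lift ord0 i)].
Definition psec_fun (f : {ffun 'I_n -> M}) : {ffun 'I_n.+1 -> M} :=
  [ffun i => if unlift ord0 i is Some j then f j else 0].
Fact pincl_linear : a_linear pincl_fun.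
Proof.
move=> a u v; apply/ffunP => j; rewrite !ffunE.
by case: eqP => // _; rewrite scaler0 addr0.
Qed.
Fact pproj_linear : a_linear pproj_fun.
Proof. by move=> a u v; apply/ffunP => j; rewrite !ffunE. Qed.
Fact psec_linear : a_linear psec_fun.
Proof.
move=> a u v; apply/ffunP => j; rewrite !ffunE.
by case: unlift => [l|]; rewrite ?ffunE // scaler0 addr0.
Qed.
Lemma pincl_inj : injective pincl_fun.
Proof. by move=> u v /ffunP/(_ ord0); rewrite !ffunE eqxx. Qed.
Lemma pproj_sec f : pproj_fun (psec_fun f) = f.
Proof. by apply/ffunP => j; rewrite !ffunE liftK. Qed.
Lemma pproj_exact f : pproj_fun f = 0 <-> exists m, pincl_fun m = f.
Proof.
split=> [/ffunP f0|[m <-]]; last by apply/ffunP => j; rewrite !ffunE.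
exists (f ord0); apply/ffunP => j; rewrite ffunE.
have [l ->|->] := unliftP ord0 j; last by rewrite eqxx.
by have := f0 l; rewrite !ffunE => ->.
Qed.
End OneModule.

Definition pincl : hom F (power F n.+1).
Proof.
apply: (@Hom k X F (power F n.+1) (pack_linear (@pincl_linear _ (secU F)))
  (pack_linear (@pincl_linear _ (secV F))) (pack_linear (@pincl_linear _ (secUV F)))).
- move=> m; apply/ffunP => j; rewrite !ffunE; case: eqP => // _; by rewrite linear0.
- move=> m; apply/ffunP => j; rewrite !ffunE; case: eqP => // _; by rewrite raddf0.
Defined.

Definition pproj : hom (power F n.+1) (power F n).
Proof.
apply: (@Hom k X (power F n.+1) (power F n) (pack_linear (@pproj_linear _ (secU F)))
  (pack_linear (@pproj_linear _ (secV F))) (pack_linear (@pproj_linear _ (secUV F)))).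
- by move=> m; apply/ffunP => j; rewrite !ffunE.
- by move=> m; apply/ffunP => j; rewrite !ffunE.
Defined.

Definition psec : hom (power F n) (power F n.+1).
Proof.
apply: (@Hom k X (power F n) (power F n.+1) (pack_linear (@psec_linear _ (secU F)))
  (pack_linear (@psec_linear _ (secV F))) (pack_linear (@psec_linear _ (secUV F)))).
- by move=> m; apply/ffunP => j; rewrite !ffunE; case: unlift => [l|]; rewrite ?ffunE // linear0.
- by move=> m; apply/ffunP => j; rewrite !ffunE; case: unlift => [l|]; rewrite ?ffunE // raddf0.
Defined.

Lemma power_exact : short_exact pincl pproj.
Proof.
split.
- by split; exact: pincl_inj.
- by split=> f; exists (psec_fun f); exact: pproj_sec.
- exact: (@pproj_exact _ (secU F)).
- exact: (@pproj_exact _ (secV F)).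
Qed.

Lemma power_torsion_free : torsion_free F -> torsion_free (power F n).
Proof.
move=> [tU tV]; split=> [a m a0 /ffunP am|v /ffunP v0]; apply/ffunP => j.
  by rewrite ffunE; apply: (tU _ _ a0); have := am j; rewrite !ffunE.
by rewrite ffunE; apply: tV; have := v0 j; rewrite !ffunE.
Qed.

End Powers.

Lemma dim_trivial (Vk : lmodType k) (P Q : Vk -> Prop) : (forall v : Vk, v = 0) ->
  submodule P -> submodule Q -> dim_quo P Q 0.
Proof.
move=> z sP sQ; apply: (dim_ext _ _ (dim_refl sP)) => // v.
by rewrite (z v); split=> _; exact: submod0.
Qed.

Lemma power0_eq (T : zmodType) (f : {ffun 'I_0 -> T}) : f = 0.
Proof. by apply/ffunP; case. Qed.

Lemma power_near_basis F n r : near_basis (secU F) r -> near_basis (secU (power F n)) (n * r).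
Proof.
move=> nb; elim: n => [|n IH]; first by apply: near_basis_of_zero => x; exact: power0_eq.
by rewrite mulSn; exact: (near_basis_exact (power_exact F n) nb IH).
Qed.

Lemma power_cech_index F n a b : cech_index F a b -> exists a' b',
  cech_index (power F n) a' b' /\ (a'%:Z - b'%:Z = n%:Z * (a%:Z - b%:Z))%R.
Proof.
move=> iF; elim: n => [|n [a2 [b2 [i2 e2]]]].
  exists 0%N, 0%N; split; last by rewrite mul0r subrr.
  split; apply: dim_trivial.
  - by move=> [m v]; rewrite (power0_eq m) (power0_eq v).
  - apply: submodI; first exact: submod_top.
    by apply: submod_preim; exact: submod_zero.
  - exact: submod_zero.
  - by move=> w; exact: power0_eq.
  - exact: submod_top.
  - by apply: submod_add; [apply: submod_image; exact: submod_top | exact: submod_zero].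
have [a' [b' [i' e']]] := cech_index_exact (power_exact F n) iF i2.
by exists a', b'; split=> //; lia.
Qed.

Lemma power_hom_index E F n a b : hom_index E F a b -> exists a' b',
  hom_index E (power F n) a' b' /\ (a'%:Z - b'%:Z = n%:Z * (a%:Z - b%:Z))%R.
Proof.
move=> iF; elim: n => [|n [a2 [b2 [i2 e2]]]].
  have st : submodule (@hom_pairs _ _ E (power F 0) (@top_pred _) (@top_pred _)).
    by apply: submod_hom_pairs; exact: submod_top.
  exists 0%N, 0%N; split; last by rewrite mul0r subrr.
  split; apply: dim_trivial.
  - by move=> t; apply: hom_space_eq; apply/funext => m; exact: power0_eq.
  - by apply: submodI => //; apply: submod_preim; exact: submod_zero.
  - exact: submod_zero.
  - by move=> f; apply/funext => m; exact: power0_eq.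
  - by apply: submod_hom_to; exact: submod_top.
  - by apply: submod_add; [apply: submod_image | exact: submod_zero].
have [a' [b' [i' e']]] := hom_index_split (s := psec F n) (power_exact F n)
  (fun m => pproj_sec m) (fun m => pproj_sec m) iF i2.
by exists a', b'; split=> //; lia.
Qed.

End Exact.

(** * Finiteness of cohomology *)

Section Finiteness.
Variables (k : closedFieldType) (X : elliptic_curve k).
Implicit Types E F G : coh X.
Local Notation U := (ringU X).
Local Notation V := (ringV X).
Local Notation kU F := (restr (scalU X) (secU F)).
Local Notation kV F := (restr (scalV X) (secV F)).
Local Notation kUV F := (restr (scalU X) (secUV F)).

(** The equation expresses [x ^ 3], so the monomials [x ^ j y ^ l] with [j < 3] span. *)
Lemma monomialsU (S : U -> Prop) : (forall c a, S a -> S (scalU X c * a)) ->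
  (forall a b, S a -> S b -> S (a + b)) ->
  (forall j l, (j < 3)%N -> S (xU ^+ j * yU ^+ l)) -> forall a, S a.
Proof.
move=> Sc SD SM a; move: S Sc SD SM.
elim/generatedU: a => [c|a b IH IH'|a IH|a IH] S Sc SD SM.
- by rewrite -[scalU X c]mulr1; apply: (Sc); have := SM 0%N 0%N isT; rewrite !expr0 mulr1.
- by apply: (SD); [exact: IH | exact: IH'].
- apply: (IH (fun a => S (xU * a))) => [c b|b b'|j l].
  + by rewrite mulrCA; exact: Sc.
  + by rewrite mulrDr; exact: SD.
  rewrite mulrA -exprS ltnS leq_eqVlt => /orP[/eqP->|j2]; last by apply: SM; rewrite ltnS.
  have e3 : (xU : U) ^+ 3 * yU ^+ l = xU ^+ 0 * yU ^+ l.+2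
      + (scalU X (a1 X) * (xU ^+ 1 * yU ^+ l.+1) + (scalU X (a3 X) * (xU ^+ 0 * yU ^+ l.+1)
      + (scalU X (- a2 X) * (xU ^+ 2 * yU ^+ l) + (scalU X (- a4 X) * (xU ^+ 1 * yU ^+ l)
      + scalU X (- a6 X) * (xU ^+ 0 * yU ^+ l))))).
    have e2 : (yU : U) ^+ 2 = xU ^+ 3 + scalU X (a2 X) * xU ^+ 2 + scalU X (a4 X) * xU
        + scalU X (a6 X) - (scalU X (a1 X) * xU + scalU X (a3 X)) * yU.
      rewrite eqU /cubic /slant -!mul_polyC !(rmorphD, rmorphXn, rmorphM) /=.
      by rewrite polyUX.
    rewrite !rmorphN (exprD yU 2 l : yU ^+ l.+2 = _) (exprS yU l) e2; move: (yU ^+ l) => t; ring.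
  rewrite e3; apply: (SD); first exact: SM.
  by do 4 (apply: (SD); first by apply: (Sc); exact: SM); apply: (Sc); exact: SM.
- apply: (IH (fun a => S (yU * a))) => [c b|b b'|j l j3].
  + by rewrite mulrCA; exact: Sc.
  + by rewrite mulrDr; exact: SD.
  by rewrite mulrCA -exprS; exact: SM.
Qed.

Lemma bridge_pow n b m a i : @bridge _ X b m a -> n = (i * m)%N -> bridge (b ^+ i) n (a ^+ i).
Proof.
move=> br ->; elim: i => [|i IH].
  by rewrite !expr0 -(rmorph1 (scalV X)) -(rmorph1 (scalU X)); exact: bridge_scal.
by rewrite !exprS mulSn; exact: bridge_mul.
Qed.

(** The sections over the intersection are spanned by the [y ^ - n x ^ j resU (g i)] with [j < 3],
    the [g i] being generators over [U]. Those with [n <= 0] extend to [U]; those with [n] large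
    extend to [V], since [y ^ - n x ^ j] is [t ^ j s ^ (n - j)]. Finitely many remain. *)
Lemma cech_coker_finite F : exists n, dim_quo (V := kUV F) (fun _ => True)
  (sum_of (image_of (cech F) (fun _ => True)) (@zero_of _ _)) n.
Proof.
set I := sum_of _ _.
have sI : submodule I.
  by apply: submod_add; [apply: submod_image; exact: submod_top | exact: submod_zero].
have IU m : I (resU F m).
  exists (resU F m), 0; split=> //; last by rewrite addr0.
  by exists (m, 0) => //; change (resU F m = resU F m - resV F 0); rewrite raddf0 subr0.
have IV v : I (resV F v).
  exists (resV F v), 0; split=> //; last by rewrite addr0.
  exists (0, - v) => //; change (resV F v = resU F 0 - resV F (- v)).
  by rewrite linear0 raddfN opprK add0r.
have [d [g gP]] := secU_fg F.
have [c cP] : exists N, forall n, (N <= n)%N -> forall j, exists v, resU F (g j) = yU ^+ n *: resV F v.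
  apply: eventually_all => j; have [n [v wE]] := resV_surj (resU F (g j)).
  by exists n => e ne; exists (sV ^+ (e - n) *: v); rewrite wE -{1}(subnKC ne) exprD -scalerA resV_sn.
have [v vE] := choice (cP c (leqnn c)).
pose T : finType := ('I_(c + 2) * 'I_3 * 'I_d)%type.
have [W WE] := @choice T (secUV F) (fun t w => yU ^+ t.1.1 *: w = xU ^+ t.1.2 *: resU F (g t.2))
  (fun t => yn_surj _ _).
pose W' (i : 'I_#|T|) : kUV F := W (enum_val i).
pose S := sum_of I (span_of W').
have sS : submodule S by apply: submod_add => //; exact: submod_span.
have SI w : I w -> S w.
  by move=> Iw; exists w, 0; split=> //; [exact: (submod0 (submod_span W')) | rewrite addr0].
have SW t : S (W t).
  exists 0, (W t); split; [exact: submod0 | | by rewrite add0r].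
  by have := span_gen W' (enum_rank t); rewrite /W' enum_rankK.
have SZ : forall (z : k) (u : secUV F), S u -> S (scalU X z *: u).
  by move=> z u Su; exact: (@submodZ _ (kUV F) S z u sS Su).
have SD : forall (u w : secUV F), S u -> S w -> S (u + w).
  by move=> u w Su Sw; exact: (@submodD _ (kUV F) S u w sS Su Sw).
have Sm n i a : forall w, yU ^+ n *: w = a *: resU F (g i) -> S w.
  apply: (monomialsU (S := fun a => forall w, yU ^+ n *: w = a *: resU F (g i) -> S w))
    => [z b IH w wE|b b' IH IH' w wE|j l j3 w wE].
  - have [w' w'E] := yn_surj n (b *: resU F (g i)).
    have -> : w = scalU X z *: w'.
      by apply: (@yn_inj _ _ _ n); rewrite wE [in RHS]scalerA [in RHS]mulrC -!scalerA w'E.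
    by apply: (SZ); exact: IH.
  - have [w' w'E] := yn_surj n (b *: resU F (g i)).
    have [u uE] := yn_surj n (b' *: resU F (g i)).
    have -> : w = w' + u by apply: (@yn_inj _ _ _ n); rewrite wE scalerDr w'E uE scalerDl.
    by apply: (SD); [exact: IH | exact: IH'].
  have [nl|ln] := leqP n l.
    have -> : w = resU F (xU ^+ j * yU ^+ (l - n) *: g i).
      apply: (@yn_inj _ _ _ n).
      by rewrite wE (a_linearZ _ _ (@resU_lin _ _ F)) scalerA mulrCA -exprD subnKC.
    exact: SI.
  have wE' : yU ^+ (n - l) *: w = xU ^+ j *: resU F (g i).
    by apply: (@yn_inj _ _ _ l); rewrite !scalerA -exprD subnKC ?(ltnW ln) // wE mulrC.
  move: (n - l)%N wE' => {wE ln l}m wE; have [mc|mc] := ltnP m (c + 2).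
    have -> : w = W (Ordinal mc, Ordinal j3, i); last exact: SW.
    by apply: (@yn_inj _ _ _ m); rewrite (WE (Ordinal mc, Ordinal j3, i)).
  have -> : w = resV F (sV ^+ (m - c - j) * tV ^+ j *: v i); last exact: SI.
  apply: (@yn_inj _ _ _ m); rewrite wE vE.
  have -> : m = (c + (m - c))%N by lia.
  rewrite exprD -[in RHS]scalerA.
  have br : bridge (sV ^+ (m - c - j) * tV ^+ j : V) (m - c) (xU ^+ j).
    have -> : (m - c = (m - c - j) + j)%N by lia.
    by rewrite addnK; apply: bridge_sn; apply: (bridge_pow (bridge_t X)); rewrite muln1.
  by rewrite addnC addnK (bridge_act br) !scalerA mulrC.
have [n dn _] : exists2 n, dim_quo (V := kUV F) (fun _ => True) I n & (n <= #|T|)%N.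
  apply: (@dim_of_span _ (kUV F) (fun _ => True) I _ W' (@submod_top _ (kUV F)) sI).
  move=> w _; suff [p [q [Ip [a ->] ->]]] : S w by exists a; rewrite addrK.
  have [n [m wE]] := resU_surj (w : secUV F); have [a mE] := gP m.
  have [u uE] := @choice 'I_d (secUV F) (fun i u => yU ^+ n *: u = a i *: resU F (g i))
    (fun i => yn_surj _ _).
  have -> : w = \sum_i u i.
    apply: (@yn_inj _ _ F n); rewrite wE mE (a_linear_lc _ _ (@resU_lin _ _ F)) scaler_sumr.
    by apply: eq_bigr => i _; rewrite uE.
  by apply: (submod_sum _ sS) => i _; exact: (Sm n i (a i)).
by exists n.
Qed.

Definition simple E := forall f : hom E E, exists c : k,
  (forall m, homU f m = scalU X c *: m) /\ (forall v, homV f v = scalV X c *: v).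

(** A section of a sufficiently negative twist of [E], multiplied by a linear form
    on [E] which has poles at infinity, is an endomorphism; so there is at most one
    such section, up to scalars. *)
Lemma negative_twist E : torsion_free E -> (exists m : secU E, m <> 0) -> simple E ->
  exists N a b, cech_index (twist E N) a b.
Proof.
move=> tf [m0 m0nz] sE; have [r [m [h [h0 ind sp]]]] := tf_near_basis tf.
have [co [coP co_lin co_m]] := coordinates ind sp.
have r0 : (0 < r)%N.
  case: r m ind sp co coP co_lin co_m => // m ind sp *; case: m0nz; apply: (tf.1 _ _ h0).
  by have [a ->] := sp m0; rewrite big_ord0.
pose i0 := Ordinal r0; pose psi x := co x i0.
have psi_lin a u v : psi (a *: u + v) = a * psi u + psi v by exact: co_lin.
have psi_m : psi (m i0) = h by rewrite /psi co_m eqxx mulr1.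
have [d [v vP]] := secV_fg E.
have [n nP] : exists N, forall n, (N <= n)%N -> forall j, exists x, yU ^+ n *: resV E (v j) = resU E x.
  apply: eventually_all => j; have [n [x wE]] := resU_surj (resV E (v j)).
  exists n => n' nn'; exists (yU ^+ (n' - n) *: x).
  by rewrite (a_linearZ _ _ (@resU_lin _ _ E)) -wE scalerA -exprD subnK.
have [x xE] := choice (nP n (leqnn n)).
have [N NP] : exists N, forall n, (N <= n)%N -> forall j, exists b, bridge b n (psi (x j)).
  by apply: eventually_all => j; exact: bridge_cover.
have endo su sv : resU E su = resV E (sV ^+ N *: sv) ->
    exists c : k, forall m, psi m *: su = scalU X c *: m.
  move=> suv.
  have lf : a_linear (fun m => psi m *: su) by move=> a u w; rewrite psi_lin scalerDl scalerA.
  have [g lg gE] := extend_resU (secUV_y E) (f := fun x => resU E (psi x *: su))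
    (fun a u v => etrans (congr1 (resU E) (lf a u v)) (resU_lin _ _ _)).
  have gv j : exists u, g (resV E (v j)) = resV E u.
    have [b br] := NP (N + n)%N (leq_addr _ _) j; exists (b *: sv).
    apply: (@yn_inj _ _ _ (N + n)).
    rewrite (bridge_act br) exprD -scalerA -(a_linearZ _ _ lg) xE gE.
    by rewrite (a_linearZ _ _ (@resU_lin _ _ E)) suv scalerA mulrC -scalerA resV_sn.
  have [fV lfV fVE] := extend_to_V tf lg vP gv.
  have [c [cU _]] := sE (@Hom k X E E (pack_linear lf) (pack_linear lfV) (pack_linear lg) gE fVE).
  by exists c.
have [b db] := cech_coker_finite (twist E N).
have sK : submodule (fun p : (kU (twist E N) * kV (twist E N))%type =>
    True /\ zero_of (cech (twist E N) p)).
  by apply: submodI; [exact: submod_top | apply: submod_preim; exact: submod_zero].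
have [a da _] : exists2 a, dim_quo (fun p : (kU (twist E N) * kV (twist E N))%type =>
    True /\ zero_of (cech (twist E N) p)) (@zero_of _ _) a & (a <= 1)%N.
  apply: dim_exists => // [|q w wK indw]; first exact: submod_zero.
  case: q w wK indw => [|[|q]] // w wK indw; exfalso.
  have sec i : resU E (w i).1 = resV E (sV ^+ N *: (w i).2).
    apply/eqP; rewrite -subr_eq0; apply/eqP; exact: (proj2 (wK i)).
  have [c c_E] := choice (fun i => endo _ _ (sec i)).
  have zU su sv : resU E su = resV E (sV ^+ N *: sv) -> (forall m, psi m *: su = 0) ->
      su = 0 /\ sv = 0.
    move=> e s0; have su0 : su = 0 by apply: (tf.1 _ _ h0); rewrite -psi_m.
    split=> //; apply: (tf_resV_inj (twist_torsion_free N tf)); rewrite raddf0.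
    by change (resV E (sV ^+ N *: sv) = 0); rewrite -e su0 linear0.
  pose j1 : 'I_q.+2 := lift ord0 ord0.
  have c0 i : c i = 0 -> False.
    move=> ci; have [z1 z2] : (w i).1 = 0 /\ (w i).2 = 0.
      by apply: zU (sec i) _ => x'; rewrite c_E ci rmorph0 scale0r.
    have := indw (fun j => (j == i)%:R); rewrite (bigD1 i) //= big1 ?addr0; last first.
      by move=> j /negPf ->; rewrite scale0r.
    rewrite eqxx scale1r => /(_ _ i); rewrite eqxx => h1.
    suff : (1 : k) = 0 by move/eqP; rewrite oner_eq0.
    by apply: h1; rewrite /zero_of (surjective_pairing (w i)) z1 z2.
  pose su : secU E := scalU X (c j1) *: ((w ord0).1 : secU E) - scalU X (c ord0) *: ((w j1).1 : secU E).
  pose sv : secV E := scalV X (c j1) *: ((w ord0).2 : secV E) - scalV X (c ord0) *: ((w j1).2 : secV E).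
  apply: (c0 j1).
  apply: (proj1 (indep_pair (i := ord0) (j := j1) (a := c j1) (b := - c ord0) indw isT _)).
  rewrite scaleNr; change ((su, sv) = (0, 0) :> (kU E * kV E)%type).
  have [-> ->] // : su = 0 /\ sv = 0.
  apply: zU => [|x'].
    rewrite (a_linearB _ _ (@resU_lin _ _ E)) !(a_linearZ _ _ (@resU_lin _ _ E)) !sec.
    have cm z (v' : secV E) : sV ^+ N *: (scalV X z *: v') = scalV X z *: (sV ^+ N *: v').
      by rewrite !scalerA mulrC.
    by rewrite /sv scalerBr !cm (raddfB (resV E)) !(@resV_scal _ _ E).
  by rewrite scalerBr !scalerA ![psi _ * _]mulrC -!scalerA !c_E !scalerA mulrC subrr.
by exists N, a, b.
Qed.

Lemma cech_index_exists E : torsion_free E -> (exists m : secU E, m <> 0) -> simple E ->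
  exists a b, cech_index E a b.
Proof.
move=> tf nz sE; have [N [a [b iN]]] := negative_twist tf nz sE.
have [n [d1 d2 d3]] := twist_incl_dim E N.
have idI : injective (homU (twist_incl E N)) by [].
have [a' [b' [iE _]]] := cech_index_finite idI (twist_incl_inj tf) d1 d2 d3 iN.
by exists a', b'.
Qed.

End Finiteness.

(** * Numerical invariants *)

Section Invariants.
Variables (k : closedFieldType) (X : elliptic_curve k).
Implicit Types E F G : coh X.
Local Notation U := (ringU X).
Local Notation V := (ringV X).
Local Notation kU F := (restr (scalU X) (secU F)).
Local Notation kV F := (restr (scalV X) (secV F)).
Local Notation kUV F := (restr (scalU X) (secUV F)).

Lemma unique_coordinates (W : lmodType k) (P Q : W -> Prop) n (w : 'I_n -> W) :
  submodule P -> submodule Q ->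
  (indep_mod Q w /\ forall p, P p -> exists a : 'I_n -> k, Q (p - \sum_i a i *: w i)) <->
  (forall p, P p -> exists! c : 'rV[k]_n, Q (p - \sum_i c 0 i *: w i)).
Proof.
move=> sP sQ; split=> [[ind sp] p /sp[a aP]|u].
  exists (\row_i a i); split.
    by rewrite (eq_bigr (fun i => a i *: w i)) // => i _; rewrite mxE.
  move=> c cP; apply/rowP => i; rewrite mxE; apply/eqP; rewrite -subr_eq0; apply/eqP.
  apply: (ind (fun i => a i - c 0 i)).
  have -> : \sum_i (a i - c 0 i) *: w i = (p - \sum_i c 0 i *: w i) - (p - \sum_i a i *: w i).
    rewrite (eq_bigr (fun i => a i *: w i - c 0 i *: w i)) => [|j _]; last by rewrite scalerBl.
    by rewrite sumrB; zmod.
  exact: submodB.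
split=> [a aQ i|p /u[c [cP _]]]; last by exists (c 0).
have [c [_ cu]] := u 0 (submod0 sP).
have : \row_i a i = 0 :> 'rV[k]_n.
  transitivity c; [symmetry|]; apply: cu.
    rewrite sub0r; apply: (submodN sQ).
    by rewrite (eq_bigr (fun i => a i *: w i)) // => j _; rewrite mxE.
  rewrite big1 ?subr0; first exact: submod0.
  by move=> j _; rewrite mxE scale0r.
by move/rowP/(_ i); rewrite !mxE.
Qed.

Lemma sum_pair1 (M N : zmodType) I (r : seq I) (f : I -> (M * N)%type) :
  (\sum_(i <- r) f i).1 = \sum_(i <- r) (f i).1.
Proof. by elim/big_rec2: _ => // i y1 y2 _ <-. Qed.

Lemma sum_pair2 (M N : zmodType) I (r : seq I) (f : I -> (M * N)%type) :
  (\sum_(i <- r) f i).2 = \sum_(i <- r) (f i).2.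
Proof. by elim/big_rec2: _ => // i y1 y2 _ <-. Qed.

Lemma h0_eq F a b : cech_index F a b -> h0 F = a.
Proof.
move=> [da _].
have sK : submodule (fun p : (kU F * kV F)%type => True /\ zero_of (cech F p)).
  by apply: submodI; [exact: submod_top | apply: submod_preim; exact: submod_zero].
have sZ : submodule (@zero_of _ (kU F * kV F)%type) by exact: submod_zero.
have eqv n : (exists (m : 'I_n -> secU F) (v : 'I_n -> secV F),
    (forall i, resU F (m i) = resV F (v i)) /\
    forall m' v', resU F m' = resV F v' -> exists! c : 'rV[k]_n,
      m' = \sum_i constU (c 0 i) *: m i /\ v' = \sum_i constV (c 0 i) *: v i) <->
    dim_quo (fun p : (kU F * kV F)%type => True /\ zero_of (cech F p)) (@zero_of _ _) n.
  have split2 (w : 'I_n -> (kU F * kV F)%type) (p : (kU F * kV F)%type) (c : 'rV[k]_n) :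
      zero_of (p - \sum_i c 0 i *: w i) <->
      (p.1 : secU F) = \sum_i constU (c 0 i) *: ((w i).1 : secU F) /\
      (p.2 : secV F) = \sum_i constV (c 0 i) *: ((w i).2 : secV F).
    have e1 : (\sum_i c 0 i *: w i).1 = \sum_i constU (c 0 i) *: ((w i).1 : secU F).
      by rewrite sum_pair1.
    have e2 : (\sum_i c 0 i *: w i).2 = \sum_i constV (c 0 i) *: ((w i).2 : secV F).
      by rewrite sum_pair2; apply: eq_bigr => i _; exact: erefl.
    rewrite -e1 -e2; split=> [/eqP|[p1 p2]]; first by rewrite subr_eq0 => /eqP ->.
    apply/eqP; rewrite subr_eq0; apply/eqP; case: p p1 p2 => p1 p2 /= -> ->.
    by rewrite -surjective_pairing.
  split=> [[m [v [mv u]]]|[w [wP ind sp]]].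
    pose w i : (kU F * kV F)%type := (m i, v i); exists w.
    have wP i : True /\ zero_of (cech F (w i)).
      by split=> //; apply/eqP; rewrite subr_eq0; apply/eqP; exact: mv.
    have [|ind sp] := (unique_coordinates w sK sZ).2; last by split.
    move=> [m' v'] [_ /eqP]; rewrite subr_eq0 => /eqP /u[c [cP cu]].
    exists c; split; first by apply/split2.
    by move=> c' /split2 /cu.
  exists (fun i => (w i).1), (fun i => (w i).2); split.
    by move=> i; have [_ /eqP] := wP i; rewrite subr_eq0 => /eqP.
  move=> m' v' e; have [] := (unique_coordinates w sK sZ).1 (conj ind sp) (m', v').
    by split=> //; apply/eqP; rewrite subr_eq0; apply/eqP.
  move=> c [cP cu]; exists c; split; first by have /split2 := cP.
  by move=> c' c'P; apply: cu; apply/split2.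
rewrite /h0; apply: xget_unique; first by apply/eqv.
by move=> n /= /eqv dn; exact: (dim_uniq sZ dn da).
Qed.

Lemma h1_eq F a b : cech_index F a b -> h1 F = b.
Proof.
move=> [_ db].
set I := sum_of _ _ in db.
have sI : submodule I.
  by apply: submod_add; [apply: submod_image; exact: submod_top | exact: submod_zero].
have IE (w : kUV F) : I w <-> exists m v, w = resU F m - resV F v.
  split=> [[p [q [[[m v] _ ->] -> ->]]]|[m [v ->]]].
    by exists m, v; rewrite addr0.
  by exists (cech F (m, v)), 0; split=> //; [exists (m, v) | rewrite addr0].
have eqv n : (exists w : 'I_n -> secUV F,
    forall w', exists! c : 'rV[k]_n, exists m v,
      w' = \sum_i constU (c 0 i) *: w i + (resU F m - resV F v)) <->
    dim_quo (V := kUV F) (fun _ => True) I n.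
  have iff (w : 'I_n -> kUV F) (w' : kUV F) (c : 'rV[k]_n) : I (w' - \sum_i c 0 i *: w i) <->
      exists m v, (w' : secUV F) = \sum_i constU (c 0 i) *: (w i : secUV F) + (resU F m - resV F v).
    rewrite IE; split=> -[m [v e]]; exists m, v.
      by apply/eqP; rewrite addrC -subr_eq; apply/eqP; exact: e.
    by apply/eqP; rewrite subr_eq addrC; apply/eqP; exact: e.
  split=> [[w u]|[w [_ ind sp]]].
    exists w; have [|ind sp] := (unique_coordinates (w : _ -> kUV F) (@submod_top _ (kUV F)) sI).2; last by split.
    move=> w' _; have [c [cP cu]] := u w'; exists c; split; first by apply/iff.
    by move=> c' /iff /cu.
  exists w => w'; have [//|c [cP cu]] :=
    (unique_coordinates (w : _ -> kUV F) (@submod_top _ (kUV F)) sI).1 (conj ind sp) w'.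
  exists c; split; first exact: (iff w w' c).1.
  by move=> c' /(iff w w') /cu.
rewrite /h1; apply: xget_unique; first by apply/eqv.
by move=> n /= /eqv dn; exact: (dim_uniq sI dn db).
Qed.

Lemma near_basis_rank F r : near_basis (secU F) r -> rank F = r.
Proof.
move=> nb; have [m [h [h0 ind sp]]] := nb; rewrite /rank.
apply: xget_unique.
  by split; [exists m | move=> v /(near_basis_bound (@domainU _ X) nb); rewrite ltnn].
move=> r' [[v vind] max]; apply/eqP; rewrite eqn_leq.
rewrite (near_basis_bound (@domainU _ X) nb vind) leqNgt.
apply/negP => lt; apply: (max (fun i => m (widen_ord lt i))) => a a0 i.
pose a' (i : 'I_r) : U := if insub (i : nat) is Some j then a j else 0.
have aw j : a' (widen_ord lt j) = a j by rewrite /a' /= valK.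
rewrite -aw; apply: ind; rewrite (bigID (fun j : 'I_r => (j < r'.+1)%N)) /=.
rewrite [X in _ + X]big1 ?addr0 => [|j jr]; last by rewrite /a' insubF ?scale0r //; exact: negbTE.
rewrite (big_ord_narrow lt) /zero_pred -[RHS]a0; apply: eq_bigr => j _; by rewrite aw.
Qed.

Lemma slope_eq F r a b : near_basis (secU F) r -> (0 < r)%N -> cech_index F a b ->
  slope F = (a%:Z - b%:Z)%:~R / r%:R - (euler_char_structure_sheaf X)%:~R.
Proof.
move=> nb r0 c; rewrite /slope /degree /euler_char (near_basis_rank nb) (h0_eq c) (h1_eq c).
by rewrite intrB intrM mulrBl mulrAC mulfV ?mul1r // pnatr_eq0 -lt0n.
Qed.

(** The kernel of the complex that computes [Hom] and [Ext^1] is the space of morphisms. *)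
Definition hom_ker E F (t : hom_space E F) :=
  hom_pairs (@top_pred _) (@top_pred _) t /\ zero_of (hom_delta E F t).

Lemma submod_hom_ker E F : submodule (@hom_ker E F).
Proof.
apply: submodI; first by apply: submod_hom_pairs; exact: submod_top.
by apply: submod_preim; exact: submod_zero.
Qed.

Definition hom_triple E F (f : hom E F) : hom_space E F := (homU f : _ -> _, homV f : _ -> _, homUV f : _ -> _).

Lemma hom_triple_ker E F (f : hom E F) : hom_ker (hom_triple f).
Proof.
split; last by apply/funext => m; apply/eqP; rewrite subr_eq0; apply/eqP; rewrite /= hom_resU.
split; [split=> //; exact: homU_lin|split=> //; exact: homV_lin|split=> //; exact: homUV_lin|].
by move=> v; rewrite /= hom_resV.
Qed.

Lemma hom_of_ker E F (t : hom_space E F) : hom_ker t -> exists f : hom E F, hom_triple f = t.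
Proof.
case: t => -[f g] h [[[lf _] [lg _] [lh _] c] z].
have zU m : h (resU E m) = resU F (f m).
  by symmetry; apply/eqP; rewrite -subr_eq0; apply/eqP; exact: (congr1 (@^~ m) z).
by exists (@Hom k X E F (pack_linear lf) (pack_linear lg) (pack_linear lh) zU c).
Qed.

Lemma hom_sum E F n (f : hom E F) (b : 'I_n -> hom E F) (c : 'I_n -> k) :
  hom_triple f = \sum_i c i *: hom_triple (b i) <->
  (forall m, homU f m = \sum_i constU (c i) *: homU (b i) m) /\
  (forall v, homV f v = \sum_i constV (c i) *: homV (b i) v).
Proof.
have e1 m : (\sum_i c i *: hom_triple (b i)).1.1 m = \sum_i constU (c i) *: homU (b i) m.
  rewrite (big_morph (fun t : hom_space E F => t.1.1) (id1 := 0) (op1 := +%R)) //.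
  by rewrite fct_sumE.
have e2 m : (\sum_i c i *: hom_triple (b i)).1.2 m = \sum_i constV (c i) *: homV (b i) m.
  rewrite (big_morph (fun t : hom_space E F => t.1.2) (id1 := 0) (op1 := +%R)) //.
  by rewrite fct_sumE.
have e3 m : (\sum_i c i *: hom_triple (b i)).2 m = \sum_i constU (c i) *: homUV (b i) m.
  rewrite (big_morph (fun t : hom_space E F => t.2) (id1 := 0) (op1 := +%R)) //.
  by rewrite fct_sumE.
split=> [e|[eU eV]].
  split=> m; first by rewrite -e1 -e.
  by rewrite -e2 -e.
apply: hom_space_eq; apply/funext => m; rewrite ?e1 ?e2 ?e3 //=.
have [n' [m' mE]] := resU_surj m; apply: (@yn_inj _ _ _ n').
rewrite -(a_linearZ _ _ (@homUV_lin _ _ _ _ f)) mE hom_resU eU (a_linear_sum _ _ _ (@resU_lin _ _ F)).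
rewrite scaler_sumr; apply: eq_bigr => i _.
rewrite (a_linearZ _ _ (@resU_lin _ _ F)) -hom_resU -mE (a_linearZ _ _ (@homUV_lin _ _ _ _ (b i))).
by rewrite !scalerA mulrC.
Qed.

Lemma hom_dim_ker E F n : hom_dim E F n -> dim_quo (@hom_ker E F) (@zero_of _ _) n.
Proof.
move=> [b bP]; pose w i := hom_triple (b i).
have sZ : submodule (@zero_of _ (hom_space E F)) by exact: submod_zero.
exists w; have [|ind sp] := (unique_coordinates w (submod_hom_ker E F) sZ).2.
  move=> t /hom_of_ker[f <-]; have [c [cP cu]] := bP f; exists c.
  split; first by apply/eqP; rewrite subr_eq0; apply/eqP/hom_sum.
  by move=> c' /eqP; rewrite subr_eq0 => /eqP/hom_sum/cu.
by split=> // i; exact: hom_triple_ker.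
Qed.

Lemma hom_dim_uniq E F n p : hom_dim E F n -> hom_dim E F p -> n = p.
Proof. by move=> /hom_dim_ker dn /hom_dim_ker dp; apply: (dim_uniq _ dn dp); exact: submod_zero. Qed.

Lemma hom_dim1_nonzero E : hom_dim E E 1 -> ~ (forall m : secU E, m = 0) \/ ~ (forall v : secV E, v = 0).
Proof.
move=> [b bP]; apply: contrapT => /not_orP[/contrapT zU /contrapT zV].
have [c [_ cu]] := bP (hom_id E).
have e (c' : 'rV[k]_1) : c = c' by apply: cu; split=> m; [rewrite [LHS]zU [RHS]zU|rewrite [LHS]zV [RHS]zV].
have := e (c + const_mx 1) => /rowP/(_ ord0); rewrite !mxE => /eqP.
by rewrite -[X in X == _]addr0 (inj_eq (addrI _)) eq_sym oner_eq0.
Qed.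

Lemma hom_dim1_simple E : hom_dim E E 1 -> simple E.
Proof.
move=> d1; have [b bP] := d1.
have b1 (f : hom E E) : exists c : k, (forall m, homU f m = scalU X c *: homU (b ord0) m) /\
    (forall v, homV f v = scalV X c *: homV (b ord0) v).
  have [c [[cU cV] _]] := bP f; exists (c 0 0).
  by split=> m; [rewrite cU|rewrite cV]; rewrite big_ord_recl big_ord0 addr0.
have [c [cU cV]] := b1 (hom_id E).
have c0 : c != 0.
  apply/eqP => c0; have [] := hom_dim1_nonzero d1; apply=> m.
    by have := cU m; rewrite c0 rmorph0 scale0r.
  by have := cV m; rewrite c0 rmorph0 scale0r.
move=> f; have [e [eU eV]] := b1 f; exists (e / c).
split=> m; [rewrite eU [in RHS](cU m : m = _)|rewrite eV [in RHS](cV m : m = _)];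
  by rewrite scalerA -rmorphM divfK.
Qed.

End Invariants.

(** * Extensions *)

Section Extensions.
Variables (k : closedFieldType) (X : elliptic_curve k).
Implicit Types A B C E F G K M N : coh X.
Local Notation U := (ringU X).
Local Notation V := (ringV X).

Lemma factor_epi M A N (p : hom M A) (f : hom M N) : epi p ->
  (forall m, homU p m = 0 -> homU f m = 0) -> (forall v, homV p v = 0 -> homV f v = 0) ->
  exists r : hom A N, (forall m, homU r (homU p m) = homU f m) /\
    (forall v, homV r (homV p v) = homV f v).
Proof.
move=> [/choice[sU sUP] /choice[sV sVP]] kU kV.
have fU m m' : homU p m = homU p m' -> homU f m = homU f m'.
  move=> e; apply/eqP; rewrite -subr_eq0 -(a_linearB _ _ (@homU_lin _ _ _ _ f)); apply/eqP.
  by apply: kU; rewrite (a_linearB _ _ (@homU_lin _ _ _ _ p)) e subrr.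
have fV m m' : homV p m = homV p m' -> homV f m = homV f m'.
  move=> e; apply/eqP; rewrite -subr_eq0 -(a_linearB _ _ (@homV_lin _ _ _ _ f)); apply/eqP.
  by apply: kV; rewrite (a_linearB _ _ (@homV_lin _ _ _ _ p)) e subrr.
pose rU a := homU f (sU a); pose rV a := homV f (sV a).
have rUE m : rU (homU p m) = homU f m by apply: fU.
have rVE m : rV (homV p m) = homV f m by apply: fV.
have lU : a_linear rU.
  by move=> a u v; rewrite /rU -(@homU_lin _ _ _ _ f); apply: fU; rewrite (@homU_lin _ _ _ _ p) !sUP.
have lV : a_linear rV.
  by move=> a u v; rewrite /rV -(@homV_lin _ _ _ _ f); apply: fV; rewrite (@homV_lin _ _ _ _ p) !sVP.
have [h lh hE] := extend_resU (secUV_y N) (f := fun x => resU N (rU x))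
  (fun a u v => etrans (congr1 (resU N) (lU a u v)) (resU_lin _ _ _)).
have hp w : h (homUV p w) = homUV f w.
  have [n [m wE]] := resU_surj w; apply: (@yn_inj _ _ _ n).
  rewrite -(a_linearZ _ _ lh) -(a_linearZ _ _ (@homUV_lin _ _ _ _ p)).
  by rewrite -(a_linearZ _ _ (@homUV_lin _ _ _ _ f)) wE !hom_resU hE rUE.
have hV v : h (resV A v) = resV N (rV v).
  by rewrite -{1}(sVP v) -hom_resV hp hom_resV.
by exists (@Hom k X A N (pack_linear lU) (pack_linear lV) (pack_linear lh) hE hV).
Qed.

Lemma factor_mono L M N (i : hom L M) (f : hom N M) : injective (homU i) -> injective (homV i) ->
  (forall m, exists l, homU i l = homU f m) -> (forall v, exists l, homV i l = homV f v) ->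
  exists e : hom N L, (forall m, homU i (homU e m) = homU f m) /\
    (forall v, homV i (homV e v) = homV f v).
Proof.
move=> injU injV /choice[eU eUE] /choice[eV eVE].
have injUV := homUV_inj injU.
have /choice[eW eWE] : forall w, exists w', homUV i w' = homUV f w.
  move=> w; apply: homUV_im.
  have [n [m wE]] := resU_surj w; exists n, (eU m).
  by rewrite -(a_linearZ _ _ (@homUV_lin _ _ _ _ f)) wE hom_resU eUE.
have lU : a_linear eU.
  by move=> a u v; apply: injU; rewrite (@homU_lin _ _ _ _ i) !eUE (@homU_lin _ _ _ _ f).
have lV : a_linear eV.
  by move=> a u v; apply: injV; rewrite (@homV_lin _ _ _ _ i) !eVE (@homV_lin _ _ _ _ f).
have lW : a_linear eW.
  by move=> a u v; apply: injUV; rewrite (@homUV_lin _ _ _ _ i) !eWE (@homUV_lin _ _ _ _ f).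
have cU m : eW (resU N m) = resU L (eU m).
  by apply: injUV; rewrite eWE (hom_resU f) (hom_resU i) eUE.
have cV m : eW (resV N m) = resV L (eV m).
  by apply: injUV; rewrite eWE (hom_resV f) (hom_resV i) eVE.
by exists (@Hom k X N L (pack_linear lU) (pack_linear lV) (pack_linear lW) cU cV).
Qed.

Lemma comp_linear (R : pzRingType) (P Q S : lmodType R) (f : {linear Q -> S}) (g : {linear P -> Q}) :
  a_linear (fun x => f (g x)).
Proof. by move=> a u v; rewrite (linear_a_linear g) (linear_a_linear f). Qed.

Definition comp_hom F G K (g : hom G K) (f : hom F G) : hom F K.
Proof.
apply: (@Hom k X F K (pack_linear (comp_linear (homU g) (homU f)))
  (pack_linear (comp_linear (homV g) (homV f))) (pack_linear (comp_linear (homUV g) (homUV f)))).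
- by move=> m; rewrite /= hom_resU hom_resU.
- by move=> m; rewrite /= hom_resV hom_resV.
Defined.

Lemma comp_homU F G K (g : hom G K) (f : hom F G) m :
  homU (comp_hom g f) m = homU g (homU f m).
Proof. by []. Qed.

Lemma comp_homV F G K (g : hom G K) (f : hom F G) m :
  homV (comp_hom g f) m = homV g (homV f m).
Proof. by []. Qed.

Definition bij_hom F G (f : hom F G) := [/\ injective (homU f), injective (homV f) & epi f].

Lemma inverse_hom F G (f : hom F G) : bij_hom f -> exists g : hom G F,
  (forall m, homU f (homU g m) = m) /\ (forall v, homV f (homV g v) = v).
Proof.
move=> [iU iV ef]; have [||g [gU gV]] := factor_epi (f := hom_id F) ef.
- by move=> m /(inj0 iU).
- by move=> m /(inj0 iV).
exists g; split=> m.
  by have [m' <-] := ef.1 m; rewrite gU.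
by have [m' <-] := ef.2 m; rewrite gV.
Qed.

(** The five lemma. *)
Lemma ext1_mor_bij A B A' B' (a : hom A A') (b : hom B B') (xi : ext1 A B) (xi' : ext1 A' B') :
  bij_hom a -> bij_hom b -> ext1_mor a b xi xi' ->
  exists2 f : hom (mid xi) (mid xi'), bij_hom f &
    (forall m, homU a (homU (prj xi) m) = homU (prj xi') (homU f m)) /\
    (forall v, homV a (homV (prj xi) v) = homV (prj xi') (homV f v)).
Proof.
move=> [aU aV [aeU aeV]] [bU bV [beU beV]] [f [fiU fiV fpU fpV]]; exists f => //.
have [[iU iV] [pU pV] exU exV] := ext1_exact xi.
have [[iU' iV'] [pU' pV'] exU' exV'] := ext1_exact xi'.
split.
- move=> u v e; apply/eqP; rewrite -subr_eq0; apply/eqP.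
  have : homU f (u - v) = 0 by rewrite (a_linearB _ _ (@homU_lin _ _ _ _ f)) e subrr.
  move: (u - v) => {}u {e v} fu.
  have /exU[b0 bE] : homU (prj xi) u = 0 by apply: (inj0 aU); rewrite fpU fu linear0.
  rewrite -bE; suff -> : b0 = 0 by rewrite linear0.
  by apply: (inj0 bU); apply: (inj0 iU'); rewrite -fiU bE.
- move=> u v e; apply/eqP; rewrite -subr_eq0; apply/eqP.
  have : homV f (u - v) = 0 by rewrite (a_linearB _ _ (@homV_lin _ _ _ _ f)) e subrr.
  move: (u - v) => {}u {e v} fu.
  have /exV[b0 bE] : homV (prj xi) u = 0 by apply: (inj0 aV); rewrite fpV fu linear0.
  rewrite -bE; suff -> : b0 = 0 by rewrite linear0.
  by apply: (inj0 bV); apply: (inj0 iV'); rewrite -fiV bE.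
- split=> n.
    have [a0 a0E] := aeU (homU (prj xi') n); have [m mE] := pU a0.
    have /exU'[b' b'E] : homU (prj xi') (n - homU f m) = 0.
      by rewrite (a_linearB _ _ (@homU_lin _ _ _ _ (prj xi'))) -fpU mE a0E subrr.
    have [b0 b0E] := beU b'; exists (m + homU (inj xi) b0).
    by rewrite (a_linearD _ _ (@homU_lin _ _ _ _ f)) fiU b0E b'E addrC subrK.
  have [a0 a0E] := aeV (homV (prj xi') n); have [m mE] := pV a0.
  have /exV'[b' b'E] : homV (prj xi') (n - homV f m) = 0.
    by rewrite (a_linearB _ _ (@homV_lin _ _ _ _ (prj xi'))) -fpV mE a0E subrr.
  have [b0 b0E] := beV b'; exists (m + homV (inj xi) b0).
  by rewrite (a_linearD _ _ (@homV_lin _ _ _ _ f)) fiV b0E b'E addrC subrK.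
Qed.

Lemma ext1_mor_split A B A' B' (a : hom A A') (b : hom B B') (xi : ext1 A B) (xi' : ext1 A' B') :
  bij_hom a -> bij_hom b -> ext1_mor a b xi xi' -> ext1_split xi <-> ext1_split xi'.
Proof.
move=> ba bb /(ext1_mor_bij ba bb)[f bf [fU fV]].
split=> -[r [rU rV]].
  have [g [gU gV]] := inverse_hom ba; exists (comp_hom f (comp_hom r g)).
  split=> m; first by rewrite !comp_homU -fU rU gU.
  by rewrite !comp_homV -fV rV gV.
have [g [gU gV]] := inverse_hom bf; exists (comp_hom g (comp_hom r a)).
case: ba => aU aV _; split=> m; [apply: aU | apply: aV].
  by rewrite fU !comp_homU gU rU.
by rewrite fV !comp_homV gV rV.
Qed.

(** Defined on Yoneda extensions of every length, to allow an induction over their morphisms. *)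
Definition yext_split n A B (x : yext n A B) : Prop :=
  match x with YOne _ _ xi => ext1_split xi | YSplice _ _ _ _ _ _ => False end.

Lemma yext_mor_split n A B A' B' (a : hom A A') (b : hom B B') (x : yext n A B) (x' : yext n A' B') :
  yext_mor a b x x' -> bij_hom a -> bij_hom b -> yext_split x <-> yext_split x'.
Proof.
case=> [A0 B0 A1 B1 a0 b0 xi xi' m ba bb|*]; last by split.
exact: (ext1_mor_split ba bb m).
Qed.

Lemma bij_hom_id F : bij_hom (hom_id F).
Proof. by split=> //; split=> m; exists m. Qed.

Lemma ext_vanishes_split A B : ext_vanishes 1 A B ->
  forall xi xi' : ext1 A B, ext1_split xi -> ext1_split xi'.
Proof.
move=> va xi xi' s; have : yext_split (YOne xi) by [].
suff [st _] : yext_split (YOne xi) <-> yext_split (YOne xi') by exact: st.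
clear s.
elim: (va (YOne xi) (YOne xi')) => // [x y m|x y _ IH|x y z _ IH1 _ IH2].
- by apply: (yext_mor_split m); exact: bij_hom_id.
- exact: iff_sym.
- exact: iff_trans IH1 IH2.
Qed.

End Extensions.

(** * Extensions given by cocycles *)

Section Cocycles.
Variables (k : closedFieldType) (X : elliptic_curve k).
Implicit Types A B C E F G K M N : coh X.
Local Notation U := (ringU X).
Local Notation V := (ringV X).

Lemma finitely_generated_pair (R : comNzRingType) (M N : lmodType R) :
  finitely_generated M -> finitely_generated N -> finitely_generated (M * N)%type.
Proof.
move=> [m [g gP]] [n [h hP]].
exists (m + n)%N, (fun i => match fintype.split i with inl j => (g j, 0) | inr j => (0, h j) end).
move=> [x y]; have [a ->] := gP x; have [b ->] := hP y.
exists (fun i => match fintype.split i with inl j => a j | inr j => b j end).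
rewrite big_split_ord /=.
have -> : \sum_(i < m) match fintype.split (lshift n i) with inl j => a j | inr j => b j end *:
    match fintype.split (lshift n i) with inl j => (g j, 0) | inr j => (0, h j) end =
    (\sum_i a i *: g i, 0) :> (M * N)%type.
  rewrite (eq_bigr (fun i => (a i *: g i, 0) : (M * N)%type)); last first.
    move=> i _; rewrite (unsplitK (inl i : 'I_m + 'I_n)).
    by congr (_, _); rewrite scaler0.
  elim/big_rec2: _ => // i y1 y2 _ ->; congr (_, _); exact: addr0.
have -> : \sum_(i < n) match fintype.split (rshift m i) with inl j => a j | inr j => b j end *:
    match fintype.split (rshift m i) with inl j => (g j, 0) | inr j => (0, h j) end =
    (0, \sum_i b i *: h i) :> (M * N)%type.
  rewrite (eq_bigr (fun i => (0, b i *: h i) : (M * N)%type)); last first.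
    move=> i _; rewrite (unsplitK (inr i : 'I_m + 'I_n)).
    by congr (_, _); rewrite scaler0.
  elim/big_rec2: _ => // i y1 y2 _ ->; congr (_, _); exact: addr0.
by congr (_, _); rewrite ?addr0 ?add0r.
Qed.

Lemma a_linearN (R : pzRingType) (M N : lmodType R) (f : M -> N) :
  a_linear f -> a_linear (fun x => - f x).
Proof. by move=> lf a u v; rewrite lf opprD -scalerN. Qed.

Section OneCocycle.
Variables (A B : coh X) (g : secU A -> secUV B) (lg : a_linear g).

Definition cocycle_resU_fun (p : (secU B * secU A)%type) : (secUV B * secUV A)%type :=
  (resU B p.1 + g p.2, resU A p.2).
Fact cocycle_resU_linear : a_linear cocycle_resU_fun.
Proof.
move=> a [b1 x1] [b2 x2]; rewrite /cocycle_resU_fun.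
congr (_, _); last exact: resU_lin.
change (resU B (a *: b1 + b2) + g (a *: x1 + x2) = a *: (resU B b1 + g x1) + (resU B b2 + g x2)).
by rewrite (@resU_lin _ _ B) lg scalerDr; zmod.
Qed.

Definition cocycle_resV (p : (secV B * secV A)%type) : (secUV B * secUV A)%type :=
  (resV B p.1, resV A p.2).
Fact cocycle_resV_additive : zmod_morphism cocycle_resV.
Proof. by move=> [b1 x1] [b2 x2]; congr (_, _); exact: raddfB. Qed.
HB.instance Definition _ := GRing.isZmodMorphism.Build _ _ cocycle_resV cocycle_resV_additive.

Fact cocycle_y : bijective (fun w : (secUV B * secUV A)%type => yU *: w).
Proof.
have [h hK Kh] := secUV_y B; have [h' hK' Kh'] := secUV_y A.
exists (fun w => (h w.1, h' w.2)) => -[w1 w2]; congr (_, _);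
  [exact: hK | exact: hK' | exact: Kh | exact: Kh'].
Qed.

Fact cocycle_const (c : k) v : cocycle_resV (constV c *: v) = constU c *: cocycle_resV v.
Proof. by case: v => v1 v2; congr (_, _); exact: resV_const. Qed.
Fact cocycle_s v : yU *: cocycle_resV (sV *: v) = cocycle_resV v.
Proof. by case: v => v1 v2; congr (_, _); exact: resV_s. Qed.
Fact cocycle_t v : yU *: cocycle_resV (tV *: v) = xU *: cocycle_resV v.
Proof. by case: v => v1 v2; congr (_, _); exact: resV_t. Qed.

Fact cocycle_resU_surj w : exists n p, yU ^+ n *: w = cocycle_resU_fun p.
Proof.
case: w => w1 w2; have [n [x xE]] := resU_surj w2.
have [m [b bE]] := resU_surj (yU ^+ n *: w1 - g x).
exists (m + n)%N, (b, yU ^+ m *: x); rewrite exprD -scalerA.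
congr (_, _); last first.
  by rewrite /= (a_linearZ _ _ (@resU_lin _ _ A)) -xE.
change (yU ^+ m *: (yU ^+ n *: w1) = resU B b + g (yU ^+ m *: x)).
by rewrite (a_linearZ _ _ lg) -bE scalerBr subrK.
Qed.

Fact cocycle_resU_ker p : cocycle_resU_fun p = 0 -> exists n, yU ^+ n *: p = 0.
Proof.
case: p => b x [e1 e2]; have [n xn] := resU_ker e2.
have [m bm] : exists m, yU ^+ m *: (yU ^+ n *: b) = 0.
  apply: resU_ker; rewrite (a_linearZ _ _ (@resU_lin _ _ B)).
  have -> : resU B b = - g x by apply/eqP; rewrite -addr_eq0; apply/eqP.
  by rewrite scalerN -(a_linearZ _ _ lg) xn (a_linear0 lg) oppr0.
exists (m + n)%N; rewrite exprD -scalerA; congr (_, _); first exact: bm.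
by rewrite -[RHS](scaler0 _ (yU ^+ m)); congr (_ *: _).
Qed.

Fact cocycle_resV_surj w : exists n p, w = yU ^+ n *: cocycle_resV p.
Proof.
case: w => w1 w2; have [n [v ->]] := resV_surj w1; have [m [v' ->]] := resV_surj w2.
exists (n + m)%N, (sV ^+ m *: v, sV ^+ n *: v'); congr (_, _); rewrite /=.
  by rewrite exprD -scalerA resV_sn.
by rewrite addnC exprD -scalerA resV_sn.
Qed.

Fact cocycle_resV_ker p : cocycle_resV p = 0 -> exists n, sV ^+ n *: p = 0.
Proof.
case: p => v v' [/resV_ker[n vn] /resV_ker[m v'm]]; exists (n + m)%N; congr (_, _); rewrite /=.
  by rewrite addnC exprD -scalerA vn scaler0.
by rewrite exprD -scalerA v'm scaler0.
Qed.

(** Gluing [B (+) A] along the matrix [[1, g], [0, 1]]. *)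
Definition cocycle_mid : coh X :=
  @Coh k X (secU B * secU A)%type (secV B * secV A)%type (secUV B * secUV A)%type
    (pack_linear cocycle_resU_linear) cocycle_resV
    (finitely_generated_pair (@secU_fg _ _ B) (@secU_fg _ _ A))
    (finitely_generated_pair (@secV_fg _ _ B) (@secV_fg _ _ A)) cocycle_y
    cocycle_const cocycle_s cocycle_t
    cocycle_resU_surj cocycle_resU_ker cocycle_resV_surj cocycle_resV_ker.

Fact pair_inl_linear (R : comNzRingType) (M N : lmodType R) : a_linear (fun m : M => (m, 0) : (M * N)%type).
Proof. by move=> a u v; congr (_, _); exact: (esym (etrans (addr0 _) (scaler0 _ _))). Qed.
Fact pair_snd_linear (R : comNzRingType) (M N : lmodType R) : a_linear (fun p : (M * N)%type => p.2).
Proof. by []. Qed.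

Definition cocycle_inj : hom B cocycle_mid.
Proof.
apply: (@Hom k X B cocycle_mid (pack_linear (@pair_inl_linear _ (secU B) (secU A)))
  (pack_linear (@pair_inl_linear _ (secV B) (secV A)))
  (pack_linear (@pair_inl_linear _ (secUV B) (secUV A)))).
- by move=> m; congr (_, _); rewrite ?linear0 // (a_linear0 lg) addr0.
- by move=> v; congr (_, _); rewrite ?raddf0.
Defined.

Definition cocycle_prj : hom cocycle_mid A :=
  @Hom k X cocycle_mid A (pack_linear (@pair_snd_linear _ (secU B) (secU A)))
    (pack_linear (@pair_snd_linear _ (secV B) (secV A)))
    (pack_linear (@pair_snd_linear _ (secUV B) (secUV A))) (fun=> erefl) (fun=> erefl).

Lemma cocycle_exact : short_exact cocycle_inj cocycle_prj.
Proof.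
split.
- by split=> u v [].
- by split=> m; exists (0, m).
- by case=> b a; split=> [/= ->|[m' [_ <-]]] //; exists b.
- by case=> b a; split=> [/= ->|[m' [_ <-]]] //; exists b.
Qed.

Definition cocycle_ext : ext1 A B := Ext1 cocycle_exact.

(** A splitting of the glued sheaf is a matrix with last column [[h, 1]], and compatibility
    with the gluing says that [g] is the coboundary of [- h]. *)
Lemma cocycle_split : ext1_split cocycle_ext <->
  exists2 t : hom_space A B, hom_pairs (@top_pred _) (@top_pred _) t & g = hom_delta A B t.
Proof.
split=> [[r [rU rV]]|[[[f h] w] [[lf _] [lh _] [lw _] c] gE]].
  pose fU a := (homU r a).1; pose fV v := (homV r v).1; pose fW w := (homUV r w).1.
  have lU : a_linear fU by move=> a u v; rewrite /fU (@homU_lin _ _ _ _ r).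
  have lV : a_linear fV by move=> a u v; rewrite /fV (@homV_lin _ _ _ _ r).
  have lW : a_linear fW by move=> a u v; rewrite /fW (@homUV_lin _ _ _ _ r).
  exists (fun a => - fU a, fun v => - fV v, fun w => - fW w).
    split.
    - by split=> //; exact: (a_linearN lU).
    - by split=> //; exact: (a_linearN lV).
    - by split=> //; exact: (a_linearN lW).
    - move=> v; change (- fW (resV A v) = resV B (- fV v)); rewrite raddfN; congr (- _).
      exact: (congr1 fst (hom_resV r v)).
  apply/funext => a; have := congr1 fst (hom_resU r a).
  change (fW (resU A a) = resU B (fU a) + g (homU r a).2 -> g a = resU B (- fU a) - - fW (resU A a)).
  have -> : (homU r a).2 = a by exact: rU.
  by move=> ->; rewrite linearN; zmod.
pose rU (a : secU A) : (secU B * secU A)%type := (- f a, a).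
pose rV (a : secV A) : (secV B * secV A)%type := (- h a, a).
pose rW (a : secUV A) : (secUV B * secUV A)%type := (- w a, a).
have lU : a_linear rU by move=> a u v; congr (_, _); exact: (a_linearN lf a u v).
have lV : a_linear rV by move=> a u v; congr (_, _); exact: (a_linearN lh a u v).
have lW : a_linear rW by move=> a u v; congr (_, _); exact: (a_linearN lw a u v).
have cU a : rW (resU A a) = resU cocycle_mid (rU a).
  congr (_, _); change (- w (resU A a) = resU B (- f a) + g a).
  rewrite gE; change (- w (resU A a) = resU B (- f a) + (resU B (f a) - w (resU A a))).
  by rewrite linearN; zmod.
have cV v : rW (resV A v) = resV cocycle_mid (rV v).
  by congr (_, _); change (- w (resV A v) = resV B (- h v)); rewrite raddfN; congr (- _); exact: c.
by exists (@Hom k X A cocycle_mid (pack_linear lU) (pack_linear lV) (pack_linear lW) cU cV).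
Qed.

End OneCocycle.

End Cocycles.

(** * The index of an elliptically exceptional sheaf *)

Section ExtIndex.
Variables (k : closedFieldType) (X : elliptic_curve k).
Implicit Types A B C E F G K M N : coh X.
Local Notation U := (ringU X).
Local Notation V := (ringV X).
Local Notation kUV F := (restr (scalU X) (secUV F)).

(** The coboundaries: the cokernel of the complex is [Ext^1(A, B)]. *)
Definition hom_coker A B : (secU A -> kUV B) -> Prop :=
  sum_of (image_of (hom_delta A B) (hom_pairs (@top_pred _) (@top_pred _))) (@zero_of _ _).

Lemma submod_hom_coker A B : submodule (@hom_coker A B).
Proof.
apply: submod_add; last exact: submod_zero.
by apply: submod_image; apply: submod_hom_pairs; exact: submod_top.
Qed.

Lemma cocycle_split_coker A B (g : secU A -> secUV B) (lg : a_linear g) :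
  ext1_split (cocycle_ext lg) <-> @hom_coker A B g.
Proof.
rewrite cocycle_split; split=> [[t tP ->]|[p [q [[t tP ->] -> ->]]]].
  by exists (hom_delta A B t), 0; split=> //; [exists t | rewrite addr0].
by exists t => //; rewrite addr0.
Qed.

(** Every cocycle defines the same extension class as the zero cocycle. *)
Lemma hom_index_of_vanishing A B n : ext_vanishes 1 A B -> hom_dim A B n -> hom_index A B n 0.
Proof.
move=> va dn; split; first exact: hom_dim_ker.
have l0 : a_linear (fun _ : secU A => 0 : secUV B).
  by move=> *; rewrite scaler0 addr0.
have s0 : ext1_split (cocycle_ext l0) by apply/cocycle_split_coker; exact: (submod0 (submod_hom_coker A B)).
have sQ : submodule (@hom_to _ _ (scalU X) (secU A) (secUV B) (@top_pred _)).
  by apply: submod_hom_to; exact: submod_top.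
apply: (dim_ext _ _ (dim_refl sQ)) => // g; split=> [[lg _]|[p [q [[t tP ->] -> ->]]]].
  by apply/(cocycle_split_coker lg); exact: (@ext_vanishes_split _ _ A B va _ _ s0).
by rewrite addr0; exact: (hom_delta_to tP).
Qed.

Section PushoutClasses.
Variables (A B : coh X) (xi0 : ext1 A B).

(** Both extensions are pushouts of [xi0], along [c0] and [c1]. Combining the two maps from
    the middle term of [xi0] gives a map to the extension of the combined cocycle, which
    vanishes on [B] because [e0 c0 + e1 c1 = 0], and so factors through a splitting. *)
Lemma proportional_cocycles (g0 g1 : secU A -> secUV B) (l0 : a_linear g0) (l1 : a_linear g1)
    (c0 c1 e0 e1 : k) :
  ext1_mor (hom_id A) (hom_scalar B c0) xi0 (cocycle_ext l0) ->
  ext1_mor (hom_id A) (hom_scalar B c1) xi0 (cocycle_ext l1) ->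
  e0 * c0 + e1 * c1 = 0 ->
  @hom_coker A B (fun a => scalU X e0 *: g0 a + scalU X e1 *: g1 a).
Proof.
move=> [f0 [i0U i0V p0U p0V]] [f1 [i1U i1V p1U p1V]] e01.
set g := fun a => _.
have lg : a_linear g.
  by move=> a u v; rewrite /g l0 l1 !scalerDr !scalerA ![_ * a]mulrC; zmod.
apply/(cocycle_split_coker lg).
pose M := mid xi0.
pose qU (m : secU M) : secU B := scalU X e0 *: ((homU f0 m).1 : secU B) + scalU X e1 *: ((homU f1 m).1 : secU B).
pose qV (m : secV M) : secV B := scalV X e0 *: ((homV f0 m).1 : secV B) + scalV X e1 *: ((homV f1 m).1 : secV B).
pose qW (m : secUV M) : secUV B := scalU X e0 *: ((homUV f0 m).1 : secUV B) + scalU X e1 *: ((homUV f1 m).1 : secUV B).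
have lin (R : comNzRingType) (P S T : lmodType R) (h0 h1 : P -> (S * T)%type) (z0 z1 : R) :
    a_linear h0 -> a_linear h1 -> a_linear (fun m => z0 *: (h0 m).1 + z1 *: (h1 m).1).
  move=> lh0 lh1 a u v; rewrite lh0 lh1 /= !scalerDr !scalerA ![_ * a]mulrC; zmod.
have lqU : a_linear qU := lin _ _ _ _ _ _ _ _ (@homU_lin _ _ _ _ f0) (@homU_lin _ _ _ _ f1).
have lqV : a_linear qV := lin _ _ _ _ _ _ _ _ (@homV_lin _ _ _ _ f0) (@homV_lin _ _ _ _ f1).
have lqW : a_linear qW := lin _ _ _ _ _ _ _ _ (@homUV_lin _ _ _ _ f0) (@homUV_lin _ _ _ _ f1).
pose fU (m : secU M) : (secU B * secU A)%type := (qU m, homU (prj xi0) m).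
pose fV (m : secV M) : (secV B * secV A)%type := (qV m, homV (prj xi0) m).
pose fW (m : secUV M) : (secUV B * secUV A)%type := (qW m, homUV (prj xi0) m).
have lU : a_linear fU by move=> a u v; congr (_, _); [exact: lqU | exact: homU_lin].
have lV : a_linear fV by move=> a u v; congr (_, _); [exact: lqV | exact: homV_lin].
have lW : a_linear fW by move=> a u v; congr (_, _); [exact: lqW | exact: homUV_lin].
have cU m : fW (resU M m) = resU (cocycle_mid lg) (fU m).
  congr (_, _); last exact: hom_resU.
  have h0 : (homUV f0 (resU M m)).1 = resU B (homU f0 m).1 + g0 (homU (prj xi0) m).
    rewrite (p0U m : homU (prj xi0) m = _); exact: (congr1 fst (hom_resU f0 m)).
  have h1 : (homUV f1 (resU M m)).1 = resU B (homU f1 m).1 + g1 (homU (prj xi0) m).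
    rewrite (p1U m : homU (prj xi0) m = _); exact: (congr1 fst (hom_resU f1 m)).
  change (qW (resU M m) = resU B (qU m) + g (homU (prj xi0) m)).
  rewrite /qW h0 h1 /qU (a_linearD _ _ (@resU_lin _ _ B)) !(a_linearZ _ _ (@resU_lin _ _ B)) /g.
  by rewrite !scalerDr; zmod.
have cV v : fW (resV M v) = resV (cocycle_mid lg) (fV v).
  congr (_, _); last exact: hom_resV.
  have h0 : (homUV f0 (resV M v)).1 = resV B (homV f0 v).1 by exact: (congr1 fst (hom_resV f0 v)).
  have h1 : (homUV f1 (resV M v)).1 = resV B (homV f1 v).1 by exact: (congr1 fst (hom_resV f1 v)).
  change (qW (resV M v) = resV B (qV v)).
  by rewrite /qW h0 h1 /qV (raddfD (resV B)) !(@resV_scal _ _ B).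
pose f := @Hom k X M (cocycle_mid lg) (pack_linear lU) (pack_linear lV) (pack_linear lW) cU cV.
have [[iU iV] ep exU exV] := ext1_exact xi0.
have [m /exU[b <-]|v /exV[b <-]|r [rU rV]] := factor_epi (f := f) ep.
- congr (_, _); last by apply/exU; exists b.
  change (qU (homU (inj xi0) b) = 0); rewrite /qU i0U i1U.
  change (scalU X e0 *: (scalU X c0 *: b) + scalU X e1 *: (scalU X c1 *: b) = 0).
  by rewrite !scalerA -!rmorphM -scalerDl -rmorphD e01 rmorph0 scale0r.
- congr (_, _); last by apply/exV; exists b.
  change (qV (homV (inj xi0) b) = 0); rewrite /qV i0V i1V.
  change (scalV X e0 *: (scalV X c0 *: b) + scalV X e1 *: (scalV X c1 *: b) = 0).
  by rewrite !scalerA -!rmorphM -scalerDl -rmorphD e01 rmorph0 scale0r.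
exists r; split=> a.
  by have [m <-] := ep.1 a; rewrite rU.
by have [m <-] := ep.2 a; rewrite rV.
Qed.

End PushoutClasses.

Lemma ext1_line_coker A B : ext1_line A B -> exists2 b, (b <= 1)%N &
  dim_quo (@hom_to _ _ (scalU X) (secU A) (secUV B) (@top_pred _)) (@hom_coker A B) b.
Proof.
move=> [xi0 xiP].
have sQ : submodule (@hom_to _ _ (scalU X) (secU A) (secUV B) (@top_pred _)).
  by apply: submod_hom_to; exact: submod_top.
have [b db b1] : exists2 b, dim_quo (@hom_to _ _ (scalU X) (secU A) (secUV B) (@top_pred _)) (@hom_coker A B) b & (b <= 1)%N.
  apply: (dim_exists sQ (submod_hom_coker A B)) => -[|[|q]] // w wP indw; exfalso.
  pose j1 : 'I_q.+2 := lift ord0 ord0.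
  have [c0 [m0 _]] := xiP (cocycle_ext (wP ord0).1).
  have [c1 [m1 _]] := xiP (cocycle_ext (wP j1).1).
  apply: (@two_scalars_dependent k c0 c1) => e0 e1 /(proportional_cocycles m0 m1).
  exact: (indep_pair indw (isT : ord0 != j1)).
by exists b.
Qed.

(** For a split class the pushouts along [0] and along [1] would coincide. *)
Lemma ext1_line_not_split A B : ext1_line A B -> exists xi : ext1 A B, ~ ext1_split xi.
Proof.
move=> [xi xiP]; exists xi => -[r [rU rV]].
have [c [_ cu]] := xiP xi.
have [[iU iV] ep exU exV] := ext1_exact xi.
have c0 : c = 0.
  apply: cu; exists (comp_hom r (prj xi)); split=> m.
  - rewrite comp_homU (exU _).2; last by exists m.
    rewrite linear0; change (0 = homU (inj xi) (scalU X 0 *: m)).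
    by rewrite rmorph0 scale0r linear0.
  - rewrite comp_homV (exV _).2; last by exists m.
    rewrite linear0; change (0 = homV (inj xi) (scalV X 0 *: m)).
    by rewrite rmorph0 scale0r linear0.
  - by rewrite comp_homU rU.
  - by rewrite comp_homV rV.
have c1 : c = 1.
  apply: cu; exists (hom_id (mid xi)); split=> m //.
  - by change (homU (inj xi) m = homU (inj xi) (scalU X 1 *: m)); rewrite rmorph1 scale1r.
  - by change (homV (inj xi) m = homV (inj xi) (scalV X 1 *: m)); rewrite rmorph1 scale1r.
by have := oner_neq0 k; rewrite -c1 c0 eqxx.
Qed.

(** A morphism from [E] to the middle term is projected to a scalar; if all these scalars were
    zero, all morphisms would be multiples of the inclusion. *)
Lemma two_homs_split E (xi : ext1 E E) p q : hom_dim E E 1 -> hom_index E (mid xi) p q -> (1 < p)%N ->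
  ext1_split xi.
Proof.
move=> d1 [dp _] p1; have sE := hom_dim1_simple d1.
apply: contrapT => ns.
have [[iU iV] ep exU exV] := ext1_exact xi.
have [w [wP indw _]] := dp.
have ex i : exists c : k, w i = c *: hom_triple (inj xi).
  have [f fE] := hom_of_ker (wP i).
  have [c [cU cV]] := sE (comp_hom (prj xi) f).
  have c0 : c = 0.
    apply/eqP; apply/negP => /negP c0; apply: ns.
    have inv : scalU X c^-1 * scalU X c = 1 /\ scalV X c^-1 * scalV X c = 1.
      by rewrite -!rmorphM mulVf // !rmorph1.
    exists (comp_hom f (hom_scalar E c^-1)); split=> m.
      change (homU (comp_hom (prj xi) f) (scalU X c^-1 *: m) = m).
      by rewrite cU scalerA mulrC inv.1 scale1r.
    change (homV (comp_hom (prj xi) f) (scalV X c^-1 *: m) = m).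
    by rewrite cV scalerA mulrC inv.2 scale1r.
  have [m|v|e [eU eV]] := factor_mono (f := f) iU iV.
  - by apply/exU; rewrite -comp_homU cU c0 rmorph0 scale0r.
  - by apply/exV; rewrite -comp_homV cV c0 rmorph0 scale0r.
  have [z [zU zV]] := sE e; exists z; rewrite -fE.
  have := (hom_sum f (fun _ : 'I_1 => inj xi) (fun=> z)).2.
  rewrite big_ord_recl big_ord0 addr0; apply; split=> m; rewrite big_ord_recl big_ord0 addr0.
    by rewrite -eU zU linearZ.
  by rewrite -eV zV linearZ.
have [c cE] := choice ex.
have o1 : (0 < p)%N by exact: ltnW.
pose j0 := Ordinal o1; pose j1 := Ordinal p1.
apply: (@two_scalars_dependent k (c j0) (c j1)) => e0 e1 e01.
apply: (indep_pair indw (isT : j0 != j1)).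
by rewrite !cE !scalerA -scalerDl e01 scale0r.
Qed.

(** The line [Ext^1(E, E)] of extension classes bounds the cokernel by [1]. If the cokernel were
    zero, comparing a self-extension [M] of [E] with [E (+) E] would give
    [Hom(E, M)] dimension at least two, and every self-extension would split. *)
Lemma self_index E : torsion_free E -> (exists m : secU E, m <> 0) ->
  hom_dim E E 1 -> ext1_line E E -> hom_index E E 1 1.
Proof.
move=> tf nz d1 l1; have [b b1 db] := ext1_line_coker l1.
have iE : hom_index E E 1 b by split=> //; exact: (hom_dim_ker d1).
case: b b1 db iE => [|[|]] // _ _ iE; exfalso.
have [xi ns] := ext1_line_not_split l1; apply: (ns).
have [r nb] := tf_near_basis tf.
have [a [b cE]] := cech_index_exists tf nz (hom_dim1_simple d1).
have [a' [b' [cM eM]]] := cech_index_exact (ext1_exact xi) cE cE.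
have [a2 [b2 [c2 e2]]] := power_cech_index 2 cE.
have [p [q [i2 ei2]]] := power_hom_index 2 iE.
have tf2 := power_torsion_free 2 tf; have tfM := torsion_free_exact (ext1_exact xi) tf tf.
have nb2 := power_near_basis 2 nb.
have nbM := near_basis_exact (ext1_exact xi) nb nb.
rewrite addnn -mul2n in nbM.
have [p' [q' [iM eiM]]] := index_same_rank tf nz nb tf2 tfM nb2 nbM c2 cM i2.
apply: (two_homs_split d1 iM); nia.
Qed.

End ExtIndex.

(** * Simple sheaves with torsion *)

Section SimpleTorsion.
Variables (k : closedFieldType) (X : elliptic_curve k).
Implicit Types E F G : coh X.
Local Notation U := (ringU X).
Local Notation V := (ringV X).

Section RankOne.
Variables (A : comNzRingType) (phi : {rmorphism k -> A}) (ev : {rmorphism A -> k}).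
Variables (M : lmodType A) (e : M) (la : M -> k).
Hypotheses (evE : forall b, b *: e = phi (ev b) *: e) (e0 : e <> 0).
Hypotheses (laD : forall x y, la (x + y) = la x + la y) (laZ : forall a x, la (a *: x) = ev a * la x).
Hypothesis la0 : exists x, la x <> 0.

Lemma rank_one_linear : a_linear (fun x => phi (la x) *: e).
Proof.
move=> a u v; rewrite laD laZ rmorphD rmorphM scalerDl; congr (_ + _).
by rewrite mulrC -!scalerA -evE !scalerA mulrC.
Qed.

Lemma phi_eq0 c : phi c *: e = 0 -> c = 0.
Proof.
move=> c0; apply/eqP; apply/negP => /negP cn0; apply: e0.
by rewrite -[e]scale1r -(rmorph1 phi) -(mulVf cn0) rmorphM -scalerA c0 scaler0.
Qed.

Lemma rank_one_scalar c : (forall x, phi (la x) *: e = phi c *: x) ->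
  c <> 0 /\ forall x, exists c', x = phi c' *: e.
Proof.
move=> cP; have c0 : c <> 0.
  move=> c0; have [x] := la0; apply; apply: phi_eq0.
  by rewrite cP c0 rmorph0 scale0r.
split=> // x; exists (c^-1 * la x).
rewrite rmorphM -scalerA cP scalerA -rmorphM mulVf ?rmorph1 ?scale1r //; exact/eqP.
Qed.

End RankOne.

(** Such a sheaf has length at most two. *)
Definition small E :=
  (exists e : secU E, forall m, exists c, m = scalU X c *: e) /\
  (exists e : secV E, forall v, exists c, v = scalV X c *: e).

(** There is an element [e] killed by [s] and by [t]; composing the projection of the stalk at
    infinity to the residue field with [e] gives an endomorphism of rank one, and a simple
    sheaf has none except scalars. *)
Lemma simple_torsionV E : simple E -> (exists2 v, resV E v = 0 & v <> 0) -> small E.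
Proof.
move=> sE [v v0 vn0].
have last_nz (a : V) (w : secV E) n : w <> 0 -> a ^+ n *: w = 0 ->
    exists2 j, a ^+ j *: w <> 0 & a *: (a ^+ j *: w) = 0.
  move=> wn0; elim: n => [|n IH]; first by rewrite expr0 scale1r.
  move=> aw; have [/IH//|aw'] := pselect (a ^+ n *: w = 0).
  by exists n => //; rewrite scalerA -exprS.
have [n sn] := resV_ker v0.
have [j e1 se1] := last_nz sV v n vn0 sn; move: (sV ^+ j *: v) e1 se1 => {v v0 vn0 n sn j} v vn0 sv.
have [|j en0 te] := last_nz tV v 3%N vn0; first by rewrite -unitV_s -scalerA sv scaler0.
set e := tV ^+ j *: v in en0 te.
have se : sV *: e = 0 by rewrite /e scalerA mulrC -scalerA sv scaler0.
have s0 := ev_inf_s X.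
have t0 : ev_inf X tV = 0 by apply: ev_t_of_s.
have evE b : b *: e = scalV X (ev_inf X b) *: e.
  elim/generatedV: b => [c|b b' IH IH'|b IH|b IH].
  - by rewrite ev_inf_scal.
  - by rewrite scalerDl IH IH' -scalerDl -rmorphD -rmorphD.
  - by rewrite mulrC -scalerA se scaler0 rmorphM s0 mulr0 rmorph0 scale0r.
  - by rewrite mulrC -scalerA te scaler0 rmorphM t0 mulr0 rmorph0 scale0r.
have [la [la0 laD laZ]] := residue_functional (@ev_inf_scal _ X) (secV_fg E) en0 evE.
have re0 : resV E e = 0 by rewrite -resV_s se raddf0 scaler0.
have lf := rank_one_linear evE laD laZ.
have l0 (N : lmodType U) : a_linear (fun _ : N => 0 : N) by move=> *; rewrite scaler0 addr0.
have cV w : 0 = resV E (scalV X (la w) *: e) by rewrite resV_scal re0 scaler0.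
have [c [cU cVc]] := sE (@Hom k X E E (pack_linear (l0 (secU E))) (pack_linear lf)
  (pack_linear (l0 (secUV E))) (fun m => esym (linear0 (resU E))) cV).
have [c0 sp] := rank_one_scalar en0 la0 cVc.
split; last by exists e.
exists 0 => m; exists 0; rewrite scaler0.
have : scalU X c *: m = 0 by rewrite -cU.
move=> cm; rewrite -[m]scale1r -(rmorph1 (scalU X)) -(mulVf (introN eqP c0)) rmorphM -scalerA.
by rewrite cm scaler0.
Qed.

(** Torsion over [U] contains a copy [k e] of the residue field of a point, and Nakayama's lemma
    gives a projection of [E] to that residue field. If the point lies outside [V], the
    resulting endomorphism of rank one is extended by zero. Otherwise the multiples of [e] over
    the intersection are also the image of a copy [k e'] of the residue field in the sections
    over [V], where multiplying by a power of [s] has removed what is supported at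
    infinity. *)
Lemma simple_torsionU E : simple E ->
  (exists a (m : secU E), [/\ a <> 0, m <> 0 & a *: m = 0]) -> small E.
Proof.
move=> sE [a [m [a0 m0 am]]].
have sZ : submodule (@zero_pred _ (secU E)) by exact: submod_zero.
have [|||e [_ [ev [_ _ en0 evphi evE]]]] :=
    @eigenvector_point k _ (scalU X) (secU E) xU yU (span_of (fun _ : 'I_1 => m)) (@zero_pred _ _) m
    (@generatedU _ X) (submod_span _) sZ.
- exact: (span_gen (fun _ : 'I_1 => m) ord0).
- exact: m0.
- move=> g z [b ->]; have [q q0 [a' qE]] := cofinite_poly z (cofiniteU a0).
  exists q => //; rewrite big_ord_recl big_ord0 addr0 qE /zero_pred.
  by rewrite (mulrC a) -scalerA (scalerA a) (mulrC a) -scalerA am !scaler0.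
have {}evE b : b *: e = scalU X (ev b) *: e by apply/eqP; rewrite -subr_eq0; apply/eqP; exact: evE.
have [la [la0 laD laZ]] := residue_functional evphi (secU_fg E) en0 evE.
have lf := rank_one_linear evE laD laZ.
have [g lg gE] := extend_resU (secUV_y E) (f := fun x => resU E (scalU X (la x) *: e))
    (fun a u v => etrans (congr1 (resU E) (lf a u v)) (resU_lin _ _ _)).
have rE b : b *: resU E e = scalU X (ev b) *: resU E e.
  by rewrite -!(a_linearZ _ _ (@resU_lin _ _ E)) evE.
have unit_c c : c <> 0 -> scalU X c^-1 * scalU X c = 1 /\ scalV X c^-1 * scalV X c = 1.
  by move=> /eqP c0; rewrite -!rmorphM mulVf // !rmorph1.
have [y0|/eqP yn0] := eqVneq (ev yU) 0.
  have re0 : resU E e = 0.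
    by apply: y_inj; rewrite scaler0 rE y0 rmorph0 scale0r.
  have l0 (R : comNzRingType) (N : lmodType R) : a_linear (fun _ : N => 0 : N).
    by move=> *; rewrite scaler0 addr0.
  have cU x : 0 = resU E (scalU X (la x) *: e).
    by rewrite (a_linearZ _ _ (@resU_lin _ _ E)) re0 scaler0.
  have c0V (v : secV E) : 0 = resV E 0 by rewrite raddf0.
  have [c [cUc cV]] := sE (@Hom k X E E (pack_linear lf) (pack_linear (l0 _ (secV E)))
    (pack_linear (l0 _ (secUV E))) cU c0V).
  have [c0 sp] := rank_one_scalar en0 la0 cUc.
  split; first by exists e.
  exists 0 => v; exists 0; rewrite scaler0 -[v]scale1r -(unit_c c c0).2 -scalerA.
  by rewrite -cV scaler0.
have re0 : resU E e <> 0.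
  move=> /resU_ker[n]; rewrite evE => /(phi_eq0 en0) /eqP; rewrite rmorphXn expf_eq0 => /andP[_ /eqP].
  exact: yn0.
have evy0 n : (ev yU) ^+ n != 0 by rewrite expf_neq0 //; apply/eqP.
have yinv n c w : yU ^+ n *: w = scalU X c *: resU E e -> w = scalU X (c * (ev yU) ^- n) *: resU E e.
  move=> wE; apply: (@yn_inj _ _ _ n); rewrite wE.
  have -> : yU ^+ n *: (scalU X (c * (ev yU) ^- n) *: resU E e) =
      scalU X (c * (ev yU) ^- n) *: (yU ^+ n *: resU E e) by rewrite !scalerA mulrC.
  have e1 : c * (ev yU) ^- n * ev (yU ^+ n) = c by rewrite rmorphXn divfK.
  by rewrite (rE (yU ^+ n)) scalerA -(rmorphM (scalU X)) e1.
have resU1 : resU E e = scalU X 1 *: resU E e by rewrite rmorph1 scale1r.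
have [v0 v0E] : exists v, resV E v = resU E e.
  have [n [v vE]] := resV_surj (resU E e); exists (scalV X ((ev yU) ^+ n) *: v).
  rewrite resV_scal (yinv n 1 _ (etrans (esym vE) resU1)) scalerA -rmorphM mul1r divff //.
pose s0 := 1 * (ev yU) ^- 1; pose t0 := ev xU * (ev yU) ^- 1.
have kdiff b c : resV E (b *: v0) = scalU X c *: resU E e -> resV E ((b - scalV X c) *: v0) = 0.
  by move=> bE; rewrite scalerBl (raddfB (resV E)) bE (@resV_scal _ _ E) v0E subrr.
have ks : resV E ((sV - scalV X s0) *: v0) = 0.
  by apply: kdiff; apply: (yinv 1%N 1); rewrite expr1 resV_s v0E.
have kt : resV E ((tV - scalV X t0) *: v0) = 0.
  by apply: kdiff; apply: (yinv 1%N); rewrite expr1 resV_t v0E (rE xU).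
have [n1 sn1] := resV_ker ks; have [n2 sn2] := resV_ker kt.
pose e' := scalV X ((ev yU) ^+ (n1 + n2)) *: (sV ^+ (n1 + n2) *: v0).
have re' : resV E e' = resU E e.
  have e1 := etrans (resV_sn (n1 + n2) v0) (etrans v0E resU1).
  by rewrite resV_scal (yinv _ _ _ e1) scalerA -rmorphM mul1r divff.
have comm (b b' c : V) (z : secV E) : b *: (b' *: (c *: z)) = b' *: (c *: (b *: z)).
  by rewrite !scalerA; congr (_ *: _); ring.
have kill b n : (n <= n1 + n2)%N -> sV ^+ n *: (b *: v0) = 0 -> b *: e' = 0.
  move=> /subnK nN z; rewrite /e' comm; move: (scalV X _) => c; rewrite -nN exprD.
  by rewrite -[X in c *: X]scalerA z !scaler0.
have se' : sV *: e' = scalV X s0 *: e'.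
  by apply/eqP; rewrite -subr_eq0 -scalerBl (kill _ _ (leq_addr _ _) sn1).
have te' : tV *: e' = scalV X t0 *: e'.
  by apply/eqP; rewrite -subr_eq0 -scalerBl (kill _ _ (leq_addl _ _) sn2).
clearbody e'.
have ev' b : exists c, b *: e' = scalV X c *: e'.
  elim/generatedV: b => [c|b b' [c cE] [c' c'E]|b [c cE]|b [c cE]].
  - by exists c.
  - by exists (c + c'); rewrite scalerDl cE c'E -scalerDl -rmorphD.
  - by exists (c * s0); rewrite -scalerA cE scalerA mulrC -scalerA se' scalerA -rmorphM.
  - by exists (c * t0); rewrite -scalerA cE scalerA mulrC -scalerA te' scalerA -rmorphM.
have [ev2 ev2E] := choice ev'.
have gW w : exists c, g w = scalU X c *: resU E e.
  have [n [x xE]] := resU_surj w; exists (la x * (ev yU) ^- n); apply: yinv.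
  by rewrite -(a_linearZ _ _ lg) xE gE (a_linearZ _ _ (@resU_lin _ _ E)).
have /choice[mu muE] : forall v, exists c, g (resV E v) = scalU X c *: resU E e by move=> v; exact: gW.
have inj_e c c' : scalU X c *: resU E e = scalU X c' *: resU E e -> c = c'.
  move=> h; apply/eqP; rewrite -subr_eq0; apply/eqP; apply: (phi_eq0 (phi := scalU X) re0).
  by rewrite (rmorphB (scalU X)) scalerBl h subrr.
have muD u v : mu (u + v) = mu u + mu v.
  by apply: inj_e; rewrite -muE raddfD (a_linearD _ _ lg) !muE -scalerDl -rmorphD.
have muZ b v : mu (b *: v) = ev2 b * mu v.
  have [n [a' br]] := bridge_onto b.
  have e1 : yU ^+ n *: (scalU X (ev2 b) *: resU E e) = a' *: resU E e.
    by rewrite -re' -(@resV_scal _ _ E) -ev2E (bridge_act br).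
  apply: inj_e; apply: (@yn_inj _ _ _ n).
  rewrite -muE -(a_linearZ _ _ lg) (bridge_act br) (a_linearZ _ _ lg) muE.
  transitivity (scalU X (mu v) *: (a' *: resU E e)); first by rewrite !scalerA mulrC.
  by rewrite -e1 (rmorphM (scalU X)) !scalerA; congr (_ *: _); ring.
have lV : a_linear (fun v => scalV X (mu v) *: e').
  move=> b u v; rewrite muD muZ (rmorphD (scalV X)) (rmorphM (scalV X)) scalerDl; congr (_ + _).
  by rewrite [in LHS]mulrC -scalerA -ev2E !scalerA [in LHS]mulrC.
have cV v : g (resV E v) = resV E (scalV X (mu v) *: e').
  by rewrite resV_scal re' muE.
have [c [cUc cVc]] := sE (@Hom k X E E (pack_linear lf) (pack_linear lV) (pack_linear lg) gE cV).
have [c0 sp] := rank_one_scalar en0 la0 cUc.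
split; first by exists e.
exists e' => v; exists (c^-1 * mu v).
by rewrite rmorphM -scalerA (cVc v : scalV X (mu v) *: e' = _) scalerA (unit_c c c0).2 scale1r.
Qed.

Lemma simple_torsion_free E : simple E -> torsion_free E \/ small E.
Proof.
move=> sE; have [sm|ns] := pselect (small E); first by right.
left; split=> [a m a0 am|v v0]; apply: contrapT => nz; apply: ns.
  by apply: simple_torsionU => //; exists a, m.
by apply: simple_torsionV => //; exists v.
Qed.

(** Over [U] a torsion sheaf; this passes to quotients and subobjects of powers. *)
Definition annihilated E := exists2 a : U, a <> 0 & forall m : secU E, a *: m = 0.

Lemma small_annihilated E : small E -> annihilated E.
Proof.
move=> [[e eP] _]; have [c cE] := eP (xU *: e).
exists (xU - scalU X c); first exact: xU_sub_neq0.
move=> m; have [z ->] := eP m.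
by rewrite scalerA mulrC -scalerA scalerBl cE subrr scaler0.
Qed.

Lemma annihilated_small E : hom_dim E E 1 -> annihilated E -> small E.
Proof.
move=> d1 [a a0 aE]; have [tf|//] := simple_torsion_free (hom_dim1_simple d1).
have zU (m : secU E) : m = 0 by apply: (tf.1 _ _ a0).
exfalso; have [] := hom_dim1_nonzero d1; apply=> // v; apply: tf.2.
have [n [m mE]] := resU_surj (resV E v).
by apply: (@yn_inj _ _ _ n); rewrite mE (zU m) linear0 scaler0.
Qed.

(** A morphism is determined by the images of two generators, each of which is a scalar. *)
Lemma hom_dim_small E F d : small E -> small F -> hom_dim E F d -> (d <= 2)%N.
Proof.
move=> [[e1 e1P] [e2 e2P]] [[f1 f1P] [f2 f2P]] [b bP]; rewrite leqNgt; apply/negP => d2.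
have /choice[al alP] : forall i, exists c, homU (b i) e1 = scalU X c *: f1 by move=> i; exact: f1P.
have /choice[be beP] : forall i, exists c, homV (b i) e2 = scalV X c *: f2 by move=> i; exact: f2P.
pose B (i : 'I_d) (j : 'I_2) : k := if j == ord0 then al i else be i.
have [c [i ci] cB] := dependent_rows (@field_is_domain k) B d2.
have cal : \sum_i c i * al i = 0 by have := cB ord0.
have cbe : \sum_i c i * be i = 0 by have := cB (lift ord0 ord0).
have [f fE] := hom_of_ker (submod0 (submod_hom_ker E F)).
have fU m : homU f m = 0 by exact: (congr1 (fun t => t.1.1 m) fE).
have fV v : homV f v = 0 by exact: (congr1 (fun t => t.1.2 v) fE).
have [c0 [_ cu]] := bP f.
suff e0 : \row_i c i = 0 :> 'rV[k]_d by apply: ci; have := congr1 (fun r : 'rV[k]_d => r 0 i) e0; rewrite !mxE.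
transitivity c0; [symmetry|]; apply: cu; split=> m.
- rewrite fU; have [z ->] := e1P m.
  rewrite (eq_bigr (fun i => scalU X (z * (c i * al i)) *: f1)) => [|j _].
    by rewrite -scaler_suml -rmorph_sum -mulr_sumr cal mulr0 rmorph0 scale0r.
  by rewrite mxE (a_linearZ _ _ (@homU_lin _ _ _ _ (b j))) alP !(rmorphM (scalU X)) !scalerA mulrA [_ * scalU X z]mulrC.
- rewrite fV; have [z ->] := e2P m.
  rewrite (eq_bigr (fun i => scalV X (z * (c i * be i)) *: f2)) => [|j _].
    by rewrite -scaler_suml -rmorph_sum -mulr_sumr cbe mulr0 rmorph0 scale0r.
  by rewrite mxE (a_linearZ _ _ (@homV_lin _ _ _ _ (b j))) beP !(rmorphM (scalV X)) !scalerA mulrA [_ * scalV X z]mulrC.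
- by rewrite fU big1 // => j _; rewrite mxE -scalUE rmorph0 scale0r.
- by rewrite fV big1 // => j _; rewrite mxE -scalVE rmorph0 scale0r.
Qed.

End SimpleTorsion.

(** * Elliptic helices *)

Section Helix.
Variables (k : closedFieldType) (X : elliptic_curve k).
Implicit Types F G : coh X.

Lemma power_annihilated F n : annihilated F -> annihilated (power F n).
Proof. by move=> [a a0 aF]; exists a => // m; apply/ffunP => i; rewrite !ffunE aF. Qed.

Lemma torsion_free_nonzero F : torsion_free F -> hom_dim F F 1 -> exists m : secU F, m <> 0.
Proof.
move=> tf d1; apply: contrapT => nz.
have zU (m : secU F) : m = 0 by apply: contrapT => m0; apply: nz; exists m.
have [] := hom_dim1_nonzero d1; apply=> // v; apply: tf.2.
have [n [m mE]] := resU_surj (resV F v).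
by apply: (@yn_inj _ _ _ n); rewrite mE (zU m) linear0 scaler0.
Qed.

(** The powers [F ^ rG] and [G ^ rF] have the same rank, so the indices of [Hom(F, -)] on them
    are compared by their Euler characteristics; on the first one the index is zero. *)
Theorem riemann_roch F G rF rG a b a' b' p q :
  torsion_free F -> (exists m : secU F, m <> 0) -> near_basis (secU F) rF ->
  torsion_free G -> near_basis (secU G) rG -> (0 < rF)%N ->
  cech_index F a b -> cech_index G a' b' -> hom_index F F 1 1 -> hom_index F G p q ->
  (p%:Z - q%:Z = rF%:Z * (a'%:Z - b'%:Z) - rG%:Z * (a%:Z - b%:Z))%R.
Proof.
move=> tf nz nb tfG nbG rF0 cF cG iF iG.
have [a1 [b1 [c1 e1]]] := power_cech_index rG cF.
have [a2 [b2 [c2 e2]]] := power_cech_index rF cG.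
have [p1 [q1 [i1 f1]]] := power_hom_index rG iF.
have [p2 [q2 [i2 f2]]] := power_hom_index rF iG.
have nb1 := power_near_basis rG nb; have nb2 := power_near_basis rF nbG.
rewrite mulnC in nb1.
have [p3 [q3 [i3 f3]]] := index_same_rank tf nz nb (power_torsion_free rG tf)
  (power_torsion_free rF tfG) nb1 nb2 c1 c2 i1.
have sp : submodule (@hom_pairs _ _ F (power G rF) (@top_pred _) (@top_pred _)).
  by apply: submod_hom_pairs; exact: submod_top.
have [e3 e4] := ker_coker_uniq sp i2 i3; rewrite -e3 -e4 f1 f2 e1 e2 !subrr mulr0 subr0 in f3.
by apply: (@mulfI _ rF%:Z) => //; case: rF rF0 {nb nb1 nb2 c2 i2 e2 f2 i3 sp f3}.
Qed.

Variables (E : int -> coh X) (helix : two_periodic_elliptic_helix E).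

Lemma helix_mutation i : exists n (b : 'I_n -> hom (E (i - 1)) (E i)) (j : hom (E (i - 2)) (power (E (i - 1)) n)),
  is_hom_basis b /\ short_exact j (evaluation b).
Proof. by case: helix => _ _ _ h; exact: (h i). Qed.

Lemma helix_hom_dim1 i : hom_dim (E i) (E i) 1.
Proof. by case: helix => /(_ i)[]. Qed.

Lemma helix_ext1_line i : ext1_line (E i) (E i).
Proof. by case: helix => /(_ i)[]. Qed.

(** Torsion spreads forwards along the quotients and backwards along the kernels of the
    evaluation maps. *)
Lemma helix_annihilated i j : annihilated (E i) -> annihilated (E j).
Proof.
have up l : annihilated (E l) -> annihilated (E (l + 1)).
  move=> aE; have := helix_mutation (l + 1); rewrite addrK => -[n [b [inc [_ ex]]]].
  have [c c0 cE] := power_annihilated n aE; exists c => // m.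
  have [_ [eU _] _ _] := ex; have [m' <-] := eU m.
  by rewrite -(a_linearZ _ _ (@homU_lin _ _ _ _ (evaluation b))) cE linear0.
have down l : annihilated (E l) -> annihilated (E (l - 1)).
  move=> aE; have e2 : l + 1 - 2 = l - 1 by ring.
  have := helix_mutation (l + 1); rewrite addrK e2 => -[n [b [inc [_ ex]]]].
  have [c c0 cE] := power_annihilated n aE; exists c => // m.
  have [[iU _] _ _ _] := ex; apply: (inj0 iU).
  by rewrite (a_linearZ _ _ (@homU_lin _ _ _ _ inc)) cE.
move=> aE; have updown (n : nat) : annihilated (E (i + n%:Z)) /\ annihilated (E (i - n%:Z)).
  elim: n => [|n [IH1 IH2]]; first by have -> : i + 0%:Z = i by lia.
  have -> : i + n.+1%:Z = i + n%:Z + 1 by lia.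
  have -> : i - n.+1%:Z = i - n%:Z - 1 by lia.
  by split; [exact: up | exact: down].
have [u v] := updown `|j - i|%N.
have [->|->] // : j = i + `|j - i|%N%:Z \/ j = i - `|j - i|%N%:Z by lia.
Qed.

Variables (d : nat) (d_dim : hom_dim (E (-1)) (E 0) d) (d_gt2 : (2 < d)%N).

(** Otherwise all terms are skyscrapers, between which there are too few morphisms. *)
Lemma helix_torsion_free i : torsion_free (E i).
Proof.
have [//|sm] := simple_torsion_free (hom_dim1_simple (helix_hom_dim1 i)).
have all_small j : small (E j).
  by apply: annihilated_small (helix_hom_dim1 j) _; apply: helix_annihilated (small_annihilated sm).
by have := hom_dim_small (all_small _) (all_small _) d_dim; rewrite leqNgt d_gt2.
Qed.

(** Additivity on the sequence of a mutation gives both recurrences, with the coefficient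
    [n i], the dimension of the space of morphisms from [E (i - 1)] to [E i]. By Riemann-Roch
    [n i] is the determinant of the last equation, and by the recurrences this determinant
    does not depend on [i]. *)
Theorem helix_numbers : exists (r : int -> nat) (chi : int -> int), forall i,
  [/\ (0 < r i)%N,
      slope (E i) = (chi i)%:~R / (r i)%:R - (euler_char_structure_sheaf X)%:~R,
      (r i)%:Z + (r (i - 2))%:Z = d%:Z * (r (i - 1))%:Z,
      chi i + chi (i - 2) = d%:Z * chi (i - 1) &
      (r (i - 1))%:Z * chi i - (r i)%:Z * chi (i - 1) = d%:Z].
Proof.
have tf := helix_torsion_free.
have nz i := torsion_free_nonzero (tf i) (helix_hom_dim1 i).
have /choice[r rP] : forall i, exists r, near_basis (secU (E i)) r by move=> i; exact: tf_near_basis.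
have r0 i : (0 < r i)%N.
  rewrite lt0n; apply/eqP => ri; have := rP i; rewrite ri => -[m [h [h0 _ sp]]].
  have [x x0] := nz i; apply: x0; apply: ((tf i).1 _ _ h0).
  by have [a ->] := sp x; rewrite big_ord0.
have /choice[ab abP] : forall i, exists ab : nat * nat, cech_index (E i) ab.1 ab.2.
  move=> i; have [a [b iE]] := cech_index_exists (tf i) (nz i) (hom_dim1_simple (helix_hom_dim1 i)).
  by exists (a, b).
pose chi i : int := (ab i).1%:Z - (ab i).2%:Z.
have /choice[n nP] : forall i, exists n, [/\ hom_dim (E (i - 1)) (E i) n,
    (r i)%:Z + (r (i - 2))%:Z = n%:Z * (r (i - 1))%:Z &
    chi i + chi (i - 2) = n%:Z * chi (i - 1)].
  move=> i; have [n [b [j [bP ex]]]] := helix_mutation i; exists n; split; first by exists b.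
    have nb := near_basis_exact ex (rP _) (rP _).
    have nb' := power_near_basis n (rP (i - 1)).
    have := near_basis_uniq (@domainU _ X) nb nb'; lia.
  have [a' [b' [c e]]] := cech_index_exact ex (abP _) (abP _).
  have [a2 [b2 [c2 e2]]] := power_cech_index n (abP (i - 1)).
  have tt : submodule (fun _ : ((restr (scalU X) (secU (power (E (i - 1)) n))) *
      (restr (scalV X) (secV (power (E (i - 1)) n))))%type => True) by exact: submod_top.
  have [e3 e4] := ker_coker_uniq tt c c2; subst a2 b2.
  by rewrite -e2 /chi; lia.
have det i : (r (i - 1))%:Z * chi i - (r i)%:Z * chi (i - 1) = (n i)%:Z.
  have [dn _ _] := nP i.
  have va : ext_vanishes 1 (E (i - 1)) (E i) by case: helix => _ h _ _; apply: h; lia.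
  have ii := self_index (tf (i - 1)) (nz _) (helix_hom_dim1 _) (helix_ext1_line _).
  have := riemann_roch (tf (i - 1)) (nz _) (rP _) (tf i) (rP i) (r0 _) (abP _) (abP _) ii
    (hom_index_of_vanishing va dn).
  by rewrite subr0 => ->.
have nS i : n i = n (i - 1).
  have [_ e1 e2] := nP i; have h1 := det i; have h2 := det (i - 1).
  have e3 : i - 1 - 1 = i - 2 by ring.
  by rewrite e3 in h2; apply/eqP; rewrite -eqz_nat -h1 -h2; apply/eqP; nia.
have nd i : n i = d.
  have n0 : n 0 = d by have [dn _ _] := nP 0; exact: (hom_dim_uniq dn d_dim).
  have updown (m : nat) : n m%:Z = d /\ n (- m%:Z) = d.
    elim: m => [|m [IH1 IH2]]; first by rewrite oppr0.
    rewrite nS; have -> : m.+1%:Z - 1 = m by lia.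
    split=> //; rewrite -IH2 [in RHS]nS; congr n; lia.
  have [u v] := updown `|i|%N.
  by have [->|->] : i = `|i|%N%:Z \/ i = - `|i|%N%:Z by lia.
exists r, chi => i; have [_ e1 e2] := nP i; rewrite nd in e1 e2.
split=> //; first exact: slope_eq.
by rewrite det nd.
Qed.

End Helix.

(** * The limit of the slopes *)

(** A rational root would be an integer, by Gauss, and the product of the two roots is [1]. *)
Lemma quadratic_root_irrational (R : realType) (d : nat) (be : R) : (2 < d)%N ->
  be ^+ 2 - d%:R * be + 1 = 0 -> irrational be.
Proof.
move=> d2 root [q _ qE].
have eq : q ^+ 2 - d%:R * q + 1 = 0.
  apply: (fmorph_inj (ratr : {rmorphism rat -> R})).
  by rewrite !rmorphD rmorphN rmorphXn rmorphM rmorph_nat rmorph1 rmorph0 /= qE.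
set a := numq q; set b := denq q.
have b0 : b%:~R != 0 :> rat by rewrite intr_eq0 denq_neq0.
have ab : a ^+ 2 + b ^+ 2 = d%:Z * a * b.
  have aE : a%:~R = q * b%:~R :> rat := numqE q.
  have e : q ^+ 2 = d%:R * q - 1 by apply/eqP; rewrite -subr_eq0 -eq; apply/eqP; ring.
  apply: (@intr_inj rat); rewrite !expr2 !(intrD, intrM) aE -pmulrn.
  have -> : q * b%:~R * (q * b%:~R) = q ^+ 2 * (b%:~R * b%:~R) by ring.
  by rewrite e; ring.
have db : (b %| a * a)%Z.
  by apply/dvdzP; exists (d%:Z * a - b); rewrite mulrBl -ab; ring.
have cop : coprimez b a by rewrite /coprimez gcdzC; exact: coprime_num_den.
have b1 : b = 1.
  have : (b %| 1)%Z by move: db; rewrite Gauss_dvdzr // => db'; have := Gauss_dvdzr 1 cop; rewrite mulr1 => <-.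
  rewrite dvdz1 => /eqP; have := denq_gt0 q; rewrite -/b; lia.
clear db cop; rewrite b1 expr1n mulr1 in ab; move: d2 ab; rewrite -ltz_nat; move: d%:Z a => z y z2 yz.
have y0 : 0 < y by nia.
have yz' : y < z by nia.
have : (y - 1) * (z - y - 1) = 2 - z by move: yz; rewrite expr2; lia.
nia.
Qed.

(** Let [be] be the smaller root of [z ^ 2 - d z + 1]. The combination [x n] of the two
    sequences is multiplied by [be] in each step, so it tends to zero, and [x n / (u n * B)] is
    the distance of the quotient from its limit [A / B]. *)
Lemma recurrence_limit (R : realType) (d : nat) (u : nat -> nat) (v : nat -> int) : (2 < d)%N ->
  (forall n, (0 < u n)%N) ->
  (forall n, (u n.+2)%:Z + (u n)%:Z = d%:Z * (u n.+1)%:Z) ->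
  (forall n, v n.+2 + v n = d%:Z * v n.+1) ->
  (u 1%N)%:Z * v 0%N - (u 0%N)%:Z * v 1%N <> 0 ->
  exists l : R, (fun n => (v n)%:~R / (u n)%:R) @ \oo --> l /\ irrational l.
Proof.
move=> d2 u0 uS vS det.
pose be : R := (d%:R - Num.sqrt (d%:R ^+ 2 - 4)) / 2.
have dR : 2 < d%:R :> R by rewrite ltr_nat.
have D0 : 0 < (d%:R : R) ^+ 2 - 4 by nra.
have sq : Num.sqrt ((d%:R : R) ^+ 2 - 4) ^+ 2 = d%:R ^+ 2 - 4 by rewrite sqr_sqrtr // ltW.
have s0 : 0 < Num.sqrt ((d%:R : R) ^+ 2 - 4) by rewrite sqrtr_gt0.
have root : be ^+ 2 - d%:R * be + 1 = 0.
  by rewrite /be; move: (Num.sqrt _) sq => s sq; field: sq.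
have irr := quadratic_root_irrational d2 root.
have be0 : 0 < be by rewrite /be divr_gt0 // subr_gt0; nra.
have be1 : be < 1 by rewrite /be ltr_pdivrMr // mul1r; nra.
move: be root irr be0 be1 {D0 sq s0} => be root irr be0 be1.
pose U n : R := (u n)%:R; pose V n : R := (v n)%:~R.
have US n : U n.+2 + U n = d%:R * U n.+1.
  have := congr1 (fun z : int => z%:~R : R) (uS n); rewrite rmorphD rmorphM /=.
  by rewrite /U !pmulrn.
have VS n : V n.+2 + V n = d%:R * V n.+1.
  have := congr1 (fun z : int => z%:~R : R) (vS n); rewrite rmorphD rmorphM /=.
  by rewrite /V !pmulrn.
have irr_lin (a b : int) : a%:~R + b%:~R * be = 0 -> a = 0 /\ b = 0.
  move=> e; have [b0|b0] := eqVneq b 0.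
    by split=> //; move: e; rewrite b0 mul0r addr0 => /eqP; rewrite intr_eq0 => /eqP.
  exfalso; apply: irr; exists (- a%:~R / b%:~R) => //.
  rewrite rmorphM rmorphN fmorphV !rmorph_int.
  have b0' : b%:~R != 0 :> R by rewrite intr_eq0.
  by apply: (mulIf b0'); rewrite divfK // mulrC; apply/eqP; rewrite eq_sym -addr_eq0 addrC e.
pose A := V 1%N - be * V 0%N; pose B := U 1%N - be * U 0%N.
have B0 : B != 0.
  apply/eqP => e; have [] := irr_lin (u 1%N)%:Z (- (u 0%N)%:Z); last by have := u0 1%N; lia.
  by rewrite mulrNz mulNr -!pmulrn mulrC.
pose x n := V n * B - U n * A.
have xS n : x n = be ^+ n * x 0%N.
  suff [-> ] : x n = be ^+ n * x 0%N /\ x n.+1 = be * x n by [].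
  elim: n => [|n [IH1 IH2]].
    by rewrite expr0 mul1r; split=> //; rewrite /x /A /B; ring: root.
  split; first by rewrite IH2 IH1 exprS mulrA.
  have e1 : V n.+2 = d%:R * V n.+1 - V n by rewrite -VS addrK.
  have e2 : U n.+2 = d%:R * U n.+1 - U n by rewrite -US addrK.
  have e3 : x n.+2 = d%:R * x n.+1 - x n by rewrite /x e1 e2; ring.
  have e4 : x n.+1 = be * x n by exact: IH2.
  rewrite e3 e4; have : be ^+ 2 = d%:R * be - 1 by apply/eqP; rewrite -subr_eq0 -root; apply/eqP; ring.
  move=> e5; have -> : be * (be * x n) = be ^+ 2 * x n by ring.
  by rewrite e5; ring.
exists (A / B); split; last first.
  (* A rational limit makes [be] a root of a linear equation over the integers. *)
  move=> [q _ qE]; have e : A * (denq q)%:~R = B * (numq q)%:~R.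
    have qE' : A / B * (denq q)%:~R = (numq q)%:~R.
      by rewrite -qE -[X in _ = X](ratr_int R) numqE rmorphM /= ratr_int.
    by rewrite -qE' mulrA [B * _]mulrC divfK.
  pose a := v 1%N * denq q - (u 1%N)%:Z * numq q.
  pose b := (u 0%N)%:Z * numq q - v 0%N * denq q.
  have [a0 b0] : a = 0 /\ b = 0.
    apply: irr_lin; rewrite /a /b !(intrB, intrM) -!pmulrn.
    transitivity (A * (denq q)%:~R - B * (numq q)%:~R); last by rewrite e subrr.
    by rewrite /A /B /U /V; ring.
  have q0 := denq_neq0 q.
  apply: det; apply/eqP; rewrite -(mulIr_eq0 _ (mulIf q0)).
  move: a0 b0; rewrite /a /b; move: (numq q) (denq q) => z y a0 b0; nia.
pose c := `|x 0%N / B|.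
have U1 n : 1 <= U n by rewrite /U ler1n.
have bound n : `|V n / U n - A / B| <= c * be ^+ n.
  have -> : V n / U n - A / B = be ^+ n * (x 0%N / B) / U n.
    have Un0 : U n != 0 by rewrite pnatr_eq0 -lt0n u0.
    by rewrite mulrA -xS /x; field; rewrite ?Un0 ?B0.
  rewrite (normrM _ (U n)^-1) (normrM (be ^+ n)) -/c normfV (ger0_norm (exprn_ge0 _ (ltW be0))).
  rewrite (ger0_norm (le_trans ler01 (U1 n))) [be ^+ n * c]mulrC ler_piMr //.
    by apply: mulr_ge0; [exact: normr_ge0 | apply: exprn_ge0; exact: ltW].
  by rewrite invf_le1 // (lt_le_trans ltr01).
have g0 : geometric c be n @[n --> \oo] --> (0 : R).
  by apply: cvg_geometric; rewrite ger0_norm // ltW.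
apply: (@squeeze_cvgr _ _ _ _ (fun n => A / B - geometric c be n) (fun n => A / B + geometric c be n)).
- by near=> n; have := bound n; rewrite ler_distl.
- by rewrite -[X in _ --> X]subr0; apply: cvgB => //; exact: cvg_cst.
- by rewrite -[X in _ --> X]addr0; apply: cvgD => //; exact: cvg_cst.
Unshelve. all: by end_near.
Qed.

Theorem lemma3p3 (k : closedFieldType) (k_char0 : [pchar k] =i pred0)
    (X : elliptic_curve k) (E : int -> coh X)
    (E_helix : two_periodic_elliptic_helix E)
    (d : nat) (d_dim : hom_dim (E (-1)) (E 0) d) (d_gt2 : (2 < d)%N)
    (R : realType) :
  exists l : R,
    (fun n : nat => ratr (slope (E (- n%:Z))) : R) @ \oo --> l /\
    irrational l.
Proof.
have [r [chi num]] := helix_numbers E_helix d_dim d_gt2.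
pose u n := r (- n%:Z); pose v n := chi (- n%:Z).
have e1 n : - n.+1%:Z = - n%:Z - 1 by lia.
have e2 n : - n.+2%:Z = - n%:Z - 2 by lia.
have [|n|n||l [lim irr]] := @recurrence_limit R d u v d_gt2.
- by move=> n; have [] := num (- n%:Z).
- by rewrite /u e2 e1 addrC; have [] := num (- n%:Z).
- by rewrite /v e2 e1 addrC; have [] := num (- n%:Z).
- rewrite /u /v (e1 0%N); have [_ _ _ _] := num (- 0%:Z).
  by move=> ->; move: d_gt2; lia.
pose c := euler_char_structure_sheaf X.
exists (l - c%:~R); split.
  have -> : (fun n : nat => ratr (slope (E (- n%:Z))) : R) =
      (fun n => (v n)%:~R / (u n)%:R - c%:~R).
    apply/funext => n; have [_ -> _ _ _] := num (- n%:Z).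
    by rewrite rmorphB rmorphM fmorphV /= !ratr_int ratr_nat.
  by apply: cvgB => //; exact: cvg_cst.
move=> [q _ qE]; apply: irr; exists (q + c%:~R) => //.
by rewrite rmorphD /= ratr_int qE subrK.
Qed.
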